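(* Riemann ZMC examples in $\mathbb{L}^3$ foliated by spacelike circles (of non-constant radii) contained in timelike planes form a one-parameter family of surfaces depending on a parameter $\lambda\in\mathbb{R}$ and, up to a rigid motion, parametrize as $$X(q,v)=(x(q),m(q)\vec a)+\sqrt q\,(0,\sinh v,\cosh v),$$ where $\vec a=(a_2,a_3)\ne(0,0)$ and $$x(q)=\frac12\int^q\frac{du}{\sqrt{-\langle\vec a,\vec a\rangle u^3+\lambda u^2+u}},\qquad m(q)=\frac12\int^q\frac{u\,du}{\sqrt{-\langle\vec a,\vec a\rangle u^3+\lambda u^2+u}}.$$ The curve formed by the centers of the circles is contained in a plane and the surface is symmetric about this plane.
   Context: $\mathbb{L}^3$ is $\mathbb{R}^3$ with the metric $\langle,\rangle=dx_1^2+dx_2^2-dx_3^2$. A plane or surface is spacelike, timelike or lightlike where the induced metric is Riemannian, Lorentzian or degenerate; a curve is spacelike (timelike) if its tangent vectors $\vec v$ satisfy $\langle\vec v,\vec v\rangle>0$ ($<0$). The mean curvature $H$ is defined where the induced metric of a surface is non-degenerate; zero mean curvature (ZMC) means $H=0$. A circle is a non-degenerate planar curve of nonzero constant curvature; a spacelike circle in a plane $x_1=\text{const}$ is a hyperbola $s\mapsto p+r(0,\sinh s,\cosh s)$ with center $p$ and radius $r>0$. A Riemann ZMC example is a non-rotational surface with zero mean curvature foliated by pieces of circles contained in parallel planes. After a rigid motion the planes of the foliation are parallel to $x_1=0$; $q=r^2$, where $r$ is the radius of the circles, and $q>0$ ranges where the radicand is positive. The $x_2x_3$-plane carries the induced metric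 $dx_2^2-dx_3^2$, so $\langle\vec a,\vec a\rangle=a_2^2-a_3^2$. Symmetric about a plane means invariant under the reflection across that plane.
   Formalization: Symmetry is claimed for whole circles: one branch if ⟨a,a⟩<0, both hyperbola branches if ⟨a,a⟩>0 (one branch fails, e.g. a=(1,0)), and not for null a, whose plane has no reflection. The formula X(q,v) is asserted on pieces where r'≠0, with a up to sign. *)

(* Defs.v *)
From Stdlib Require Import Reals.
From Coquelicot Require Import Coquelicot.
Open Scope R_scope.

Definition L3 : Type := (R * R * R)%type.

Definition x1 (p : L3) : R := fst (fst p).
Definition x2 (p : L3) : R := snd (fst p).
Definition x3 (p : L3) : R := snd p.

Definition vadd (p q : L3) : L3 := (x1 p + x1 q, x2 p + x2 q, x3 p + x3 q).
Definition vscal (k : R) (p : L3) : L3 := (k * x1 p, k * x2 p, k * x3 p).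
Definition vsub (p q : L3) : L3 := vadd p (vscal (-1) q).
Definition vzero : L3 := (0, 0, 0).

Definition lprod (p q : L3) : R := x1 p * x1 q + x2 p * x2 q - x3 p * x3 q.

(* The Lorentzian cross product: lprod (lcross u v) w = det (u, v, w). *)
Definition lcross (u v : L3) : L3 :=
  (x2 u * x3 v - x3 u * x2 v,
   x3 u * x1 v - x1 u * x3 v,
   - (x1 u * x2 v - x2 u * x1 v)).

Definition rigid_motion (T : L3 -> L3) : Prop :=
  exists (A : L3 -> L3) (b : L3),
    (forall p q, A (vadd p q) = vadd (A p) (A q)) /\
    (forall k p, A (vscal k p) = vscal k (A p)) /\
    (forall p q, lprod (A p) (A q) = lprod p q) /\
    (forall p, T p = vadd (A p) b).

Definition is_open_interval (I : R -> Prop) : Prop :=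
  (exists t, I t) /\ open I /\
  (forall a b t, I a -> I b -> a <= t <= b -> I t).

Definition smooth_on (I : R -> Prop) (g : R -> R) : Prop :=
  forall (n : nat) (t : R), I t -> ex_derive_n g n t.

Definition smooth_curve_on (I : R -> Prop) (g : R -> L3) : Prop :=
  smooth_on I (fun t => x1 (g t)) /\
  smooth_on I (fun t => x2 (g t)) /\
  smooth_on I (fun t => x3 (g t)).

Definition vDerive (g : R -> L3) (t : R) : L3 :=
  (Derive (fun s => x1 (g s)) t,
   Derive (fun s => x2 (g s)) t,
   Derive (fun s => x3 (g s)) t).

Definition du (X : R -> R -> L3) (u v : R) : L3 := vDerive (fun s => X s v) u.
Definition dv (X : R -> R -> L3) (u v : R) : L3 := vDerive (fun s => X u s) v.

Definition coefE (X : R -> R -> L3) (u v : R) : R := lprod (du X u v) (du X u v).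
Definition coefF (X : R -> R -> L3) (u v : R) : R := lprod (du X u v) (dv X u v).
Definition coefG (X : R -> R -> L3) (u v : R) : R := lprod (dv X u v) (dv X u v).
Definition metric_det (X : R -> R -> L3) (u v : R) : R :=
  coefE X u v * coefG X u v - coefF X u v ^ 2.

Definition unit_normal (X : R -> R -> L3) (u v : R) : L3 :=
  let n := lcross (du X u v) (dv X u v) in
  vscal (/ sqrt (Rabs (lprod n n))) n.

(* Meaningful only where [metric_det X u v <> 0]; the factor [lprod N N] is
   -1 where the surface is spacelike and 1 where it is timelike. *)
Definition mean_curvature (X : R -> R -> L3) (u v : R) : R :=
  let N := unit_normal X u v in
  let e := lprod N (du (du X) u v) in
  let f := lprod N (dv (du X) u v) in
  let g := lprod N (dv (dv X) u v) in
  lprod N N / 2 *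
  ((e * coefG X u v - 2 * f * coefF X u v + g * coefE X u v) / metric_det X u v).

(* The surface may change causal type: H = 0 is required wherever H is
   defined, that is, off the points where the induced metric degenerates. *)
Definition zero_mean_curvature (D : R * R -> Prop) (X : R -> R -> L3) : Prop :=
  forall u v, D (u, v) -> metric_det X u v <> 0 -> mean_curvature X u v = 0.

Definition immersed (D : R * R -> Prop) (X : R -> R -> L3) : Prop :=
  forall u v, D (u, v) -> lcross (du X u v) (dv X u v) <> vzero.

Definition surface_image (D : R * R -> Prop) (X : R -> R -> L3) (p : L3) : Prop :=
  exists u v, D (u, v) /\ p = X u v.

(* Nontrivial smooth one-parameter groups of rigid motions fixing a line
   pointwise; the axis may have any causal character. *)
Definition rotation_group (phi : R -> L3 -> L3) : Prop :=
  (forall t, rigid_motion (phi t)) /\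
  (forall s t p, phi (s + t) p = phi s (phi t p)) /\
  (forall p, smooth_curve_on (fun _ => True) (fun t => phi t p)) /\
  (exists p0 d, d <> vzero /\
     forall t k, phi t (vadd p0 (vscal k d)) = vadd p0 (vscal k d)) /\
  (exists t p, phi t p <> p).

(* Invariance is only required for small parameters, so that open pieces of
   rotational surfaces are rotational. *)
Definition rotational (S : L3 -> Prop) : Prop :=
  exists phi, rotation_group phi /\
    forall p, S p -> exists delta, 0 < delta /\
      forall t, Rabs t < delta -> S (phi t p).

(* The plane spanned by [e] and [f] is timelike, and every timelike direction
   plane has such a basis. *)
Definition timelike_frame (e f : L3) : Prop :=
  lprod e e = 1 /\ lprod f f = -1 /\ lprod e f = 0.

(* For a timelike frame and r > 0: the spacelike circle of center p and radius
   r in the plane p + span (e, f); [hyperbola e f p (- r)] is the opposite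
   branch of the same hyperbola. *)
Definition hyperbola (e f p : L3) (r v : R) : L3 :=
  vadd p (vscal r (vadd (vscal (sinh v) e) (vscal (cosh v) f))).

(* The leaf at [u] is the piece { v | D (u, v) } of the circle of center [c u]
   and radius [r u] in the timelike plane c u + span (e, f); these planes are
   parallel because [e] and [f] do not depend on [u]. *)
Definition foliated_by_spacelike_circles (I : R -> Prop) (D : R * R -> Prop)
    (X : R -> R -> L3) (e f : L3) (c : R -> L3) (r : R -> R) : Prop :=
  is_open_interval I /\
  open D /\
  (forall u v, D (u, v) -> I u) /\
  (forall u, I u -> exists v, D (u, v)) /\
  (forall u v1 v2 v, D (u, v1) -> D (u, v2) -> v1 <= v <= v2 -> D (u, v)) /\
  timelike_frame e f /\
  smooth_curve_on I c /\
  smooth_on I r /\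
  (forall u, I u -> 0 < r u) /\
  (forall u v, D (u, v) -> X u v = hyperbola e f (c u) (r u) v).

Definition riemann_ZMC_example (I : R -> Prop) (D : R * R -> Prop)
    (X : R -> R -> L3) (e f : L3) (c : R -> L3) (r : R -> R) : Prop :=
  foliated_by_spacelike_circles I D X e f c r /\
  immersed D X /\
  zero_mean_curvature D X /\
  ~ rotational (surface_image D X).

Definition nonconstant_on (I : R -> Prop) (r : R -> R) : Prop :=
  ~ exists rho, forall u, I u -> r u = rho.

Definition lprod2 (a b : R * R) : R := fst a * fst b - snd a * snd b.

Definition radicand (a : R * R) (lam u : R) : R :=
  - lprod2 a a * u ^ 3 + lam * u ^ 2 + u.

(* The indefinite integrals are normalized to vanish at [q0]. *)
Definition x_int (a : R * R) (lam q0 q : R) : R :=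
  / 2 * RInt (fun u => / sqrt (radicand a lam u)) q0 q.
Definition m_int (a : R * R) (lam q0 q : R) : R :=
  / 2 * RInt (fun u => u / sqrt (radicand a lam u)) q0 q.

Definition riemann_center (a : R * R) (lam q0 q : R) : L3 :=
  (x_int a lam q0 q, m_int a lam q0 q * fst a, m_int a lam q0 q * snd a).

Definition riemann_surface (a : R * R) (lam q0 q v : R) : L3 :=
  vadd (riemann_center a lam q0 q) (vscal (sqrt q) (0, sinh v, cosh v)).

Definition admissible (a : R * R) (lam : R) (Q : R -> Prop) : Prop :=
  is_open_interval Q /\ forall q, Q q -> 0 < q /\ 0 < radicand a lam q.

Definition on_plane (p w y : L3) : Prop := lprod w (vsub y p) = 0.

(* A reflection exists only across a plane with non-degenerate metric, that
   is, with non-null normal [w]. *)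
Definition reflection (p w y : L3) : L3 :=
  vsub y (vscal (2 * lprod w (vsub y p) / lprod w w) w).

Definition symmetric_about (p w : L3) (S : L3 -> Prop) : Prop :=
  lprod w w <> 0 /\ forall y, S y <-> S (reflection p w y).

(* The surfaces swept out by the whole circles, as single branches and as
   hyperbolas with both branches. *)
Definition swept_branch (I : R -> Prop) (e f : L3) (c : R -> L3) (r : R -> R)
    (y : L3) : Prop :=
  exists u v, I u /\ y = hyperbola e f (c u) (r u) v.
Definition swept_full (I : R -> Prop) (e f : L3) (c : R -> L3) (r : R -> R)
    (y : L3) : Prop :=
  exists u v, I u /\
    (y = hyperbola e f (c u) (r u) v \/ y = hyperbola e f (c u) (- r u) v).

(* Main.v *)
Require Import Defs.
From Stdlib Require Import Reals Lra Psatz Classical ClassicalEpsilon.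
From Coquelicot Require Import Coquelicot.
Open Scope R_scope.

(* Complete the frame (e, f) by the unit normal n and write the centers as
   al n + be e + ga f.  On the circle at u the zero mean curvature equation is a
   linear relation between 1, sinh v and cosh v, so its three coefficients
   vanish.  The first two integrate to be' = a2 r^2 al', ga' = a3 r^2 al'; the
   third then has the first integral (r r')^2 = al'^2 radicand (r^2), and q = r^2
   as a parameter gives the two integrals.  If al' has a zero it vanishes
   identically and the surface is an open piece of a plane, which is
   rotational; if a = 0 the centers lie on a line and boosts preserve the
   surface.  Conversely, a rotation group has a Killing field b + om x p with
   om <> 0; were it tangent to the surface of (a, lam), the coefficients in
   sinh v and cosh v would force om = 0, or m constant, or <a, a> = 0 with
   6 radicand = q radicand', all of them impossible. *)

(** The equation H = 0 says nothing where the metric degenerates, so whole leaves may carry no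
    information at first; they have to be brought in by continuity in u. That al' vanishes
    everywhere or nowhere, and that r' cannot vanish on an interval, are both uniqueness statements
    for first-order equations; a Gronwall estimate proves them without any existence theory.

    The first integral comes from a multiplication by r', so it forgets the third equation where r'
    = 0; both equations are therefore kept. The square root takes one sign only whereas al' r' may
    have either; reversing the axis of the frame, that is replacing a by s a, absorbs this.

    In the converse, a rotational surface is invariant merely as a set: nothing provides a
    differentiable lift of an orbit to the parameters (q, v). Tangency of the Killing field thus
    requires an inverse function argument based on the monotonicity of x(q). *)

(** * Calculus on intervals of the real line *)

Definition convex (I : R -> Prop) : Prop :=
  forall a b t, I a -> I b -> a <= t <= b -> I t.

Lemma continuous_continuity_pt (f : R -> R) (x : R) :
  continuous f x -> continuity_pt f x.
Proof. intros H. apply continuity_pt_filterlim. exact H. Qed.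

Lemma continuity_pt_continuous (f : R -> R) (x : R) :
  continuity_pt f x -> continuous f x.
Proof. intros H. apply continuity_pt_filterlim. exact H. Qed.

Lemma is_derive_continuous (f : R -> R) (x l : R) :
  is_derive f x l -> continuous f x.
Proof. intros H. apply (ex_derive_continuous f x). exists l. exact H. Qed.

Lemma locally_Rabs_iff (x : R) (P : R -> Prop) :
  locally x P <-> exists d, 0 < d /\ forall y, Rabs (y - x) < d -> P y.
Proof.
  split.
  - intros [d Hd]. exists d. split; [apply cond_pos|]. intros y Hy. apply Hd. exact Hy.
  - intros [d [Hd HP]]. exists (mkposreal d Hd). intros y Hy. apply HP. exact Hy.
Qed.

Lemma continuous_gt_locally (f : R -> R) (x c : R) :
  continuous f x -> c < f x -> locally x (fun y => c < f y).
Proof.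
  intros Hf Hx. apply (Hf (fun y => c < y)). apply (open_gt c). exact Hx.
Qed.

Lemma continuous_lt_locally (f : R -> R) (x c : R) :
  continuous f x -> f x < c -> locally x (fun y => f y < c).
Proof.
  intros Hf Hx. apply (Hf (fun y => y < c)). apply (open_lt c). exact Hx.
Qed.

(** The difference quotients at h and - h are within |l| / 2 of l, so both have the sign of l, while
    the increments have opposite signs. Only the derivative at the single point x enters. *)
Lemma derive_sign_change (g : R -> R) (x l d : R) :
  is_derive g x l -> l <> 0 -> g x = 0 -> 0 < d ->
  exists h, 0 < h < d /\ g (x - h) * g (x + h) < 0.
Proof.
  intros Hg Hl H0 Hd. apply is_derive_Reals in Hg.
  assert (Hl2 : 0 < Rabs l / 2) by (pose proof (Rabs_pos_lt l Hl); lra).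
  destruct (Hg _ Hl2) as [del Hdel]. pose proof (cond_pos del) as Hp.
  set (h := Rmin del d / 2).
  assert (Hh : 0 < h /\ h < del /\ h < d).
  { unfold h. pose proof (Rmin_l del d). pose proof (Rmin_r del d).
    assert (0 < Rmin del d) by now apply Rmin_glb_lt. lra. }
  exists h. split; [lra|].
  assert (A1 := Hdel h ltac:(lra) ltac:(rewrite Rabs_pos_eq; lra)).
  assert (A2 := Hdel (- h) ltac:(lra) ltac:(rewrite Rabs_Ropp, Rabs_pos_eq; lra)).
  rewrite H0 in A1, A2.
  assert (E1 : g (x + h) = h * ((g (x + h) - 0) / h)) by (field; lra).
  assert (E2 : g (x - h) = - h * ((g (x + - h) - 0) / - h)).
  { replace (x - h) with (x + - h) by ring. field. lra. }
  set (s1 := (g (x + h) - 0) / h) in *. set (s2 := (g (x + - h) - 0) / - h) in *.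
  rewrite E1, E2.
  assert (0 < s1 * s2).
  { apply Rabs_def2 in A1. apply Rabs_def2 in A2.
    destruct (Rlt_dec 0 l).
    - rewrite Rabs_pos_eq in A1, A2 by lra. nra.
    - rewrite Rabs_left in A1, A2 by lra. nra. }
  assert (0 < h * h * (s1 * s2)) by (apply Rmult_lt_0_compat; nra). nra.
Qed.

Lemma continuous_nonzero_locally (f : R -> R) (x : R) :
  continuous f x -> f x <> 0 -> locally x (fun y => f y <> 0).
Proof.
  intros Hf Hx. apply (Hf (fun y => y <> 0)). apply (open_neq 0). exact Hx.
Qed.

Lemma derive_zero_const (I : R -> Prop) (f : R -> R) :
  convex I -> (forall t, I t -> is_derive f t 0) ->
  forall a b, I a -> I b -> f a = f b.
Proof.
  intros HI Hf.
  assert (H : forall a b, I a -> I b -> a < b -> f a = f b).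
  { intros a b Ha Hb Hab. apply (eq_is_derive f a b); [|exact Hab].
    intros t Ht. apply Hf. now apply (HI a b). }
  intros a b Ha Hb. destruct (Rtotal_order a b) as [L|[L|L]].
  - now apply H.
  - now subst.
  - symmetry. now apply H.
Qed.

Lemma derive_locally_zero (f : R -> R) (x l : R) :
  is_derive f x l -> locally x (fun y => f y = 0) -> l = 0.
Proof.
  intros Hf H0. apply is_derive_unique in Hf. rewrite <- Hf.
  rewrite (Derive_ext_loc f (fun _ => 0) x H0). apply Derive_const.
Qed.

Lemma IVT_zero (f : R -> R) (a b : R) :
  a <= b -> (forall t, a <= t <= b -> continuous f t) ->
  f a * f b <= 0 -> exists t, a <= t <= b /\ f t = 0.
Proof.
  intros Hab Hf Hs.
  destruct (Req_dec (f a) 0) as [E|Na]; [exists a; split; [lra|exact E]|].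
  destruct (Req_dec (f b) 0) as [E|Nb]; [exists b; split; [lra|exact E]|].
  assert (Hlt : a < b).
  { destruct Hab as [H|H]; [exact H|]. subst. exfalso. nra. }
  destruct (Rlt_dec (f a) 0) as [Ha|Ha].
  - destruct (Ranalysis5.IVT_interv f a b) as [z [Hz Ez]]; [| exact Hlt | exact Ha | nra |].
    + intros t Ht. apply continuous_continuity_pt. now apply Hf.
    + now exists z.
  - destruct (Ranalysis5.IVT_interv (fun t => - f t) a b) as [z [Hz Ez]];
      [| exact Hlt | lra | nra |].
    + intros t Ht. apply continuous_continuity_pt.
      apply (continuous_opp f). now apply Hf.
    + exists z. split; [exact Hz|lra].
Qed.

Lemma nonvanishing_same_sign (I : R -> Prop) (f : R -> R) :
  convex I -> (forall t, I t -> continuous f t) -> (forall t, I t -> f t <> 0) ->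
  forall a b, I a -> I b -> 0 < f a * f b.
Proof.
  intros HI Hc Hn.
  assert (H : forall a b, I a -> I b -> a <= b -> 0 < f a * f b).
  { intros a b Ha Hb Hab. destruct (Rlt_dec 0 (f a * f b)) as [L|L]; [exact L|].
    exfalso. destruct (IVT_zero f a b Hab) as [t [Ht E]].
    - intros t Ht. apply Hc. now apply (HI a b).
    - lra.
    - apply (Hn t); [now apply (HI a b)|exact E]. }
  intros a b Ha Hb. destruct (Rle_dec a b) as [L|L].
  - now apply H.
  - rewrite Rmult_comm. apply H; auto. lra.
Qed.

(** With K a maximum of k on the segment, f^2 exp (- 2 K t) has nonpositive derivative. It starts at
    0 and is nonnegative, so it is 0 at b. *)
Lemma gronwall_forward (f f' k : R -> R) (a b : R) :
  a <= b ->
  (forall t, a <= t <= b -> is_derive f t (f' t)) ->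
  (forall t, a <= t <= b -> continuous k t) ->
  (forall t, a <= t <= b -> Rabs (f' t) <= k t * Rabs (f t)) ->
  f a = 0 -> f b = 0.
Proof.
  intros Hab Hd Hk Hb H0.
  destruct (continuity_ab_maj k a b Hab) as [m [Hm _]].
  { intros t Ht. apply continuous_continuity_pt. now apply Hk. }
  set (K := k m) in *.
  set (g := fun t => f t ^ 2 * exp (- 2 * K * t)).
  assert (Hg : forall t, a <= t <= b ->
    is_derive g t ((2 * f t * f' t - 2 * K * f t ^ 2) * exp (- 2 * K * t))).
  { intros t Ht. unfold g. auto_derive.
    - exists (f' t). now apply Hd.
    - rewrite (is_derive_unique (fun x : R => f x) t (f' t)) by now apply Hd. ring. }
  destruct (MVT_gen g a b (fun t => (2 * f t * f' t - 2 * K * f t ^ 2) * exp (- 2 * K * t)))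
    as [t [Ht E]].
  { rewrite Rmin_left, Rmax_right by exact Hab. intros t Ht. apply Hg. lra. }
  { rewrite Rmin_left, Rmax_right by exact Hab. intros t Ht.
    apply continuous_continuity_pt. exact (is_derive_continuous _ _ _ (Hg t Ht)). }
  rewrite Rmin_left, Rmax_right in Ht by exact Hab.
  assert (Hneg : 2 * f t * f' t - 2 * K * f t ^ 2 <= 0).
  { specialize (Hb t Ht). specialize (Hm t Ht). fold K in Hm.
    assert (f t * f' t <= Rabs (f t) * Rabs (f' t)).
    { rewrite <- Rabs_mult. apply Rle_abs. }
    assert (Hs : f t ^ 2 = Rabs (f t) * Rabs (f t)).
    { rewrite <- Rabs_mult, Rabs_pos_eq; [ring|nra]. }
    pose proof (Rabs_pos (f t)). rewrite Hs.
    assert (Rabs (f' t) <= K * Rabs (f t)) by nra. nra. }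
  assert (Hga : g a = 0) by (unfold g; rewrite H0; ring).
  pose proof (exp_pos (- 2 * K * t)). pose proof (exp_pos (- 2 * K * b)).
  assert (Hgb : g b <= 0).
  { replace (g b) with (g b - g a) by lra. rewrite E.
    enough (0 <= - ((2 * f t * f' t - 2 * K * f t ^ 2)) * exp (- 2 * K * t) * (b - a)) by lra.
    apply Rmult_le_pos; [apply Rmult_le_pos|]; lra. }
  unfold g in Hgb. assert (f b ^ 2 <= 0) by nra. nra.
Qed.

Lemma gronwall_zero (I : R -> Prop) (f f' k : R -> R) (t0 : R) :
  convex I ->
  (forall t, I t -> is_derive f t (f' t)) ->
  (forall t, I t -> continuous k t) ->
  (forall t, I t -> Rabs (f' t) <= k t * Rabs (f t)) ->
  I t0 -> f t0 = 0 -> forall t, I t -> f t = 0.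
Proof.
  intros HI Hd Hk Hb I0 H0 t It. destruct (Rle_dec t0 t) as [L|L].
  - apply (gronwall_forward f f' k t0 t L); auto; intros s Hs;
      [apply Hd|apply Hk|apply Hb]; now apply (HI t0 t).
  - assert (J : forall s, - t0 <= s <= - t -> I (- s)).
    { intros s Hs. apply (HI t t0); auto. lra. }
    (* Backwards in time: the forward case for s -> f (- s) on [- t0, - t]. *)
    rewrite <- (Ropp_involutive t).
    apply (gronwall_forward (fun s => f (- s)) (fun s => - f' (- s)) (fun s => k (- s)) (- t0) (- t));
      [lra| | | |now rewrite Ropp_involutive].
    + intros s Hs. auto_derive.
      * exists (f' (- s)). now apply Hd, J.
      * rewrite (is_derive_unique (fun x : R => f x) (- s) (f' (- s))) by now apply Hd, J. ring.
    + intros s Hs. apply (continuous_comp Ropp k).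
      * apply (is_derive_continuous Ropp s (-1)). auto_derive; [trivial|ring].
      * apply Hk. now apply J.
    + intros s Hs. rewrite Rabs_Ropp. apply Hb. now apply J.
Qed.

(** * Hyperbolic functions *)

Lemma is_derive_sinh (x : R) : is_derive sinh x (cosh x).
Proof. apply is_derive_Reals. apply derivable_pt_lim_sinh. Qed.

Lemma is_derive_cosh (x : R) : is_derive cosh x (sinh x).
Proof. apply is_derive_Reals. apply derivable_pt_lim_cosh. Qed.

Lemma cosh_sq (x : R) : cosh x ^ 2 = 1 + sinh x ^ 2.
Proof.
  unfold cosh, sinh. assert (exp x * exp (- x) = 1).
  { rewrite <- exp_plus. replace (x + - x) with 0 by ring. apply exp_0. }
  nra.
Qed.

Lemma cosh_pos (x : R) : 0 < cosh x.
Proof. unfold cosh. pose proof (exp_pos x). pose proof (exp_pos (- x)). lra. Qed.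

Lemma sinh_plus (x y : R) : sinh (x + y) = sinh x * cosh y + cosh x * sinh y.
Proof. unfold sinh, cosh. rewrite Ropp_plus_distr, !exp_plus. field. Qed.

Lemma cosh_plus (x y : R) : cosh (x + y) = cosh x * cosh y + sinh x * sinh y.
Proof. unfold sinh, cosh. rewrite Ropp_plus_distr, !exp_plus. field. Qed.

Lemma sinh_opp (x : R) : sinh (- x) = - sinh x.
Proof. unfold sinh. rewrite Ropp_involutive. field. Qed.

Lemma cosh_opp (x : R) : cosh (- x) = cosh x.
Proof. unfold cosh. rewrite Ropp_involutive. field. Qed.

Lemma cosh_0 : cosh 0 = 1.
Proof. unfold cosh. rewrite Ropp_0, exp_0. field. Qed.

Lemma Rabs_sinh_lt_cosh (x : R) : Rabs (sinh x) < cosh x.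
Proof.
  pose proof (cosh_sq x). pose proof (cosh_pos x).
  apply Rabs_def1; nra.
Qed.

Lemma sinh_pos (x : R) : 0 < x -> 0 < sinh x.
Proof. intros H. rewrite <- sinh_0. now apply sinh_lt. Qed.

Lemma hyperbola_param (r y z : R) :
  0 < r -> 0 < z -> z ^ 2 - y ^ 2 = r ^ 2 ->
  exists v, y = r * sinh v /\ z = r * cosh v.
Proof.
  intros Hr Hz H. exists (arcsinh (y / r)).
  assert (E : y = r * sinh (arcsinh (y / r))).
  { rewrite sinh_arcsinh. field. lra. }
  set (v := arcsinh (y / r)) in *. split; [exact E|].
  pose proof (cosh_sq v). pose proof (cosh_pos v).
  assert ((z - r * cosh v) * (z + r * cosh v) = 0).
  { rewrite E in H. nra. }
  assert (0 < r * cosh v) by nra.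
  apply Rmult_integral in H2. destruct H2; lra.
Qed.

(** Comparing h with - h separates the even part a + c cosh + p sinh^2 from the odd part sinh (b + q
    cosh). Three values of h, namely 0, d / 3 and d / 2, then determine the coefficients, since cosh
    is injective on nonnegative numbers. *)
Lemma hyp_quadratic_independent (d a b c p q : R) :
  0 < d ->
  (forall h, Rabs h < d ->
     a + b * sinh h + c * cosh h + p * sinh h ^ 2 + q * (sinh h * cosh h) = 0) ->
  a = 0 /\ b = 0 /\ c = 0 /\ p = 0 /\ q = 0.
Proof.
  intros Hd H.
  assert (Hin : forall k, 0 < k < 1 -> Rabs (k * d) < d).
  { intros k Hk. rewrite Rabs_pos_eq; nra. }
  assert (Hev : forall k, 0 < k < 1 ->
    a + c * cosh (k * d) + p * sinh (k * d) ^ 2 = 0 /\ b + q * cosh (k * d) = 0).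
  { intros k Hk. pose proof (H _ (Hin k Hk)) as H1.
    assert (H2 : Rabs (- (k * d)) < d) by (rewrite Rabs_Ropp; now apply Hin).
    apply H in H2. rewrite sinh_opp, cosh_opp in H2.
    assert (0 < sinh (k * d)) by (apply sinh_pos; nra).
    split; [nra|].
    assert (sinh (k * d) * (b + q * cosh (k * d)) = 0) by nra.
    apply Rmult_integral in H3. destruct H3; lra. }
  pose proof (H 0) as H0. rewrite Rabs_R0, sinh_0, cosh_0 in H0. specialize (H0 Hd).
  assert (Hc : forall x y, 0 < x < y -> cosh x < cosh y).
  { intros x y Hxy. assert (0 < sinh x) by (apply sinh_pos; lra).
    assert (sinh x < sinh y) by (apply sinh_lt; lra).
    pose proof (cosh_sq x). pose proof (cosh_sq y).
    pose proof (cosh_pos x). pose proof (cosh_pos y). nra. }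
  destruct (Hev (/ 3)) as [E1 O1]; [lra|].
  destruct (Hev (/ 2)) as [E2 O2]; [lra|].
  assert (L12 : cosh (/ 3 * d) < cosh (/ 2 * d)) by (apply Hc; nra).
  assert (L1 : 0 < sinh (/ 3 * d)) by (apply sinh_pos; nra).
  pose proof (cosh_sq (/ 3 * d)) as Q1. pose proof (cosh_sq (/ 2 * d)) as Q2.
  pose proof (cosh_pos (/ 3 * d)) as P1.
  set (C1 := cosh (/ 3 * d)) in *. set (C2 := cosh (/ 2 * d)) in *.
  set (S1 := sinh (/ 3 * d)) in *. set (S2 := sinh (/ 2 * d)) in *.
  assert (G1 : 1 < C1) by nra.
  assert (Hz : forall x, x * (C2 - C1) = 0 -> x = 0).
  { intros x Hx. apply Rmult_integral in Hx. destruct Hx; [assumption|lra]. }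
  assert (q = 0) by (apply Hz; lra).
  (* At h = 0 the relation reads a + c = 0; subtracting it leaves the factor cosh - 1, which is
     nonzero at the other two sample points. *)
  assert (F1 : (C1 - 1) * (c + p * (C1 + 1)) = 0).
  { replace (S1 ^ 2) with (C1 ^ 2 - 1) in E1 by lra. lra. }
  assert (F2 : (C2 - 1) * (c + p * (C2 + 1)) = 0).
  { replace (S2 ^ 2) with (C2 ^ 2 - 1) in E2 by lra. lra. }
  apply Rmult_integral in F1. apply Rmult_integral in F2.
  destruct F1 as [F1|F1]; [lra|]. destruct F2 as [F2|F2]; [lra|].
  assert (p = 0) by (apply Hz; lra). subst. repeat split; lra.
Qed.

Lemma hyp_linear_independent (d v0 a b c : R) :
  0 < d ->
  (forall v, Rabs (v - v0) < d -> a + b * sinh v + c * cosh v = 0) ->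
  a = 0 /\ b = 0 /\ c = 0.
Proof.
  intros Hd H.
  (* The addition theorems move the base point v0 to 0. They transform (b, c) by a matrix of
     determinant cosh^2 - sinh^2 = 1, which is inverted below. *)
  destruct (hyp_quadratic_independent d a (b * cosh v0 + c * sinh v0)
              (b * sinh v0 + c * cosh v0) 0 0 Hd) as [Ha [Hb [Hc _]]].
  { intros h Hh. specialize (H (v0 + h)).
    replace (v0 + h - v0) with h in H by ring. specialize (H Hh).
    rewrite sinh_plus, cosh_plus in H. lra. }
  pose proof (cosh_sq v0). split; [exact Ha|]. split.
  - replace b with (cosh v0 * (b * cosh v0 + c * sinh v0) - sinh v0 * (b * sinh v0 + c * cosh v0)
                    - b * (cosh v0 ^ 2 - (1 + sinh v0 ^ 2))) by ring.
    rewrite Hb, Hc, H0. ring.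
  - replace c with (cosh v0 * (b * sinh v0 + c * cosh v0) - sinh v0 * (b * cosh v0 + c * sinh v0)
                    - c * (cosh v0 ^ 2 - (1 + sinh v0 ^ 2))) by ring.
    rewrite Hb, Hc, H0. ring.
Qed.

(** * Lorentzian frames *)

Lemma L3_eq (p q : L3) : x1 p = x1 q -> x2 p = x2 q -> x3 p = x3 q -> p = q.
Proof.
  destruct p as [[p1 p2] p3], q as [[q1 q2] q3]; unfold x1, x2, x3; simpl.
  intros -> -> ->. reflexivity.
Qed.

Ltac vsimpl :=
  cbv [lprod vsub vadd vscal lcross vzero x1 x2 x3 fst snd] in *.

(* The frame is completed by the unit normal [lcross e f]. *)
Definition frame_map (e f p : L3) : L3 :=
  vadd (vscal (x1 p) (lcross e f)) (vadd (vscal (x2 p) e) (vscal (x3 p) f)).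

(** The third coordinate carries a minus sign because f has square -1. *)
Definition frame_coords (e f p : L3) : L3 :=
  (lprod (lcross e f) p, lprod e p, - lprod f p).

(** Lagrange's identity for the Lorentzian cross product: the square of [lcross e f] is minus the
    Gram determinant of e and f, and that determinant is -1. *)
Lemma frame_gram (e f : L3) : timelike_frame e f ->
  lprod (lcross e f) (lcross e f) = 1 /\
  lprod (lcross e f) e = 0 /\ lprod (lcross e f) f = 0.
Proof.
  intros [He [Hf Hef]].
  assert (E : lprod (lcross e f) (lcross e f)
              = - (lprod e e * lprod f f - lprod e f ^ 2)) by (vsimpl; ring).
  rewrite He, Hf, Hef in E. split; [lra|]. split; vsimpl; ring.
Qed.

Lemma frame_map_isometry (e f p q : L3) : timelike_frame e f ->
  lprod (frame_map e f p) (frame_map e f q) = lprod p q.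
Proof.
  intros H. destruct (frame_gram e f H) as [Hn [Hne Hnf]].
  destruct H as [He [Hf Hef]]. set (n := lcross e f) in *.
  replace (lprod (frame_map e f p) (frame_map e f q)) with
    (x1 p * x1 q * lprod n n + x2 p * x2 q * lprod e e + x3 p * x3 q * lprod f f
     + (x1 p * x2 q + x2 p * x1 q) * lprod n e + (x1 p * x3 q + x3 p * x1 q) * lprod n f
     + (x2 p * x3 q + x3 p * x2 q) * lprod e f).
  - rewrite Hn, He, Hf, Hne, Hnf, Hef. unfold lprod. ring.
  - unfold frame_map. fold n. clearbody n. vsimpl. ring.
Qed.

(** Both sides are determinants, and the matrix of the frame has determinant <n, n> = 1 for n =
    [lcross e f]. The isometry property alone would leave the sign open. *)
Lemma frame_map_det (e f p q w : L3) : timelike_frame e f ->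
  lprod (lcross (frame_map e f p) (frame_map e f q)) (frame_map e f w)
  = lprod (lcross p q) w.
Proof.
  intros H. destruct (frame_gram e f H) as [Hn _].
  transitivity (lprod (lcross p q) w * lprod (lcross e f) (lcross e f)).
  - unfold frame_map. set (n := lcross e f).
    (* Only one of the two copies of the cross product is kept abstract; the other has to unfold so
       that the factor is visibly the determinant of n, e, f. *)
    replace (lprod n n) with (lprod (lcross e f) n) by reflexivity.
    clearbody n. vsimpl. ring.
  - rewrite Hn. ring.
Qed.

Lemma frame_coords_map (e f p : L3) : timelike_frame e f ->
  frame_coords e f (frame_map e f p) = p.
Proof.
  intros H. destruct (frame_gram e f H) as [Hn [Hne Hnf]].
  destruct H as [He [Hf Hef]]. unfold frame_coords, frame_map.
  set (n := lcross e f) in *. clearbody n.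
  apply L3_eq.
  - transitivity (x1 p * lprod n n + x2 p * lprod n e + x3 p * lprod n f); [vsimpl; ring|].
    rewrite Hn, Hne, Hnf. ring.
  - transitivity (x1 p * lprod n e + x2 p * lprod e e + x3 p * lprod e f); [vsimpl; ring|].
    rewrite Hne, He, Hef. ring.
  - transitivity (- (x1 p * lprod n f + x2 p * lprod e f + x3 p * lprod f f)); [vsimpl; ring|].
    rewrite Hnf, Hef, Hf. ring.
Qed.

(* Cramer's rule, the determinant of the frame being 1. *)
Lemma frame_map_coords (e f p : L3) : timelike_frame e f ->
  frame_map e f (frame_coords e f p) = p.
Proof.
  intros H. destruct (frame_gram e f H) as [Hn _].
  destruct H as [He [Hf Hef]].
  (* Cramer's rule is a polynomial identity only after the Gram entries 1, -1 and 0 are put back: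
     [G1] inserts minus the Gram determinant on one side, [G2] the single entries on the other. *)
  assert (G1 : forall k, k = k * (- (lprod e e * lprod f f - lprod e f ^ 2))).
  { intros k. rewrite He, Hf, Hef. ring. }
  assert (G2 : frame_map e f (frame_coords e f p) =
     vadd (vscal (lprod (lcross e f) p) (lcross e f))
       (vadd (vscal (lprod e p * - lprod f f + lprod e f * lprod f p) e)
             (vscal (- lprod f p * lprod e e + lprod e f * lprod e p) f))).
  { unfold frame_map, frame_coords. rewrite He, Hf, Hef. apply L3_eq; vsimpl; ring. }
  rewrite G2. clear G2 Hn.
  apply L3_eq; [rewrite (G1 (x1 p))|rewrite (G1 (x2 p))|rewrite (G1 (x3 p))];
    clear; vsimpl; ring.
Qed.

Lemma frame_coords_isometry (e f p q : L3) : timelike_frame e f ->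
  lprod (frame_coords e f p) (frame_coords e f q) = lprod p q.
Proof.
  intros H. rewrite <- (frame_map_isometry e f) by exact H.
  now rewrite !frame_map_coords.
Qed.

Definition is_vderive (g : R -> L3) (t : R) (l : L3) : Prop :=
  is_derive (fun s => x1 (g s)) t (x1 l) /\
  is_derive (fun s => x2 (g s)) t (x2 l) /\
  is_derive (fun s => x3 (g s)) t (x3 l).

Lemma is_vderive_unique (g : R -> L3) (t : R) (l : L3) :
  is_vderive g t l -> vDerive g t = l.
Proof.
  intros [H1 [H2 H3]]. unfold vDerive.
  apply L3_eq; apply is_derive_unique; assumption.
Qed.

Lemma is_vderive_ext_loc (g h : R -> L3) (t : R) (l : L3) :
  locally t (fun s => g s = h s) -> is_vderive g t l -> is_vderive h t l.
Proof.
  intros He [H1 [H2 H3]]. split; [|split].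
  - apply (is_derive_ext_loc (fun s => x1 (g s))); [|exact H1].
    apply (filter_imp _ _ ) with (2 := He). intros s Hs. now rewrite Hs.
  - apply (is_derive_ext_loc (fun s => x2 (g s))); [|exact H2].
    apply (filter_imp _ _ ) with (2 := He). intros s Hs. now rewrite Hs.
  - apply (is_derive_ext_loc (fun s => x3 (g s))); [|exact H3].
    apply (filter_imp _ _ ) with (2 := He). intros s Hs. now rewrite Hs.
Qed.

Lemma is_derive_lin3 (k1 k2 k3 : R) (g1 g2 g3 : R -> R) (t l1 l2 l3 : R) :
  is_derive g1 t l1 -> is_derive g2 t l2 -> is_derive g3 t l3 ->
  is_derive (fun s => g1 s * k1 + (g2 s * k2 + g3 s * k3)) t (l1 * k1 + (l2 * k2 + l3 * k3)).
Proof.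
  intros H1 H2 H3. auto_derive.
  - repeat split; [now exists l1|now exists l2|now exists l3].
  - rewrite (is_derive_unique (fun x : R => g1 x) t l1), (is_derive_unique (fun x : R => g2 x) t l2),
      (is_derive_unique (fun x : R => g3 x) t l3) by assumption. ring.
Qed.

Lemma is_vderive_frame_map (e f : L3) (g : R -> L3) (t : R) (l : L3) :
  is_vderive g t l -> is_vderive (fun s => frame_map e f (g s)) t (frame_map e f l).
Proof.
  intros [H1 [H2 H3]]. split; [|split]; apply is_derive_lin3; assumption.
Qed.

Lemma is_derive_affine (a k t l : R) (g : R -> R) :
  is_derive g t l -> is_derive (fun x => a + k * g x) t (k * l).
Proof.
  intros H. auto_derive.
  - now exists l.
  - rewrite (is_derive_unique (fun x : R => g x) t l) by assumption. ring.
Qed.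

Lemma open_section_fst (D : R * R -> Prop) (u v : R) :
  open D -> D (u, v) -> locally u (fun s => D (s, v)).
Proof.
  intros HD Hp. destruct (HD _ Hp) as [eps He]. exists eps.
  intros s Hs. apply He. split; [exact Hs|apply ball_center].
Qed.

Lemma open_section_snd (D : R * R -> Prop) (u v : R) :
  open D -> D (u, v) -> locally v (fun s => D (u, s)).
Proof.
  intros HD Hp. destruct (HD _ Hp) as [eps He]. exists eps.
  intros s Hs. apply He. split; [apply ball_center|exact Hs].
Qed.

(** * Mean curvature of a surface swept out by circles *)

(** The numerator of the mean curvature, formed with the unnormalized normal: it is polynomial in
    the partial derivatives and makes sense also at degenerate points. *)
Definition zmc_expr (X : R -> R -> L3) (u v : R) : R :=
  let N := lcross (du X u v) (dv X u v) in
  lprod N (du (du X) u v) * coefG X u v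
  - 2 * lprod N (dv (du X) u v) * coefF X u v
  + lprod N (dv (dv X) u v) * coefE X u v.

Lemma lprod_normal (X : R -> R -> L3) (u v : R) :
  let N := lcross (du X u v) (dv X u v) in lprod N N = - metric_det X u v.
Proof. unfold metric_det, coefE, coefF, coefG. vsimpl. ring. Qed.

Lemma mean_curvature_zero_iff (X : R -> R -> L3) (u v : R) :
  metric_det X u v <> 0 -> (mean_curvature X u v = 0 <-> zmc_expr X u v = 0).
Proof.
  intros Hd. pose proof (lprod_normal X u v) as Hn. simpl in Hn.
  unfold mean_curvature, unit_normal, zmc_expr. cbv zeta.
  set (N := lcross (du X u v) (dv X u v)) in *.
  set (k := / sqrt (Rabs (lprod N N))).
  assert (Hk : k <> 0).
  { apply Rinv_neq_0_compat. apply Rgt_not_eq. apply sqrt_lt_R0.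
    apply Rabs_pos_lt. rewrite Hn. lra. }
  assert (Hl : forall w, lprod (vscal k N) w = k * lprod N w).
  { intros w. clearbody k N. vsimpl. ring. }
  assert (Hkk : lprod (vscal k N) (vscal k N) = k * k * - metric_det X u v).
  { rewrite <- Hn. clearbody k N. vsimpl. ring. }
  rewrite Hkk, !Hl.
  set (P := lprod N (du (du X) u v) * coefG X u v
    - 2 * lprod N (dv (du X) u v) * coefF X u v
    + lprod N (dv (dv X) u v) * coefE X u v).
  (* The factor <N, N> equals - k^2 times the metric determinant and cancels the denominator; the
     remaining k comes from the normal in the second fundamental form. *)
  match goal with |- ?l = 0 <-> _ => replace l with (- (k * k * k / 2) * P) end.
  2:{ unfold P. field. exact Hd. }
  split; intros H.
  - apply Rmult_integral in H. destruct H as [H|H]; [|exact H].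
    exfalso. assert (k * (k * k) <> 0) by (repeat apply Rmult_integral_contrapositive_currified; exact Hk).
    lra.
  - rewrite H. ring.
Qed.

Definition C2_data (I : R -> Prop) (g : R -> R) : Prop :=
  forall t, I t -> ex_derive g t /\ ex_derive (Derive g) t.

Section Sweep.

Variables (I : R -> Prop) (D : R * R -> Prop) (X : R -> R -> L3) (e f : L3).
Variables (al be ga r : R -> R).
Hypothesis HD : open D.
Hypothesis HDI : forall u v, D (u, v) -> I u.
Hypothesis Hef : timelike_frame e f.
Hypothesis HX : forall u v, D (u, v) ->
  X u v = frame_map e f (al u, be u + r u * sinh v, ga u + r u * cosh v).
Hypothesis Hal : C2_data I al.
Hypothesis Hbe : C2_data I be.
Hypothesis Hga : C2_data I ga.
Hypothesis Hr : C2_data I r.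

Lemma is_derive_sweep (b s : R -> R) (k t lb ls : R) :
  is_derive b t lb -> is_derive s t ls ->
  is_derive (fun x => b x + s x * k) t (lb + ls * k).
Proof.
  intros Hb Hs. auto_derive.
  - repeat split; [now exists lb|now exists ls].
  - rewrite (is_derive_unique (fun x : R => b x) t lb), (is_derive_unique (fun x : R => s x) t ls)
      by assumption. ring.
Qed.

Lemma du_sweep (u v : R) : D (u, v) ->
  du X u v = frame_map e f
    (Derive al u, Derive be u + Derive r u * sinh v, Derive ga u + Derive r u * cosh v).
Proof.
  intros Hp. pose proof (HDI _ _ Hp) as Hu. apply is_vderive_unique.
  apply (is_vderive_ext_loc (fun s => frame_map e f (al s, be s + r s * sinh v, ga s + r s * cosh v))).
  - apply (filter_imp (fun s => D (s, v))); [|now apply open_section_fst].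
    intros s Hs. symmetry. now apply HX.
  - apply is_vderive_frame_map. split; [|split]; cbn -[sinh cosh].
    + apply Derive_correct. now apply Hal.
    + apply is_derive_sweep; apply Derive_correct; [now apply Hbe|now apply Hr].
    + apply is_derive_sweep; apply Derive_correct; [now apply Hga|now apply Hr].
Qed.

Lemma dv_sweep (u v : R) : D (u, v) ->
  dv X u v = frame_map e f (0, r u * cosh v, r u * sinh v).
Proof.
  intros Hp. apply is_vderive_unique.
  apply (is_vderive_ext_loc (fun s => frame_map e f (al u, be u + r u * sinh s, ga u + r u * cosh s))).
  - apply (filter_imp (fun s => D (u, s))); [|now apply open_section_snd].
    intros s Hs. symmetry. now apply HX.
  - apply is_vderive_frame_map. split; [|split]; cbn -[sinh cosh].
    + apply (is_derive_const (al u)).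
    + apply is_derive_affine. apply is_derive_sinh.
    + apply is_derive_affine. apply is_derive_cosh.
Qed.

Lemma du_du_sweep (u v : R) : D (u, v) ->
  du (du X) u v = frame_map e f
    (Derive (Derive al) u, Derive (Derive be) u + Derive (Derive r) u * sinh v,
     Derive (Derive ga) u + Derive (Derive r) u * cosh v).
Proof.
  intros Hp. pose proof (HDI _ _ Hp) as Hu. apply is_vderive_unique.
  apply (is_vderive_ext_loc (fun s => frame_map e f
    (Derive al s, Derive be s + Derive r s * sinh v, Derive ga s + Derive r s * cosh v))).
  - apply (filter_imp (fun s => D (s, v))); [|now apply open_section_fst].
    intros s Hs. symmetry. now apply du_sweep.
  - apply is_vderive_frame_map. split; [|split]; cbn -[sinh cosh].
    + apply Derive_correct. now apply Hal.
    + apply is_derive_sweep; apply Derive_correct; [now apply Hbe|now apply Hr].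
    + apply is_derive_sweep; apply Derive_correct; [now apply Hga|now apply Hr].
Qed.

Lemma dv_du_sweep (u v : R) : D (u, v) ->
  dv (du X) u v = frame_map e f (0, Derive r u * cosh v, Derive r u * sinh v).
Proof.
  intros Hp. apply is_vderive_unique.
  apply (is_vderive_ext_loc (fun s => frame_map e f
    (Derive al u, Derive be u + Derive r u * sinh s, Derive ga u + Derive r u * cosh s))).
  - apply (filter_imp (fun s => D (u, s))); [|now apply open_section_snd].
    intros s Hs. symmetry. now apply du_sweep.
  - apply is_vderive_frame_map. split; [|split]; cbn -[sinh cosh].
    + apply (is_derive_const (Derive al u)).
    + apply is_derive_affine. apply is_derive_sinh.
    + apply is_derive_affine. apply is_derive_cosh.
Qed.

Lemma dv_dv_sweep (u v : R) : D (u, v) ->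
  dv (dv X) u v = frame_map e f (0, r u * sinh v, r u * cosh v).
Proof.
  intros Hp. apply is_vderive_unique.
  apply (is_vderive_ext_loc (fun s => frame_map e f (0, r u * cosh s, r u * sinh s))).
  - apply (filter_imp (fun s => D (u, s))); [|now apply open_section_snd].
    intros s Hs. symmetry. now apply dv_sweep.
  - apply is_vderive_frame_map. split; [|split]; cbn -[sinh cosh].
    + apply (is_derive_const 0).
    + apply is_derive_scal. apply is_derive_cosh.
    + apply is_derive_scal. apply is_derive_sinh.
Qed.

(** The component along [lcross e f] of the unnormalized normal, divided by r. *)
Definition normal_fst (u v : R) : R := Derive be u * sinh v - Derive ga u * cosh v - Derive r u.

Lemma metric_det_sweep (u v : R) : D (u, v) ->
  metric_det X u v = r u ^ 2 * (Derive al u ^ 2 - normal_fst u v ^ 2).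
Proof.
  intros Hp. unfold metric_det, coefE, coefF, coefG.
  rewrite (du_sweep u v Hp), (dv_sweep u v Hp), !frame_map_isometry by exact Hef.
  unfold normal_fst. vsimpl. pose proof (cosh_sq v) as E.
  set (S := sinh v) in *. set (C := cosh v) in *.
  clearbody S C. ring [E].
Qed.

(** Where al' and r are nonzero, this is - al'^2 r^3 times the derivative of b' / (al' r^2); hence
    its vanishing integrates at once. *)
Definition coef_lin (b : R -> R) (u : R) : R :=
  r u * (Derive (Derive al) u * Derive b u - Derive al u * Derive (Derive b) u)
  + 2 * Derive al u * Derive r u * Derive b u.

Definition coef_const (u : R) : R :=
  r u * (Derive al u * Derive (Derive r) u - Derive (Derive al) u * Derive r u)
  + Derive al u * (Derive al u ^ 2 + Derive be u ^ 2 - Derive ga u ^ 2 - Derive r u ^ 2).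

(** All terms of higher degree in sinh v and cosh v cancel or reduce by cosh^2 = 1 + sinh^2. This
    linearity is what makes one equation on a leaf equivalent to three equations in u. *)
Lemma zmc_expr_sweep (u v : R) : D (u, v) ->
  zmc_expr X u v = r u ^ 2 *
    (coef_const u + coef_lin be u * sinh v + - coef_lin ga u * cosh v).
Proof.
  intros Hp. unfold zmc_expr, coefE, coefF, coefG.
  rewrite (du_sweep u v Hp), (dv_sweep u v Hp), (du_du_sweep u v Hp), (dv_du_sweep u v Hp),
    (dv_dv_sweep u v Hp), !frame_map_det, !frame_map_isometry by exact Hef.
  unfold coef_const, coef_lin. vsimpl. pose proof (cosh_sq v) as E.
  set (S := sinh v) in *. set (C := cosh v) in *.
  clearbody S C. ring [E].
Qed.

Lemma immersed_sweep (u v : R) : D (u, v) -> 0 < r u ->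
  (lcross (du X u v) (dv X u v) <> vzero <->
   (Derive al u <> 0 \/ normal_fst u v <> 0)).
Proof.
  intros Hp Hr0. rewrite (du_sweep u v Hp), (dv_sweep u v Hp).
  set (p := (Derive al u, Derive be u + Derive r u * sinh v, Derive ga u + Derive r u * cosh v)).
  set (q := (0, r u * cosh v, r u * sinh v)).
  (* The form is non-degenerate, so a vector vanishes once its products with all w do; for a cross
     product these are determinants, which the frame map preserves. *)
  assert (Hz : lcross (frame_map e f p) (frame_map e f q) = vzero <-> lcross p q = vzero).
  { split; intros H.
    - assert (Hw : forall w, lprod (lcross p q) w = 0).
      { intros w. rewrite <- (frame_map_det e f) by exact Hef. rewrite H. vsimpl. ring. }
      pose proof (Hw (1, 0, 0)) as W1. pose proof (Hw (0, 1, 0)) as W2. pose proof (Hw (0, 0, 1)) as W3.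
      clear - W1 W2 W3. set (n := lcross p q) in *. clearbody n.
      apply L3_eq; vsimpl; lra.
    - assert (Hw : forall w, lprod (lcross (frame_map e f p) (frame_map e f q)) w = 0).
      { intros w. rewrite <- (frame_map_coords e f w) by exact Hef.
        rewrite frame_map_det by exact Hef. rewrite H. vsimpl. ring. }
      pose proof (Hw (1, 0, 0)) as W1. pose proof (Hw (0, 1, 0)) as W2. pose proof (Hw (0, 0, 1)) as W3.
      clear - W1 W2 W3. set (n := lcross _ _) in *. clearbody n.
      apply L3_eq; vsimpl; lra. }
  assert (Hc : lcross p q = vscal (r u)
     (normal_fst u v, - Derive al u * sinh v, - Derive al u * cosh v)).
  { unfold p, q, normal_fst. pose proof (cosh_sq v) as E.
    set (S := sinh v) in *. set (C := cosh v) in *. clearbody S C.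
    apply L3_eq; vsimpl; ring [E]. }
  rewrite Hz, Hc. pose proof (cosh_pos v). split.
  - intros Hn. destruct (Req_dec (Derive al u) 0) as [Ea|Ea]; [right|now left].
    intros Ew. apply Hn. rewrite Ea, Ew. apply L3_eq; vsimpl; ring.
  - intros Hn Hv. unfold vscal, vzero, x1, x2, x3 in Hv. cbn [fst snd] in Hv.
    injection Hv as E1 _ E3. destruct Hn as [Hn|Hn]; apply Hn.
    + apply Rmult_integral in E3. destruct E3 as [E3|E3]; [lra|].
      apply Rmult_integral in E3. destruct E3; lra.
    + apply Rmult_integral in E1. destruct E1; [lra|assumption].
Qed.

End Sweep.

(** * Smoothness *)

(** On I the n-th derivative of a member of F again coincides with a member, by induction on n.
    Smoothness thus reduces to exhibiting a class closed under differentiation, with no formula for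
    higher derivatives. *)
Lemma smooth_on_of_derivation (I : R -> Prop) (F : (R -> R) -> Prop) :
  open I ->
  (forall g, F g -> exists g', F g' /\ forall t, I t -> is_derive g t (g' t)) ->
  forall g, F g -> smooth_on I g.
Proof.
  intros HI HF.
  assert (H : forall n g, F g -> exists h, F h /\ forall t, I t -> Derive_n g n t = h t).
  { induction n as [|n IH]; intros g Hg.
    - exists g. split; [exact Hg|reflexivity].
    - destruct (IH g Hg) as [h [Fh Hh]]. destruct (HF h Fh) as [h' [Fh' Hd]].
      exists h'. split; [exact Fh'|]. intros t It. simpl.
      rewrite (Derive_ext_loc (Derive_n g n) h).
      + now apply is_derive_unique, Hd.
      + apply (filter_imp I); [exact Hh|now apply HI]. }
  intros g Hg [|n] t It; [exact Logic.I|].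
  destruct (H n g Hg) as [h [Fh Hh]]. destruct (HF h Fh) as [h' [_ Hd]].
  exists (h' t). apply (is_derive_ext_loc h); [|now apply Hd].
  apply (filter_imp I); [|now apply HI]. intros s Hs. symmetry. now apply Hh.
Qed.

Lemma smooth_on_lin3 (I : R -> Prop) (g1 g2 g3 : R -> R) (k1 k2 k3 : R) :
  open I -> smooth_on I g1 -> smooth_on I g2 -> smooth_on I g3 ->
  smooth_on I (fun t => k1 * g1 t + (k2 * g2 t + k3 * g3 t)).
Proof.
  intros HI H1 H2 H3.
  assert (Hs : forall k g, smooth_on I g -> smooth_on I (fun t => k * g t)).
  { intros k g Hg n t It. apply ex_derive_n_scal_l. now apply Hg. }
  assert (Hp : forall g h, smooth_on I g -> smooth_on I h -> smooth_on I (fun t => g t + h t)).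
  { intros g h Hg Hh n t It. apply ex_derive_n_plus;
      (apply (filter_imp I); [|now apply HI]); intros s Hs' k _; [now apply Hg|now apply Hh]. }
  apply Hp; [now apply Hs|]. apply Hp; now apply Hs.
Qed.

Lemma smooth_on_ext (I : R -> Prop) (g h : R -> R) :
  open I -> (forall t, I t -> g t = h t) -> smooth_on I g -> smooth_on I h.
Proof.
  intros HI E Hg n t It. apply (ex_derive_n_ext_loc g); [|now apply Hg].
  apply (filter_imp I); [exact E|now apply HI].
Qed.

Lemma smooth_on_C2 (I : R -> Prop) (g : R -> R) : smooth_on I g -> C2_data I g.
Proof.
  intros Hg t It. split; [exact (Hg 1%nat t It)|exact (Hg 2%nat t It)].
Qed.

Lemma smooth_on_continuous2 (I : R -> Prop) (g : R -> R) (t : R) :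
  smooth_on I g -> I t ->
  continuous g t /\ continuous (Derive g) t /\ continuous (Derive (Derive g)) t.
Proof.
  intros Hg It. repeat split.
  - apply (ex_derive_continuous g). exact (Hg 1%nat t It).
  - apply (ex_derive_continuous (Derive g)). exact (Hg 2%nat t It).
  - apply (ex_derive_continuous (Derive (Derive g))). exact (Hg 3%nat t It).
Qed.

(** * Boosts about a spacelike axis *)

Definition hyp_rot (t : R) (w : L3) : L3 :=
  (x1 w, x2 w * cosh t + x3 w * sinh t, x2 w * sinh t + x3 w * cosh t).

(** The axis is the line through p0 in the direction [lcross e f], orthogonal to the planes of the
    circles. *)
Definition boost (e f p0 : L3) (t : R) (p : L3) : L3 :=
  vadd p0 (frame_map e f (hyp_rot t (frame_coords e f (vsub p p0)))).

Lemma boost_frame_map (e f p0 w : L3) (t : R) : timelike_frame e f ->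
  boost e f p0 t (vadd p0 (frame_map e f w)) = vadd p0 (frame_map e f (hyp_rot t w)).
Proof.
  intros H. unfold boost.
  replace (vsub (vadd p0 (frame_map e f w)) p0) with (frame_map e f w).
  - now rewrite frame_coords_map.
  - set (q := frame_map e f w). clearbody q. apply L3_eq; vsimpl; ring.
Qed.

Lemma smooth_hyp (a b c : R) :
  smooth_on (fun _ => True) (fun t => a + b * sinh t + c * cosh t).
Proof.
  apply (smooth_on_of_derivation _ (fun g => exists a b c, g = fun t => a + b * sinh t + c * cosh t)).
  - apply open_true.
  - intros g (a' & b' & c' & ->). exists (fun t => 0 + c' * sinh t + b' * cosh t).
    split; [now exists 0, c', b'|]. intros t _.
    replace (0 + c' * sinh t + b' * cosh t) with (b' * cosh t + c' * sinh t) by ring.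
    apply (is_derive_plus (fun t => a' + b' * sinh t) (fun t => c' * cosh t)).
    + apply is_derive_affine, is_derive_sinh.
    + apply is_derive_scal, is_derive_cosh.
  - now exists a, b, c.
Qed.

Lemma frame_map_inj (e f p q : L3) : timelike_frame e f ->
  frame_map e f p = frame_map e f q -> p = q.
Proof.
  intros H E. rewrite <- (frame_coords_map e f p), <- (frame_coords_map e f q) by exact H.
  now rewrite E.
Qed.

Lemma rotation_group_boost (e f p0 : L3) :
  timelike_frame e f -> rotation_group (boost e f p0).
Proof.
  intros H.
  assert (Hr0 : forall p, exists w, p = vadd p0 (frame_map e f w)).
  { intros p. exists (frame_coords e f (vsub p p0)). rewrite frame_map_coords by exact H.
    apply L3_eq; vsimpl; ring. }
  split; [|split; [|split; [|split]]].
  - intros t.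
    exists (fun q => frame_map e f (hyp_rot t (frame_coords e f q))).
    exists (vsub p0 (frame_map e f (hyp_rot t (frame_coords e f p0)))).
    split; [|split; [|split]].
    + intros p q. unfold frame_map, frame_coords, hyp_rot.
      set (n := lcross e f). set (C := cosh t). set (S := sinh t). clearbody n C S.
      apply L3_eq; vsimpl; ring.
    + intros k p. unfold frame_map, frame_coords, hyp_rot.
      set (n := lcross e f). set (C := cosh t). set (S := sinh t). clearbody n C S.
      apply L3_eq; vsimpl; ring.
    + intros p q. rewrite frame_map_isometry by exact H.
      rewrite <- (frame_coords_isometry e f p q) by exact H.
      set (p' := frame_coords e f p). set (q' := frame_coords e f q).
      unfold hyp_rot. pose proof (cosh_sq t) as E.
      set (C := cosh t) in *. set (S := sinh t) in *. clearbody C S p' q'.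
      vsimpl. ring [E].
    + intros p. unfold boost, frame_map, frame_coords, hyp_rot.
      set (n := lcross e f). set (C := cosh t). set (S := sinh t). clearbody n C S.
      apply L3_eq; vsimpl; ring.
  - intros s t p. destruct (Hr0 p) as [w ->]. rewrite !boost_frame_map by exact H.
    do 2 f_equal. unfold hyp_rot. rewrite cosh_plus, sinh_plus.
    apply L3_eq; vsimpl; ring.
  - intros p. unfold boost.
    set (w := frame_coords e f (vsub p p0)). unfold hyp_rot, frame_map.
    set (n := lcross e f). clearbody n w.
    split; [|split].
    + apply (smooth_on_ext _ (fun t => (x1 p0 + x1 w * x1 n)
        + (x3 w * x1 e + x2 w * x1 f) * sinh t + (x2 w * x1 e + x3 w * x1 f) * cosh t)).
      * apply open_true.
      * intros t _. set (C := cosh t). set (S := sinh t). clearbody C S. vsimpl. ring.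
      * apply smooth_hyp.
    + apply (smooth_on_ext _ (fun t => (x2 p0 + x1 w * x2 n)
        + (x3 w * x2 e + x2 w * x2 f) * sinh t + (x2 w * x2 e + x3 w * x2 f) * cosh t)).
      * apply open_true.
      * intros t _. set (C := cosh t). set (S := sinh t). clearbody C S. vsimpl. ring.
      * apply smooth_hyp.
    + apply (smooth_on_ext _ (fun t => (x3 p0 + x1 w * x3 n)
        + (x3 w * x3 e + x2 w * x3 f) * sinh t + (x2 w * x3 e + x3 w * x3 f) * cosh t)).
      * apply open_true.
      * intros t _. set (C := cosh t). set (S := sinh t). clearbody C S. vsimpl. ring.
      * apply smooth_hyp.
  - exists p0, (lcross e f). split.
    + intros E. destruct (frame_gram e f H) as [Hn _]. rewrite E in Hn.
      clear - Hn. vsimpl. lra.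
    + intros t k.
      replace (vscal k (lcross e f)) with (frame_map e f (k, 0, 0)).
      * rewrite boost_frame_map by exact H. do 2 f_equal. unfold hyp_rot.
        apply L3_eq; vsimpl; ring.
      * unfold frame_map. set (n := lcross e f). clearbody n. apply L3_eq; vsimpl; ring.
  - exists 1, (vadd p0 (frame_map e f (0, 0, 1))). rewrite boost_frame_map by exact H.
    intros E.
    assert (E' : frame_map e f (hyp_rot 1 (0, 0, 1)) = frame_map e f (0, 0, 1)).
    { set (a := frame_map e f (hyp_rot 1 (0, 0, 1))) in *.
      set (b := frame_map e f (0, 0, 1)) in *. clearbody a b.
      apply L3_eq; [apply (f_equal x1) in E|apply (f_equal x2) in E|apply (f_equal x3) in E];
        vsimpl; lra. }
    apply frame_map_inj in E'; [|exact H]. apply (f_equal x2) in E'.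
    unfold hyp_rot, x2, x3 in E'. cbn [fst snd] in E'.
    pose proof (sinh_pos 1). lra.
Qed.

(** * Degenerate cases that are rotational *)

(** The boost by t about the line of centers sends the parameter v to v + t on every leaf, and D is
    open in v. *)
Lemma constant_centers_rotational (D : R * R -> Prop) (X : R -> R -> L3) (e f p0 : L3)
    (x r : R -> R) :
  open D -> timelike_frame e f ->
  (forall u v, D (u, v) ->
     X u v = vadd p0 (frame_map e f (x u, r u * sinh v, r u * cosh v))) ->
  rotational (surface_image D X).
Proof.
  intros HD H HX. exists (boost e f p0). split; [now apply rotation_group_boost|].
  intros p (u & v & Hp & ->).
  destruct (open_section_snd D u v HD Hp) as [eps He].
  exists eps. split; [apply cond_pos|]. intros t Ht.
  assert (Hp' : D (u, v + t)).
  { apply He. unfold ball; simpl. unfold AbsRing_ball, abs, minus, plus, opp; simpl.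
    now replace (v + t + - v) with t by ring. }
  exists u, (v + t). split; [exact Hp'|].
  rewrite (HX u v Hp), (HX u (v + t) Hp'), boost_frame_map by exact H.
  do 2 f_equal. unfold hyp_rot. rewrite sinh_plus, cosh_plus.
  apply L3_eq; vsimpl; ring.
Qed.

(* A planar piece is open in its plane: at fixed [(y, z)] the function
   [(z - ga)^2 - (y - be)^2 - r^2] changes sign in u, because its derivative on
   the surface is [2 r W] with [W] the first component of the normal. *)
Lemma planar_rotational (I : R -> Prop) (D : R * R -> Prop) (X : R -> R -> L3) (e f : L3)
    (al be ga r : R -> R) (al0 : R) :
  open D -> (forall u v, D (u, v) -> I u) -> timelike_frame e f ->
  (forall u v, D (u, v) ->
     X u v = frame_map e f (al u, be u + r u * sinh v, ga u + r u * cosh v)) ->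
  C2_data I be -> C2_data I ga -> C2_data I r ->
  (forall u, I u -> al u = al0) -> (forall u, I u -> 0 < r u) ->
  (forall u v, D (u, v) -> normal_fst be ga r u v <> 0) ->
  rotational (surface_image D X).
Proof.
  intros HD HDI H HX Hbe Hga Hr Hal Hr0 HW.
  (* The axis is not adapted to the circles: the boost maps the plane to itself, and an open piece
     of the plane absorbs every small motion. *)
  exists (boost e f vzero). split; [now apply rotation_group_boost|].
  intros p (u & v & Hp & ->).
  pose proof (HDI u v Hp) as Iu.
  set (y0 := be u + r u * sinh v). set (z0 := ga u + r u * cosh v).
  set (yt := fun t => y0 * cosh t + z0 * sinh t).
  set (zt := fun t => y0 * sinh t + z0 * cosh t).
  assert (Hphi : forall t, boost e f vzero t (X u v) = frame_map e f (al0, yt t, zt t)).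
  { intros t. rewrite (HX u v Hp), (Hal u Iu). fold y0 z0.
    replace (frame_map e f (al0, y0, z0)) with (vadd vzero (frame_map e f (al0, y0, z0))).
    - rewrite boost_frame_map by exact H.
      unfold hyp_rot, yt, zt. set (q := frame_map e f _).
      replace (vadd vzero q) with q; [reflexivity|]. clearbody q. apply L3_eq; vsimpl; ring.
    - set (q := frame_map e f _). clearbody q. apply L3_eq; vsimpl; ring. }
  assert (Hy1 : is_derive yt 0 (y0 * sinh 0 + z0 * cosh 0)).
  { apply (is_derive_plus (fun t => y0 * cosh t) (fun t => z0 * sinh t));
      apply is_derive_scal; [apply is_derive_cosh|apply is_derive_sinh]. }
  assert (Hz1 : is_derive zt 0 (y0 * cosh 0 + z0 * sinh 0)).
  { apply (is_derive_plus (fun t => y0 * sinh t) (fun t => z0 * cosh t));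
      apply is_derive_scal; [apply is_derive_sinh|apply is_derive_cosh]. }
  pose proof (is_derive_continuous _ _ _ Hy1) as Hyc.
  pose proof (is_derive_continuous _ _ _ Hz1) as Hzc.
  assert (Hy0 : yt 0 = y0) by (unfold yt; rewrite cosh_0, sinh_0; ring).
  assert (Hz0 : zt 0 = z0) by (unfold zt; rewrite cosh_0, sinh_0; ring).
  destruct (HD _ Hp) as [eps He].
  (* Bounds for sinh w that keep the parameter w, found at the end, within eps / 2 of v. *)
  set (S1 := sinh (v - eps / 2)). set (S2 := sinh (v + eps / 2)).
  pose proof (cond_pos eps) as Heps.
  assert (HS1 : S1 < sinh v) by (apply sinh_lt; lra).
  assert (HS2 : sinh v < S2) by (apply sinh_lt; lra).
  pose proof (Hr0 u Iu) as Hru. pose proof (cosh_pos v) as HC.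
  assert (Hcont : forall g, C2_data I g -> continuous g u).
  { intros g Hg. apply (ex_derive_continuous g). now apply Hg. }
  (* Positivity of [F1] and [F2] says that (y0 - be) / r lies between S1 and S2, positivity of [F3]
     that the point is above the center and so faces the right branch. The margin k allows the point
     itself to move a little. *)
  set (F1 := fun s => y0 - be s - S1 * r s).
  set (F2 := fun s => S2 * r s - (y0 - be s)).
  set (F3 := fun s => z0 - ga s).
  assert (exists k, 0 < k /\ k < F1 u /\ k < F2 u /\ k < F3 u) as (k & Hk & K1 & K2 & K3).
  { assert (0 < F1 u) by (unfold F1, y0; nra).
    assert (0 < F2 u) by (unfold F2, y0; nra).
    assert (0 < F3 u) by (unfold F3, z0; nra).
    exists (Rmin (F1 u) (Rmin (F2 u) (F3 u)) / 2).
    pose proof (Rmin_l (F1 u) (Rmin (F2 u) (F3 u))).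
    pose proof (Rmin_r (F1 u) (Rmin (F2 u) (F3 u))).
    pose proof (Rmin_l (F2 u) (F3 u)). pose proof (Rmin_r (F2 u) (F3 u)).
    assert (0 < Rmin (F1 u) (Rmin (F2 u) (F3 u))) by (repeat apply Rmin_glb_lt; lra).
    lra. }
  assert (L1 : locally u (fun s => k < F1 s)).
  { apply continuous_gt_locally; [|exact K1]. unfold F1.
    apply (continuous_minus (fun s => y0 - be s) (fun s => S1 * r s)).
    - apply (continuous_minus (fun _ => y0) be); [apply continuous_const|now apply Hcont].
    - apply (continuous_scal_r S1 r). now apply Hcont. }
  assert (L2 : locally u (fun s => k < F2 s)).
  { apply continuous_gt_locally; [|exact K2]. unfold F2.
    apply (continuous_minus (fun s => S2 * r s) (fun s => y0 - be s)).
    - apply (continuous_scal_r S2 r). now apply Hcont.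
    - apply (continuous_minus (fun _ => y0) be); [apply continuous_const|now apply Hcont]. }
  assert (L3' : locally u (fun s => k < F3 s)).
  { apply continuous_gt_locally; [|exact K3]. unfold F3.
    apply (continuous_minus (fun _ => z0) ga); [apply continuous_const|now apply Hcont]. }
  destruct (proj1 (locally_Rabs_iff _ _) (filter_and _ _ L1 (filter_and _ _ L2 L3')))
    as (d & Hd & Hdist).
  set (h := fun y z s => (z - ga s) ^ 2 - (y - be s) ^ 2 - r s ^ 2).
  assert (Hder : is_derive (h y0 z0) u (2 * r u * normal_fst be ga r u v)).
  { unfold h. auto_derive.
    - repeat split; [apply (Hga u Iu)|apply (Hbe u Iu)|apply (Hr u Iu)].
    - unfold normal_fst, y0, z0.
      change (Derive (fun x : R => ga x) u) with (Derive ga u).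
      change (Derive (fun x : R => be x) u) with (Derive be u).
      change (Derive (fun x : R => r x) u) with (Derive r u). ring. }
  destruct (derive_sign_change (h y0 z0) u _ (Rmin d eps) Hder) as (eta & Heta & Hsg).
  { pose proof (HW u v Hp). repeat apply Rmult_integral_contrapositive_currified; lra. }
  { unfold h, y0, z0. pose proof (cosh_sq v) as E. clear - E.
    set (C := cosh v) in *. set (S := sinh v) in *. clearbody C S. ring [E]. }
  { apply Rmin_glb_lt; lra. }
  pose proof (Rmin_l d eps). pose proof (Rmin_r d eps).
  assert (Hhc : forall s, continuous (fun t => h (yt t) (zt t) s) 0).
  { intros s. apply (ex_derive_continuous (fun t => h (yt t) (zt t) s)).
    unfold h. clearbody yt zt. auto_derive.
    split; [now exists (y0 * cosh 0 + z0 * sinh 0)|].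
    split; [now exists (y0 * sinh 0 + z0 * cosh 0)|exact Logic.I]. }
  (* The sign change between u - eta and u + eta survives a small motion of the point, so by the
     intermediate value theorem some leaf in between passes through the moved point. *)
  assert (T1 : locally 0 (fun t => h (yt t) (zt t) (u - eta) * h (yt t) (zt t) (u + eta) < 0)).
  { apply (continuous_lt_locally (fun t => h (yt t) (zt t) (u - eta) * h (yt t) (zt t) (u + eta))).
    - apply (continuous_mult (fun t => h (yt t) (zt t) (u - eta))
        (fun t => h (yt t) (zt t) (u + eta))); apply Hhc.
    - now rewrite Hy0, Hz0. }
  assert (T2 : locally 0 (fun t => y0 - k < yt t)).
  { apply continuous_gt_locally; [exact Hyc|]. rewrite Hy0. lra. }
  assert (T3 : locally 0 (fun t => yt t < y0 + k)).
  { apply continuous_lt_locally; [exact Hyc|]. rewrite Hy0. lra. }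
  assert (T4 : locally 0 (fun t => z0 - k < zt t)).
  { apply continuous_gt_locally; [exact Hzc|]. rewrite Hz0. lra. }
  destruct (proj1 (locally_Rabs_iff _ _) (filter_and _ _ T1 (filter_and _ _ T2 (filter_and _ _ T3 T4))))
    as (delta & Hdelta & Ht).
  exists delta. split; [exact Hdelta|]. intros t Htd.
  destruct (Ht t) as (N1 & N2 & N3 & N4); [now rewrite Rminus_0_r|]. clear Ht.
  assert (HDs : forall s w, Rabs (s - u) < eps -> Rabs (w - v) < eps -> D (s, w)).
  { intros s w Hs Hw. apply He. split; [exact Hs|exact Hw]. }
  assert (Hnear : forall s, u - eta <= s <= u + eta -> Rabs (s - u) < eps).
  { intros s Hs. apply Rabs_def1; lra. }
  assert (Is : forall s, u - eta <= s <= u + eta -> I s).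
  { intros s Hs. apply (HDI s v). apply HDs; [now apply Hnear|].
    replace (v - v) with 0 by ring. now rewrite Rabs_R0. }
  destruct (IVT_zero (h (yt t) (zt t)) (u - eta) (u + eta)) as (s & Hs & Es).
  { lra. }
  { intros s Hs. apply (ex_derive_continuous (h (yt t) (zt t))). unfold h. auto_derive.
    repeat split; [apply (Hga s (Is s Hs))|apply (Hbe s (Is s Hs))|apply (Hr s (Is s Hs))]. }
  { lra. }
  destruct (Hdist s) as (G1 & G2 & G3); [apply Rabs_def1; lra|].
  unfold F1 in G1. unfold F2 in G2. unfold F3 in G3.
  pose proof (Hr0 s (Is s Hs)) as Hrs.
  destruct (hyperbola_param (r s) (yt t - be s) (zt t - ga s) Hrs) as (w & Ey & Ez).
  { lra. }
  { unfold h in Es. lra. }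
  assert (Hw : Rabs (w - v) < eps).
  { assert (W1 : S1 < sinh w) by nra. assert (W2 : sinh w < S2) by nra.
    assert (v - eps / 2 < w).
    { destruct (Rlt_dec (v - eps / 2) w) as [L|L]; [exact L|]. exfalso.
      assert (w < v - eps / 2 \/ w = v - eps / 2) as [L'|L'] by lra.
      - apply sinh_lt in L'. unfold S1 in W1. lra.
      - rewrite L' in W1. unfold S1 in W1. lra. }
    assert (w < v + eps / 2).
    { destruct (Rlt_dec w (v + eps / 2)) as [L|L]; [exact L|]. exfalso.
      assert (v + eps / 2 < w \/ w = v + eps / 2) as [L'|L'] by lra.
      - apply sinh_lt in L'. unfold S2 in W2. lra.
      - rewrite L' in W2. unfold S2 in W2. lra. }
    apply Rabs_def1; lra. }
  assert (Hsw : D (s, w)) by (apply HDs; [now apply Hnear|exact Hw]).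
  exists s, w. split; [exact Hsw|]. rewrite Hphi, (HX s w Hsw), (Hal s (Is s Hs)).
  f_equal. apply L3_eq; unfold x1, x2, x3; cbn [fst snd]; lra.
Qed.

(** * The leaf equations and their first integrals *)

Lemma continuous_Rplus (f g : R -> R) (x : R) :
  continuous f x -> continuous g x -> continuous (fun t => f t + g t) x.
Proof. exact (continuous_plus f g x). Qed.

Lemma continuous_Rminus (f g : R -> R) (x : R) :
  continuous f x -> continuous g x -> continuous (fun t => f t - g t) x.
Proof. exact (continuous_minus f g x). Qed.

Lemma continuous_Rmult (f g : R -> R) (x : R) :
  continuous f x -> continuous g x -> continuous (fun t => f t * g t) x.
Proof. exact (continuous_mult f g x). Qed.

Lemma continuous_Rpow2 (f : R -> R) (x : R) :
  continuous f x -> continuous (fun t => f t ^ 2) x.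
Proof.
  intros H. apply (continuous_Rmult f (fun t => f t * 1)); [exact H|].
  apply (continuous_Rmult f (fun _ => 1)); [exact H|apply continuous_const].
Qed.

Ltac continuity_tac :=
  match goal with
  | |- continuous (fun _ => ?c) _ => apply continuous_const
  | |- continuous (fun t => @?f t + @?g t) ?x => apply (continuous_Rplus f g x); continuity_tac
  | |- continuous (fun t => @?f t - @?g t) ?x => apply (continuous_Rminus f g x); continuity_tac
  | |- continuous (fun t => @?f t * @?g t) ?x => apply (continuous_Rmult f g x); continuity_tac
  | |- continuous (fun t => @?f t ^ 2) ?x => apply (continuous_Rpow2 f x); continuity_tac
  | _ => assumption
  end.

(** If some point of the leaf near v0 is non-degenerate, the curvature equation holds on an interval
    of v and its coefficients vanish. Otherwise al'^2 = W^2 identically in v near v0, W being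
    [normal_fst], and comparing coefficients of this quadratic relation gives the second case. *)
Lemma coefs_or_degenerate (I : R -> Prop) (D : R * R -> Prop) (X : R -> R -> L3) (e f : L3)
    (al be ga r : R -> R) (u v0 : R) :
  open D -> (forall u v, D (u, v) -> I u) -> timelike_frame e f ->
  (forall u v, D (u, v) ->
     X u v = frame_map e f (al u, be u + r u * sinh v, ga u + r u * cosh v)) ->
  C2_data I al -> C2_data I be -> C2_data I ga -> C2_data I r ->
  zero_mean_curvature D X -> D (u, v0) -> 0 < r u ->
  (coef_lin al r be u = 0 /\ coef_lin al r ga u = 0 /\ coef_const al be ga r u = 0) \/
  (Derive be u = 0 /\ Derive ga u = 0 /\ Derive r u ^ 2 = Derive al u ^ 2).
Proof.
  intros HD HDI H HX Hal Hbe Hga Hr HZ Hp Hru.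
  destruct (proj1 (locally_Rabs_iff _ _) (open_section_snd D u v0 HD Hp)) as (d & Hd & Hin).
  destruct (classic (exists v1, Rabs (v1 - v0) < d /\
     Derive al u ^ 2 - normal_fst be ga r u v1 ^ 2 <> 0)) as [(v1 & Hv1 & Hn)|Hall].
  - left.
    assert (L1 : locally v1 (fun v => D (u, v))).
    { apply open_section_snd; [exact HD|now apply Hin]. }
    assert (L2 : locally v1 (fun v => Derive al u ^ 2 - normal_fst be ga r u v ^ 2 <> 0)).
    { apply (continuous_nonzero_locally (fun v => Derive al u ^ 2 - normal_fst be ga r u v ^ 2));
        [|exact Hn].
      pose proof (is_derive_continuous _ _ _ (is_derive_sinh v1)).
      pose proof (is_derive_continuous _ _ _ (is_derive_cosh v1)).
      unfold normal_fst. continuity_tac. }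
    destruct (proj1 (locally_Rabs_iff _ _) (filter_and _ _ L1 L2)) as (d' & Hd' & Hin').
    destruct (hyp_linear_independent d' v1 (coef_const al be ga r u) (coef_lin al r be u)
      (- coef_lin al r ga u) Hd') as (E1 & E2 & E3).
    + intros v Hv. destruct (Hin' v Hv) as [Hp' Hn'].
      assert (Hmd : metric_det X u v <> 0).
      { rewrite (metric_det_sweep I D X e f al be ga r HD HDI H HX Hal Hbe Hga Hr u v Hp').
        apply Rmult_integral_contrapositive_currified; [|exact Hn'].
        apply pow_nonzero. lra. }
      pose proof (proj1 (mean_curvature_zero_iff X u v Hmd) (HZ u v Hp' Hmd)) as Hz.
      rewrite (zmc_expr_sweep I D X e f al be ga r HD HDI H HX Hal Hbe Hga Hr u v Hp') in Hz.
      apply Rmult_integral in Hz. destruct Hz as [Hz|Hz]; [|exact Hz].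
      exfalso. apply (pow_nonzero (r u) 2); [lra|exact Hz].
    + repeat split; lra.
  - right.
    (* Chosen so that W at v0 + h equals P cosh h + M sinh h - r'. The coefficient of sinh^2 in W^2
       is then P^2 + M^2, which forces P = M = 0. *)
    set (P := Derive be u * sinh v0 - Derive ga u * cosh v0).
    set (M := Derive be u * cosh v0 - Derive ga u * sinh v0).
    destruct (hyp_quadratic_independent d (Derive r u ^ 2 + P ^ 2 - Derive al u ^ 2)
      (- 2 * Derive r u * M) (- 2 * Derive r u * P) (P ^ 2 + M ^ 2) (2 * P * M) Hd)
      as (E1 & _ & _ & E2 & _).
    { intros h Hh.
      assert (E : Derive al u ^ 2 - normal_fst be ga r u (v0 + h) ^ 2 = 0).
      { apply NNPP. intros N. apply Hall. exists (v0 + h). split; [|exact N].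
        now replace (v0 + h - v0) with h by ring. }
      unfold normal_fst in E. rewrite sinh_plus, cosh_plus in E.
      pose proof (cosh_sq h) as Eh.
      replace (Derive be u * (sinh v0 * cosh h + cosh v0 * sinh h) -
        Derive ga u * (cosh v0 * cosh h + sinh v0 * sinh h) - Derive r u)
        with (P * cosh h + M * sinh h - Derive r u) in E by (unfold P, M; ring).
      set (C := cosh h) in *. set (S := sinh h) in *. clearbody C S P M.
      rewrite <- Ropp_0, <- E. ring [Eh]. }
    assert (P = 0) by nra. assert (M = 0) by nra.
    pose proof (cosh_sq v0) as E0.
    assert (B1 : Derive be u = cosh v0 * M - sinh v0 * P).
    { unfold M, P. set (C := cosh v0) in *. set (S := sinh v0) in *. clearbody C S. ring [E0]. }
    assert (B2 : Derive ga u = sinh v0 * M - cosh v0 * P).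
    { unfold M, P. set (C := cosh v0) in *. set (S := sinh v0) in *. clearbody C S. ring [E0]. }
    rewrite H0, H1 in B1, B2. rewrite H0 in E1. repeat split; lra.
Qed.

(* At a limit of non-degenerate leaves the equations hold by continuity; on an
   interval of degenerate leaves (a piece of a light cone) they are trivial. *)
Lemma coefs_vanish (I : R -> Prop) (al be ga r : R -> R) :
  open I -> smooth_on I al -> smooth_on I be -> smooth_on I ga -> smooth_on I r ->
  (forall u, I u ->
    (coef_lin al r be u = 0 /\ coef_lin al r ga u = 0 /\ coef_const al be ga r u = 0) \/
    (Derive be u = 0 /\ Derive ga u = 0 /\ Derive r u ^ 2 = Derive al u ^ 2)) ->
  forall u, I u ->
    coef_lin al r be u = 0 /\ coef_lin al r ga u = 0 /\ coef_const al be ga r u = 0.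
Proof.
  intros HIo Hal Hbe Hga Hr Halt u Iu.
  destruct (smooth_on_continuous2 I al u Hal Iu) as (_ & A1 & A2).
  destruct (smooth_on_continuous2 I be u Hbe Iu) as (_ & B1 & B2).
  destruct (smooth_on_continuous2 I ga u Hga Iu) as (_ & G1 & G2).
  destruct (smooth_on_continuous2 I r u Hr Iu) as (R0 & R1 & R2).
  (* A nonzero coefficient at u stays nonzero nearby, so all leaves near u are degenerate and b'
     vanishes there. Then b'' = 0 at u as well, and the coefficient was zero. *)
  assert (Hlin : forall b, smooth_on I b ->
     (forall s, I s -> coef_lin al r b s <> 0 -> Derive b s = 0) -> coef_lin al r b u = 0).
  { intros b Hb Hdeg. apply NNPP. intros N.
    destruct (smooth_on_continuous2 I b u Hb Iu) as (_ & Cb1 & Cb2).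
    assert (L : locally u (fun s => Derive b s = 0)).
    { apply (filter_imp (fun s => I s /\ coef_lin al r b s <> 0)).
      - intros s [Is Ns]. now apply Hdeg.
      - apply filter_and; [now apply HIo|].
        apply (continuous_nonzero_locally (coef_lin al r b)); [|exact N].
        unfold coef_lin. continuity_tac. }
    pose proof (derive_locally_zero (Derive b) u (Derive (Derive b) u)
      (Derive_correct _ _ (proj2 (smooth_on_C2 I b Hb u Iu))) L) as E2.
    apply N. unfold coef_lin. rewrite E2, (locally_singleton _ _ L). ring. }
  split; [|split].
  - apply Hlin; [exact Hbe|]. intros s Is Ns. destruct (Halt s Is) as [E|E]; [|apply E].
    exfalso. apply Ns, E.
  - apply Hlin; [exact Hga|]. intros s Is Ns. destruct (Halt s Is) as [E|E]; [|apply E].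
    exfalso. apply Ns, E.
  - apply NNPP. intros N.
    assert (L : locally u (fun s => Derive be s = 0 /\ Derive ga s = 0 /\
       Derive r s ^ 2 - Derive al s ^ 2 = 0)).
    { apply (filter_imp (fun s => I s /\ coef_const al be ga r s <> 0)).
      - intros s [Is Ns]. destruct (Halt s Is) as [E|(E1 & E2 & E3)].
        + exfalso. apply Ns, E.
        + repeat split; try assumption. lra.
      - apply filter_and; [now apply HIo|].
        apply (continuous_nonzero_locally (coef_const al be ga r)); [|exact N].
        unfold coef_const. continuity_tac. }
    destruct (locally_singleton _ _ L) as (E1 & E2 & E3).
    assert (E4 : 2 * Derive r u * Derive (Derive r) u - 2 * Derive al u * Derive (Derive al) u = 0).
    { apply (derive_locally_zero (fun s => Derive r s ^ 2 - Derive al s ^ 2) u).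
      - pose proof (Derive_correct _ _ (proj2 (smooth_on_C2 I r Hr u Iu))) as Dr.
        pose proof (Derive_correct _ _ (proj2 (smooth_on_C2 I al Hal u Iu))) as Da.
        set (r1 := Derive r) in *. set (a1 := Derive al) in *. clearbody r1 a1.
        auto_derive; [split; [now exists (Derive r1 u)|split; [now exists (Derive a1 u)|exact Logic.I]]|].
        change (Derive (fun x : R => r1 x) u) with (Derive r1 u).
        change (Derive (fun x : R => a1 x) u) with (Derive a1 u). ring.
      - apply (filter_imp _ _) with (2 := L). intros s Hs. apply Hs. }
    unfold coef_const in N. rewrite E1, E2 in N.
    set (a1 := Derive al u) in *. set (a2 := Derive (Derive al) u) in *.
    set (r1 := Derive r u) in *. set (r2 := Derive (Derive r) u) in *.
    set (r0 := r u) in *. clearbody a1 a2 r1 r2 r0.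
    (* On degenerate leaves r'^2 = al'^2, and differentiating this gives r' r'' = al' al''. If al' =
       0 then r' = 0 and all terms vanish; otherwise al' times the coefficient is a combination of
       these two relations. *)
    apply N. destruct (Req_dec a1 0) as [Z|Z].
    + subst a1. assert (r1 = 0) by nra. subst r1. ring.
    + apply (Rmult_eq_reg_l a1); [|exact Z].
      replace (a1 * (r0 * (a1 * r2 - a2 * r1) + a1 * (a1 ^ 2 + 0 ^ 2 - 0 ^ 2 - r1 ^ 2)))
        with (r0 * (r1 * (r1 * r2 - a1 * a2)) - (r1 ^ 2 - a1 ^ 2) * (r0 * r2 + a1 ^ 2)) by ring.
      rewrite E3. replace (r1 * r2 - a1 * a2) with 0 by lra. ring.
Qed.

(** The combination be' E1 + ga' E2 - r' E3 of the three equations can be solved for al'': it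
    becomes al'' den = al' num, a linear homogeneous equation for al' with continuous coefficient. A
    single zero of al' therefore spreads over I. *)
Lemma axis_speed_dichotomy (I : R -> Prop) (al be ga r : R -> R) :
  convex I -> smooth_on I al -> smooth_on I be -> smooth_on I ga -> smooth_on I r ->
  (forall u, I u -> 0 < r u) ->
  (forall u, I u ->
    coef_lin al r be u = 0 /\ coef_lin al r ga u = 0 /\ coef_const al be ga r u = 0) ->
  (forall u, I u -> 0 < Derive al u ^ 2 + Derive be u ^ 2 + Derive ga u ^ 2 + Derive r u ^ 2) ->
  (forall u, I u -> Derive al u = 0) \/ (forall u, I u -> Derive al u <> 0).
Proof.
  intros HI Hal Hbe Hga Hr Hr0 Hco Hpos.
  destruct (classic (exists t0, I t0 /\ Derive al t0 = 0)) as [(t0 & It0 & Et0)|Hn].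
  2:{ right. intros u Iu E. apply Hn. now exists u. }
  left.
  (* The term r al'^2 al'' has been added on both sides, so that den contains all four squares and
     is positive by hypothesis. *)
  set (num := fun u =>
    Derive be u * (r u * Derive (Derive be) u - 2 * Derive r u * Derive be u)
    + Derive ga u * (r u * Derive (Derive ga) u - 2 * Derive r u * Derive ga u)
    + Derive r u * (r u * Derive (Derive r) u
        + (Derive al u ^ 2 + Derive be u ^ 2 - Derive ga u ^ 2 - Derive r u ^ 2))
    + r u * Derive al u * Derive (Derive al) u).
  set (den := fun u => r u * (Derive al u ^ 2 + Derive be u ^ 2 + Derive ga u ^ 2 + Derive r u ^ 2)).
  assert (Hden : forall u, I u -> 0 < den u).
  { intros u Iu. apply Rmult_lt_0_compat; [now apply Hr0|now apply Hpos]. }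
  apply (gronwall_zero I (Derive al) (Derive (Derive al)) (fun u => Rabs (num u / den u)) t0 HI);
    [| | |exact It0|exact Et0].
  - intros t It. apply Derive_correct. now apply (smooth_on_C2 I al Hal).
  - intros t It.
    destruct (smooth_on_continuous2 I al t Hal It) as (_ & A1 & A2).
    destruct (smooth_on_continuous2 I be t Hbe It) as (_ & B1 & B2).
    destruct (smooth_on_continuous2 I ga t Hga It) as (_ & G1 & G2).
    destruct (smooth_on_continuous2 I r t Hr It) as (R0 & R1 & R2).
    apply (continuous_comp (fun u => num u / den u) Rabs); [|apply continuous_Rabs].
    apply (continuous_Rmult num (fun u => / den u)).
    + unfold num. continuity_tac.
    + apply (continuous_Rinv_comp den); [unfold den; continuity_tac|].
      pose proof (Hden t It). lra.
  - intros t It. rewrite <- Rabs_mult.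
    pose proof (Hden t It) as Hd. destruct (Hco t It) as (E1 & E2 & E3).
    right. f_equal. apply (Rmult_eq_reg_r (den t)); [|lra].
    replace (num t / den t * Derive al t * den t) with (num t * Derive al t) by (field; lra).
    unfold num, den. unfold coef_lin in E1, E2. unfold coef_const in E3.
    set (a1 := Derive al t) in *. set (a2 := Derive (Derive al) t) in *.
    set (b1 := Derive be t) in *. set (b2 := Derive (Derive be) t) in *.
    set (g1 := Derive ga t) in *. set (g2 := Derive (Derive ga) t) in *.
    set (r1 := Derive r t) in *. set (r2 := Derive (Derive r) t) in *.
    set (r0 := r t) in *. clearbody a1 a2 b1 b2 g1 g2 r1 r2 r0.
    apply Rminus_diag_uniq.
    match type of E1 with ?x1 = 0 => match type of E2 with ?x2 = 0 => match type of E3 with ?x3 = 0 =>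
      transitivity (b1 * x1 + g1 * x2 - r1 * x3); [ring|rewrite E1, E2, E3; ring] end end end.
Qed.

Lemma center_slope (I : R -> Prop) (al b r : R -> R) :
  convex I -> (exists t, I t) -> smooth_on I al -> smooth_on I b -> smooth_on I r ->
  (forall u, I u -> 0 < r u) -> (forall u, I u -> Derive al u <> 0) ->
  (forall u, I u -> coef_lin al r b u = 0) ->
  exists k, forall u, I u -> Derive b u = k * Derive al u * r u ^ 2.
Proof.
  intros HI [t0 It0] Hal Hb Hr Hr0 Ha Hco.
  (* Its derivative is - [coef_lin] / (al'^2 r^3), hence zero. *)
  set (phi := fun u => Derive b u / (Derive al u * r u ^ 2)).
  exists (phi t0). intros u Iu.
  assert (Hne : forall s, I s -> Derive al s * r s ^ 2 <> 0).
  { intros s Is. apply Rmult_integral_contrapositive_currified; [now apply Ha|].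
    apply pow_nonzero. pose proof (Hr0 s Is). lra. }
  replace (phi t0) with (phi u).
  { unfold phi. field. split; [pose proof (Hr0 u Iu); lra|now apply Ha]. }
  apply (derive_zero_const I); [exact HI| |exact Iu|exact It0].
  intros t It. pose proof (Hco t It) as E. pose proof (Hne t It) as N.
  pose proof (proj2 (smooth_on_C2 I al Hal t It)) as D1.
  pose proof (proj2 (smooth_on_C2 I b Hb t It)) as D2.
  pose proof (proj1 (smooth_on_C2 I r Hr t It)) as D3.
  unfold phi. unfold coef_lin in E.
  pose proof (Ha t It) as Na. pose proof (Hr0 t It) as Nr. clear - D1 D2 D3 E N Na Nr.
  set (r1 := Derive r t) in *.
  set (a1 := Derive al) in *. set (b1 := Derive b) in *. clearbody a1 b1.
  auto_derive.
  - repeat split; try assumption.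
  - change (Derive (fun x : R => a1 x) t) with (Derive a1 t).
    change (Derive (fun x : R => b1 x) t) with (Derive b1 t).
    change (Derive (fun x : R => r x) t) with r1.
    match type of E with ?x = 0 => transitivity (- x / (a1 t ^ 2 * r t ^ 3)) end.
    + field. split; [lra|exact Na].
    + rewrite E. field. split; [lra|exact Na].
Qed.

(** [phi] below is the claimed relation solved for lam. Once be' and ga' are replaced by their
    values, its derivative is 2 r' / (al'^3 r^3) times the third coefficient. *)
Lemma profile_first_integral (I : R -> Prop) (al be ga r : R -> R) (a : R * R) :
  convex I -> (exists t, I t) -> smooth_on I al -> smooth_on I r ->
  (forall u, I u -> 0 < r u) -> (forall u, I u -> Derive al u <> 0) ->
  (forall u, I u -> Derive be u = fst a * Derive al u * r u ^ 2) ->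
  (forall u, I u -> Derive ga u = snd a * Derive al u * r u ^ 2) ->
  (forall u, I u -> coef_const al be ga r u = 0) ->
  exists lam, forall u, I u ->
    (Derive r u * r u) ^ 2 = Derive al u ^ 2 * radicand a lam (r u ^ 2).
Proof.
  intros HI [t0 It0] Hal Hr Hr0 Ha Hbe Hga Hco.
  set (phi := fun u => (Derive r u / (Derive al u * r u)) ^ 2 - / r u ^ 2 + lprod2 a a * r u ^ 2).
  exists (phi t0). intros u Iu.
  replace (phi t0) with (phi u).
  { unfold phi, radicand. pose proof (Hr0 u Iu). field. split; [lra|now apply Ha]. }
  apply (derive_zero_const I); [exact HI| |exact Iu|exact It0].
  intros t It. pose proof (Hco t It) as E.
  unfold coef_const in E. rewrite (Hbe t It), (Hga t It) in E.
  pose proof (proj2 (smooth_on_C2 I al Hal t It)) as D1.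
  pose proof (proj2 (smooth_on_C2 I r Hr t It)) as D2.
  pose proof (Derive_correct _ _ (proj1 (smooth_on_C2 I r Hr t It))) as D3.
  unfold phi. unfold lprod2.
  pose proof (Ha t It) as Na. pose proof (Hr0 t It) as Nr. clear - D1 D2 D3 E Na Nr.
  set (a1 := Derive al) in *. set (r1 := Derive r) in *. clearbody a1 r1.
  auto_derive.
  - repeat split; try assumption; try now exists (r1 t).
    + apply Rmult_integral_contrapositive_currified; lra.
    + replace (r t * (r t * 1)) with (r t * r t) by ring.
      apply Rmult_integral_contrapositive_currified; lra.
  - change (Derive (fun x : R => a1 x) t) with (Derive a1 t).
    change (Derive (fun x : R => r1 x) t) with (Derive r1 t).
    rewrite (is_derive_unique (fun x : R => r x) t (r1 t)) by exact D3.
    match type of E with ?x = 0 => transitivity (2 * r1 t * x / (a1 t ^ 3 * r t ^ 3)) end.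
    + field. split; [lra|exact Na].
    + rewrite E. field. split; [lra|exact Na].
Qed.

(** * The profile equations *)

Definition ax (e f : L3) (c : R -> L3) (u : R) : R := x1 (frame_coords e f (c u)).
Definition ay (e f : L3) (c : R -> L3) (u : R) : R := x2 (frame_coords e f (c u)).
Definition az (e f : L3) (c : R -> L3) (u : R) : R := x3 (frame_coords e f (c u)).

Lemma hyperbola_frame_map (e f : L3) (c : R -> L3) (u rho v : R) : timelike_frame e f ->
  hyperbola e f (c u) rho v =
  frame_map e f (ax e f c u, ay e f c u + rho * sinh v, az e f c u + rho * cosh v).
Proof.
  intros H. unfold hyperbola, ax, ay, az.
  set (w := frame_coords e f (c u)).
  replace (c u) with (frame_map e f w) by now apply frame_map_coords.
  clearbody w. unfold frame_map. set (n := lcross e f). clearbody n.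
  set (C := cosh v). set (S := sinh v). clearbody C S. apply L3_eq; vsimpl; ring.
Qed.

Lemma smooth_coords (I : R -> Prop) (e f : L3) (c : R -> L3) :
  open I -> smooth_curve_on I c ->
  smooth_on I (ax e f c) /\ smooth_on I (ay e f c) /\ smooth_on I (az e f c).
Proof.
  intros HI (H1 & H2 & H3). split; [|split].
  - apply (smooth_on_ext I (fun t => x1 (lcross e f) * x1 (c t) + (x2 (lcross e f) * x2 (c t) + - x3 (lcross e f) * x3 (c t)))); [exact HI| |now apply smooth_on_lin3].
    intros t _. unfold ax, frame_coords. set (n := lcross e f). clearbody n. vsimpl. ring.
  - apply (smooth_on_ext I (fun t => x1 e * x1 (c t) + (x2 e * x2 (c t) + - x3 e * x3 (c t)))); [exact HI| |now apply smooth_on_lin3].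
    intros t _. unfold ay, frame_coords. set (n := lcross e f). clearbody n. vsimpl. ring.
  - apply (smooth_on_ext I (fun t => - x1 f * x1 (c t) + (- x2 f * x2 (c t) + x3 f * x3 (c t)))); [exact HI| |now apply smooth_on_lin3].
    intros t _. unfold az, frame_coords. set (n := lcross e f). clearbody n. vsimpl. ring.
Qed.

(** The third coefficient is listed beside the first integral because the latter does not imply it
    where r' = 0; this is needed to exclude intervals of constant radius. *)
Definition riemann_profile (I : R -> Prop) (al be ga r : R -> R) (a : R * R) (lam : R) : Prop :=
  forall u, I u ->
    Derive al u <> 0 /\
    Derive be u = fst a * Derive al u * r u ^ 2 /\
    Derive ga u = snd a * Derive al u * r u ^ 2 /\
    coef_const al be ga r u = 0 /\
    (Derive r u * r u) ^ 2 = Derive al u ^ 2 * radicand a lam (r u ^ 2).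

Lemma riemann_example_profile (I : R -> Prop) (D : R * R -> Prop) (X : R -> R -> L3)
    (e f : L3) (c : R -> L3) (r : R -> R) :
  riemann_ZMC_example I D X e f c r ->
  exists lam a, a <> (0, 0) /\
    riemann_profile I (ax e f c) (ay e f c) (az e f c) r a lam.
Proof.
  intros (Hfol & Him & HZ & Hnrot).
  destruct Hfol as ((Hne & HIo & HIc) & HD & HDI & Hfib & _ & H & Hc & Hr & Hr0 & HX0).
  destruct (smooth_coords I e f c HIo Hc) as (Hal & Hbe & Hga).
  assert (HX : forall u v, D (u, v) -> X u v = frame_map e f
     (ax e f c u, ay e f c u + r u * sinh v, az e f c u + r u * cosh v)).
  { intros u v Hp. rewrite (HX0 u v Hp). now apply hyperbola_frame_map. }
  set (al := ax e f c) in *. set (be := ay e f c) in *. set (ga := az e f c) in *.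
  pose proof (smooth_on_C2 I al Hal) as Hal2. pose proof (smooth_on_C2 I be Hbe) as Hbe2.
  pose proof (smooth_on_C2 I ga Hga) as Hga2. pose proof (smooth_on_C2 I r Hr) as Hr2.
  assert (Hco := coefs_vanish I al be ga r HIo Hal Hbe Hga Hr).
  assert (Hco' : forall u, I u ->
    coef_lin al r be u = 0 /\ coef_lin al r ga u = 0 /\ coef_const al be ga r u = 0).
  { apply Hco. intros u Iu. destruct (Hfib u Iu) as [v0 Hp].
    apply (coefs_or_degenerate I D X e f al be ga r u v0); auto. }
  clear Hco.
  assert (Himm : forall u v, D (u, v) -> Derive al u <> 0 \/ normal_fst be ga r u v <> 0).
  { intros u v Hp.
    apply (immersed_sweep I D X e f al be ga r HD HDI H HX Hal2 Hbe2 Hga2 Hr2 u v Hp);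
      [apply Hr0; now apply (HDI u v)|now apply Him]. }
  destruct (axis_speed_dichotomy I al be ga r) as [A0|A0]; auto.
  (* Were all four derivatives zero at u, then al' and [normal_fst] would vanish together, against
     immersedness. *)
  { intros u Iu. destruct (Hfib u Iu) as [v Hp].
    assert (Hsq : forall x, 0 <= x ^ 2) by (intros; nra).
    pose proof (Hsq (Derive al u)). pose proof (Hsq (Derive be u)).
    pose proof (Hsq (Derive ga u)). pose proof (Hsq (Derive r u)).
    destruct (Rlt_dec 0 (Derive al u ^ 2 + Derive be u ^ 2 + Derive ga u ^ 2 + Derive r u ^ 2))
      as [L|L]; [exact L|exfalso].
    assert (Z : forall x, x ^ 2 <= 0 -> x = 0) by (intros; nra).
    assert (Derive al u = 0) by (apply Z; lra). assert (Derive be u = 0) by (apply Z; lra).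
    assert (Derive ga u = 0) by (apply Z; lra). assert (Derive r u = 0) by (apply Z; lra).
    destruct (Himm u v Hp) as [N|N]; [easy|]. apply N. unfold normal_fst.
    rewrite H5, H6, H7. ring. }
  { exfalso. apply Hnrot. destruct Hne as [t0 It0].
    apply (planar_rotational I D X e f al be ga r (al t0)); auto.
    - intros u Iu. apply (derive_zero_const I); auto.
      intros t It. rewrite <- (A0 t It). apply Derive_correct. now apply Hal2.
    - intros u v Hp. destruct (Himm u v Hp) as [N|N]; [|exact N].
      exfalso. apply N, A0. now apply (HDI u v). }
  destruct (center_slope I al be r) as [k2 Hk2]; auto; [intros; now apply Hco'|].
  destruct (center_slope I al ga r) as [k3 Hk3]; auto; [intros; now apply Hco'|].
  destruct (profile_first_integral I al be ga r (k2, k3)) as [lam Hlam]; auto;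
    [intros; now apply Hco'|].
  exists lam, (k2, k3). split.
  - intros E. injection E as E2 E3. subst k2 k3. apply Hnrot. destruct Hne as [t0 It0].
    apply (constant_centers_rotational D X e f (frame_map e f (0, be t0, ga t0)) al r HD H).
    intros u v Hp. pose proof (HDI u v Hp) as Iu. rewrite (HX u v Hp).
    assert (Eb : be u = be t0).
    { apply (derive_zero_const I); auto. intros t It.
      replace 0 with (Derive be t) by (rewrite Hk2 by exact It; ring).
      apply Derive_correct. now apply Hbe2. }
    assert (Eg : ga u = ga t0).
    { apply (derive_zero_const I); auto. intros t It.
      replace 0 with (Derive ga t) by (rewrite Hk3 by exact It; ring).
      apply Derive_correct. now apply Hga2. }
    rewrite Eb, Eg. unfold frame_map. set (n := lcross e f).
    generalize (be t0) (ga t0) (al u) (r u) (sinh v) (cosh v) n. clear. intros.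
    apply L3_eq; vsimpl; ring.
  - intros u Iu. cbn [fst snd]. repeat split; auto. now apply Hco'.
Qed.

(** The radicand depends on a only through <a, a>, so passing from a to s a costs nothing. *)
Lemma radicand_swap_sign (s : R) (a : R * R) (lam q : R) : s = 1 \/ s = -1 ->
  radicand (s * fst a, s * snd a) lam q = radicand a lam q.
Proof.
  intros Hs. unfold radicand, lprod2. cbn [fst snd]. destruct Hs as [-> | ->]; ring.
Qed.

(* If r' vanished on an interval, the profile would start at an equilibrium of
   its first-order equation, a double root of the radicand, and stay there. *)
Lemma radius_regular_dense (I : R -> Prop) (al be ga r : R -> R) (a : R * R) (lam : R) :
  convex I -> open I -> smooth_on I al -> smooth_on I r -> (forall u, I u -> 0 < r u) ->
  riemann_profile I al be ga r a lam -> nonconstant_on I r ->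
  forall u eps, I u -> 0 < eps ->
    exists u', I u' /\ Rabs (u' - u) < eps /\ Derive r u' <> 0.
Proof.
  intros HI HIo Hal Hr Hr0 Hp Hnc u eps Iu Heps. apply NNPP. intros Hno. apply Hnc.
  exists (r u).
  pose proof (smooth_on_C2 I r Hr) as Hr2.
  assert (L : locally u (fun s => Derive r s = 0)).
  { apply (filter_imp (fun s => I s /\ Rabs (s - u) < eps)).
    - intros s [Is Hs]. apply NNPP. intros N. apply Hno. now exists s.
    - apply filter_and; [now apply HIo|]. apply locally_Rabs_iff. now exists eps. }
  pose proof (locally_singleton _ _ L) as E1. cbv beta in E1.
  assert (E2 : Derive (Derive r) u = 0).
  { apply (derive_locally_zero (Derive r) u); [|exact L].
    apply Derive_correct. now apply Hr2. }
  destruct (Hp u Iu) as (Ha & Hb & Hg & Hc & Hf).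
  unfold coef_const in Hc. rewrite E1, E2, Hb, Hg in Hc. rewrite E1 in Hf.
  pose proof (Hr0 u Iu) as Hru. set (r0 := r u) in *.
  (* With r' = r'' = 0 the third coefficient gives [H1] and the first integral gives [H2]. Together
     <a, a> = - 1 / r0^4 and lam = - 2 / r0^2, so the radicand is u (1 - u / r0^2)^2. *)
  assert (H1 : 1 + lprod2 a a * r0 ^ 4 = 0).
  { unfold lprod2. apply (Rmult_eq_reg_l (Derive al u ^ 3)); [|now apply pow_nonzero].
    rewrite Rmult_0_r, <- Hc. ring. }
  assert (H2 : 1 - lprod2 a a * r0 ^ 4 + lam * r0 ^ 2 = 0).
  { assert (Hz : Derive al u ^ 2 * r0 ^ 2 * (1 - lprod2 a a * r0 ^ 4 + lam * r0 ^ 2) = 0).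
    { transitivity (Derive al u ^ 2 * radicand a lam (r0 ^ 2)); [unfold radicand; ring|].
      rewrite <- Hf. ring. }
    apply Rmult_integral in Hz. destruct Hz as [Hz|Hz]; [|exact Hz].
    exfalso. apply Rmult_integral in Hz.
    destruct Hz as [Hz|Hz]; revert Hz; apply pow_nonzero; [exact Ha|lra]. }
  assert (Haa : lprod2 a a = - / r0 ^ 4).
  { apply (Rmult_eq_reg_r (r0 ^ 4)); [|apply pow_nonzero; lra].
    rewrite Ropp_mult_distr_l_reverse, Rinv_l by (apply pow_nonzero; lra). lra. }
  assert (Hlam : lam = - 2 / r0 ^ 2).
  { apply (Rmult_eq_reg_r (r0 ^ 2)); [|apply pow_nonzero; lra].
    unfold Rdiv. rewrite Rmult_assoc, Rinv_l by (apply pow_nonzero; lra). lra. }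
  intros s Is.
  enough (r s - r0 = 0) by lra.
  apply (gronwall_zero I (fun t => r t - r0) (Derive r)
    (fun t => Rabs (Derive al t * (r t + r0) / r0 ^ 2)) u HI); [| | |exact Iu|unfold r0; ring|exact Is].
  - intros t It. auto_derive; [now apply Hr2|].
    change (Derive (fun x : R => r x) t) with (Derive r t). ring.
  - intros t It.
    destruct (smooth_on_continuous2 I al t Hal It) as (_ & A1 & _).
    destruct (smooth_on_continuous2 I r t Hr It) as (R0 & _ & _).
    apply (continuous_comp (fun t => Derive al t * (r t + r0) / r0 ^ 2) Rabs); [|apply continuous_Rabs].
    unfold Rdiv. clearbody r0. continuity_tac.
  (* The double root makes |r'| equal to |al' (r + r0) / r0^2| times |r - r0|, which is exactly a
     Gronwall bound; it is checked after squaring. *)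
  - intros t It. rewrite <- Rabs_mult. apply Rsqr_le_abs_0. right. unfold Rsqr.
    destruct (Hp t It) as (_ & _ & _ & _ & Hft). pose proof (Hr0 t It) as Hrt.
    rewrite Haa, Hlam in *.
    apply (Rmult_eq_reg_r (r t ^ 2)); [|apply pow_nonzero; lra].
    transitivity ((Derive r t * r t) ^ 2); [ring|]. rewrite Hft.
    unfold radicand. rewrite Haa. field. lra.
Qed.

(** * Differentiating the two integrals *)

Lemma continuous_inv_sqrt_radicand (a : R * R) (lam y : R) :
  0 < radicand a lam y -> continuous (fun u => / sqrt (radicand a lam u)) y.
Proof.
  intros H. apply (ex_derive_continuous (fun u => / sqrt (radicand a lam u))).
  unfold radicand in *. auto_derive. repeat split.
  - cbn in H |- *. lra.
  - apply Rgt_not_eq. apply sqrt_lt_R0. cbn in H |- *. lra.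
Qed.

Lemma is_derive_RInt_of_continuous (g : R -> R) (q0 q : R) :
  (forall y, Rmin q0 q <= y <= Rmax q0 q -> continuous g y) ->
  locally q (continuous g) ->
  is_derive (fun x => / 2 * RInt g q0 x) q (/ 2 * g q).
Proof.
  intros Hc Hl. apply is_derive_scal. apply (is_derive_RInt g (fun x => RInt g q0 x) q0 q); [|exact (locally_singleton _ _ Hl)].
  destruct (proj1 (locally_Rabs_iff _ _) Hl) as (d & Hd & Hin).
  apply locally_Rabs_iff. exists d. split; [exact Hd|]. intros x Hx. apply (RInt_correct g).
  apply (ex_RInt_continuous g). intros z Hz.
  destruct (Rlt_dec (Rabs (z - q)) d) as [L|L]; [now apply Hin|].
  apply Hc. apply Rabs_def2 in Hx.
  assert (Hz' : ~ (q - d < z < q + d)).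
  { intros K. apply L. apply Rabs_def1; lra. }
  unfold Rmin, Rmax in *. repeat destruct Rle_dec; lra.
Qed.

Lemma is_derive_x_int (a : R * R) (lam q0 q : R) :
  (forall y, Rmin q0 q <= y <= Rmax q0 q -> 0 < radicand a lam y) ->
  is_derive (x_int a lam q0) q (/ 2 * / sqrt (radicand a lam q)) /\
  is_derive (m_int a lam q0) q (/ 2 * (q / sqrt (radicand a lam q))).
Proof.
  intros Hpos.
  assert (L : locally q (fun y => 0 < radicand a lam y)).
  { apply continuous_gt_locally.
    - apply (ex_derive_continuous (radicand a lam)). unfold radicand. auto_derive. exact Logic.I.
    - apply Hpos. split; [apply Rmin_r|apply Rmax_r]. }
  assert (Hm : forall y, 0 < radicand a lam y -> continuous (fun u => u / sqrt (radicand a lam u)) y).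
  { intros y Hy. apply (continuous_Rmult (fun u => u)); [apply continuous_id|].
    now apply continuous_inv_sqrt_radicand. }
  split.
  - apply (is_derive_RInt_of_continuous (fun u => / sqrt (radicand a lam u))).
    + intros y Hy. apply continuous_inv_sqrt_radicand. now apply Hpos.
    + apply (filter_imp _ _) with (2 := L). intros y Hy. now apply continuous_inv_sqrt_radicand.
  - apply (is_derive_RInt_of_continuous (fun u => u / sqrt (radicand a lam u))).
    + intros y Hy. apply Hm. now apply Hpos.
    + apply (filter_imp _ _) with (2 := L). exact Hm.
Qed.

(** * Integrated profiles and symmetry *)

(** Since s is the sign of al' r', the positive root is sqrt (radicand (r^2)) = s r' r / al'. The
    chain rule along q = r^2 then gives x' = s al' and m' = s al' r^2, with s = 1 / s. The pair (b,
    k) stands for either coordinate of the center. *)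
Lemma piece_integrals (K : R -> Prop) (al r : R -> R) (a : R * R) (lam s u0 : R) :
  convex K -> K u0 -> s = 1 \/ s = -1 ->
  (forall u, K u -> ex_derive al u /\ ex_derive r u /\ 0 < r u /\
     0 < s * Derive al u * Derive r u /\
     (Derive r u * r u) ^ 2 = Derive al u ^ 2 * radicand a lam (r u ^ 2)) ->
  forall u, K u ->
    0 < radicand a lam (r u ^ 2) /\
    s * (al u - al u0) = x_int a lam (r u0 ^ 2) (r u ^ 2) /\
    forall b k, (forall t, K t -> is_derive b t (k * Derive al t * r t ^ 2)) ->
      b u - b u0 = m_int a lam (r u0 ^ 2) (r u ^ 2) * (s * k).
Proof.
  intros HK K0 Hs H.
  assert (Hss : s * s = 1) by (destruct Hs as [-> | ->]; ring).
  assert (Hsqrt : forall u, K u -> 0 < radicand a lam (r u ^ 2) /\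
     sqrt (radicand a lam (r u ^ 2)) = s * Derive r u * r u / Derive al u).
  { intros u Ku. destruct (H u Ku) as (_ & _ & Hr & Hsg & Hf).
    set (A := Derive al u) in *. set (r1 := Derive r u) in *. set (r0 := r u) in *.
    clearbody A r1 r0.
    assert (HA : A <> 0) by (intros ->; lra).
    assert (Hr1 : r1 <> 0) by (intros ->; lra).
    assert (E : radicand a lam (r0 ^ 2) = (s * r1 * r0 / A) ^ 2).
    { apply (Rmult_eq_reg_l (A ^ 2)); [|now apply pow_nonzero]. rewrite <- Hf.
      transitivity ((s * s) * (r1 * r0) ^ 2); [rewrite Hss; ring|field; exact HA]. }
    assert (Hp : 0 < s * r1 * r0 / A).
    { replace (s * r1 * r0 / A) with (s * A * r1 * (r0 * / (A ^ 2))) by (field; exact HA).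
      apply Rmult_lt_0_compat; [exact Hsg|]. apply Rmult_lt_0_compat; [exact Hr|].
      apply Rinv_0_lt_compat. nra. }
    rewrite E. split; [now apply pow_lt|]. rewrite <- Rsqr_pow2. apply sqrt_Rsqr. lra. }
  (* The integrals run over all values between the two radii squared; each of them is attained by
     r^2 on K, where the radicand is already known to be positive. *)
  assert (Hseg : forall u, K u -> forall y,
     Rmin (r u0 ^ 2) (r u ^ 2) <= y <= Rmax (r u0 ^ 2) (r u ^ 2) -> 0 < radicand a lam y).
  { intros u Ku y Hy.
    assert (Hc : forall t, K t -> continuous (fun t => r t ^ 2 - y) t).
    { intros t Kt. apply (continuous_Rminus (fun t => r t ^ 2) (fun _ => y));
        [apply continuous_Rpow2|apply continuous_const].
      apply (ex_derive_continuous r). apply (H t Kt). }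
    assert (Hm : exists t, K t /\ r t ^ 2 - y = 0).
    { assert (Hprod : (r u0 ^ 2 - y) * (r u ^ 2 - y) <= 0).
      { unfold Rmin, Rmax in Hy. destruct Rle_dec; nra. }
      destruct (Rle_dec u0 u) as [L|L].
      - destruct (IVT_zero (fun t => r t ^ 2 - y) u0 u L) as (t & Ht & Et); [|exact Hprod|].
        + intros t Ht. apply Hc. now apply (HK u0 u).
        + exists t. split; [now apply (HK u0 u)|exact Et].
      - destruct (IVT_zero (fun t => r t ^ 2 - y) u u0) as (t & Ht & Et); [lra| |lra|].
        + intros t Ht. apply Hc. now apply (HK u u0).
        + exists t. split; [now apply (HK u u0)|exact Et]. }
    destruct Hm as (t & Kt & Et). replace y with (r t ^ 2) by lra. now apply Hsqrt. }
  assert (Hd : forall t, K t ->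
    is_derive (fun x => x_int a lam (r u0 ^ 2) (r x ^ 2)) t (s * Derive al t) /\
    is_derive (fun x => m_int a lam (r u0 ^ 2) (r x ^ 2)) t (s * Derive al t * r t ^ 2)).
  { intros t Kt. destruct (H t Kt) as (_ & Er & Hr & Hsg & _).
    destruct (Hsqrt t Kt) as [Hpos Hsq].
    destruct (is_derive_x_int a lam (r u0 ^ 2) (r t ^ 2) (Hseg t Kt)) as [Dx Dm].
    rewrite Hsq in Dx, Dm.
    assert (HA : Derive al t <> 0) by (intros E; rewrite E in Hsg; lra).
    assert (Hr1 : Derive r t <> 0) by (intros E; rewrite E in Hsg; lra).
    assert (Hs0 : s <> 0) by (intros E; rewrite E in Hss; lra).
    assert (D2 : is_derive (fun x => r x ^ 2) t (2 * r t * Derive r t)).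
    { auto_derive; [exact Er|]. change (Derive (fun x : R => r x) t) with (Derive r t). ring. }
    split.
    - replace (s * Derive al t) with (2 * r t * Derive r t * (/ 2 * / (s * Derive r t * r t / Derive al t))).
      + exact (is_derive_comp (x_int a lam (r u0 ^ 2)) (fun x => r x ^ 2) t _ _ Dx D2).
      + transitivity (Derive al t * / s); [field; repeat split; try assumption; lra|].
        replace (/ s) with s; [ring|]. apply (Rmult_eq_reg_l s); [|exact Hs0].
        rewrite Rinv_r by exact Hs0. exact Hss.
    - replace (s * Derive al t * r t ^ 2)
        with (2 * r t * Derive r t * (/ 2 * (r t ^ 2 / (s * Derive r t * r t / Derive al t)))).
      + exact (is_derive_comp (m_int a lam (r u0 ^ 2)) (fun x => r x ^ 2) t _ _ Dm D2).
      + transitivity (Derive al t * / s * r t ^ 2); [field; repeat split; try assumption; lra|].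
        replace (/ s) with s; [ring|]. apply (Rmult_eq_reg_l s); [|exact Hs0].
        rewrite Rinv_r by exact Hs0. exact Hss. }
  assert (Hx0 : x_int a lam (r u0 ^ 2) (r u0 ^ 2) = 0).
  { unfold x_int. rewrite RInt_point. unfold zero; simpl. ring. }
  assert (Hm0 : m_int a lam (r u0 ^ 2) (r u0 ^ 2) = 0).
  { unfold m_int. rewrite RInt_point. unfold zero; simpl. ring. }
  intros u Ku. split; [now apply Hsqrt|split].
  - assert (E := derive_zero_const K (fun t => s * al t - x_int a lam (r u0 ^ 2) (r t ^ 2)) HK).
    assert (E' : s * al u - x_int a lam (r u0 ^ 2) (r u ^ 2)
               = s * al u0 - x_int a lam (r u0 ^ 2) (r u0 ^ 2)).
    { apply E; auto. intros t Kt.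
      replace 0 with (s * Derive al t - s * Derive al t) by ring.
      apply (is_derive_minus (fun t => s * al t) (fun t => x_int a lam (r u0 ^ 2) (r t ^ 2)));
        [|now apply Hd].
      apply is_derive_scal. apply Derive_correct. now apply H. }
    lra.
  - intros b k Hb.
    assert (E' : b u - m_int a lam (r u0 ^ 2) (r u ^ 2) * (s * k)
               = b u0 - m_int a lam (r u0 ^ 2) (r u0 ^ 2) * (s * k)).
    { apply (derive_zero_const K (fun t => b t - m_int a lam (r u0 ^ 2) (r t ^ 2) * (s * k)) HK);
        auto. intros t Kt.
      replace 0 with (k * Derive al t * r t ^ 2 - s * Derive al t * r t ^ 2 * (s * k)).
      - apply (is_derive_minus b (fun t => m_int a lam (r u0 ^ 2) (r t ^ 2) * (s * k)));
          [now apply Hb|].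
        apply (is_derive_scal_l (fun t => m_int a lam (r u0 ^ 2) (r t ^ 2)) t
          (s * Derive al t * r t ^ 2) (s * k)). now apply Hd.
      - transitivity (k * Derive al t * r t ^ 2 * (1 - s * s)); [ring|rewrite Hss; ring]. }
    rewrite Hm0 in E'. lra.
Qed.

(** The sign s reverses the axis when needed, so that the first coordinate increases with q. *)
Definition to_frame (e f p0 : L3) (s : R) (p : L3) : L3 :=
  let w := frame_coords e f (vsub p p0) in (s * x1 w, x2 w, x3 w).

Lemma rigid_motion_to_frame (e f p0 : L3) (s : R) : timelike_frame e f ->
  s = 1 \/ s = -1 -> rigid_motion (to_frame e f p0 s).
Proof.
  intros H Hs.
  exists (fun p => let w := frame_coords e f p in (s * x1 w, x2 w, x3 w)).
  exists (let w := frame_coords e f p0 in (- s * x1 w, - x2 w, - x3 w)).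
  split; [|split; [|split]].
  - intros p q. unfold frame_coords. set (n := lcross e f). clearbody n.
    apply L3_eq; vsimpl; ring.
  - intros k p. unfold frame_coords. set (n := lcross e f). clearbody n.
    apply L3_eq; vsimpl; ring.
  - intros p q. rewrite <- (frame_coords_isometry e f p q) by exact H. cbv zeta.
    set (w := frame_coords e f p). set (w' := frame_coords e f q). clearbody w w'.
    destruct Hs as [-> | ->]; vsimpl; ring.
  - intros p. unfold to_frame, frame_coords. set (n := lcross e f). clearbody n.
    apply L3_eq; vsimpl; ring.
Qed.

Lemma hyperbola_shape (S C : R) : C ^ 2 = 1 + S ^ 2 ->
  exists v, ((S = sinh v /\ C = cosh v) \/ (S = - sinh v /\ C = - cosh v)) /\
    (0 < C -> S = sinh v /\ C = cosh v).
Proof.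
  intros H. destruct (Rlt_dec 0 C) as [L|L].
  - destruct (hyperbola_param 1 S C) as (v & E1 & E2); [lra|exact L|lra|].
    exists v. rewrite !Rmult_1_l in *. auto.
  - destruct (hyperbola_param 1 (- S) (- C)) as (v & E1 & E2); [lra|nra|lra|].
    exists v. rewrite !Rmult_1_l in *. split; [right; split; lra|lra].
Qed.

Lemma reflection_involutive (p w y : L3) : lprod w w <> 0 ->
  reflection p w (reflection p w y) = y.
Proof.
  intros H. set (z := reflection p w y).
  assert (E : lprod w (vsub z p) = - lprod w (vsub y p)).
  { unfold z, reflection. set (k := 2 * lprod w (vsub y p) / lprod w w).
    transitivity (lprod w (vsub y p) - k * lprod w w).
    - clearbody k. clear H z. vsimpl. ring.
    - unfold k. field. exact H. }
  unfold reflection at 1. rewrite E. unfold z, reflection.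
  replace (2 * - lprod w (vsub y p) / lprod w w) with (- (2 * lprod w (vsub y p) / lprod w w))
    by (field; exact H).
  set (k := 2 * lprod w (vsub y p) / lprod w w). clearbody k. clear.
  apply L3_eq; vsimpl; ring.
Qed.

(** The center q lies on the mirror, so the reflection fixes it and acts isometrically on the plane
    of the leaf, preserving the hyperbola. If a3^2 - a2^2 > 0 the normal is spacelike and the
    reflection keeps the time orientation, hence each branch; a timelike normal exchanges the
    branches. *)
Lemma reflection_leaf (e f p q : L3) (a2 a3 rho v : R) :
  timelike_frame e f -> a3 ^ 2 - a2 ^ 2 <> 0 ->
  lprod (frame_map e f (0, a3, a2)) (vsub q p) = 0 ->
  exists v',
    (reflection p (frame_map e f (0, a3, a2)) (hyperbola e f q rho v) = hyperbola e f q rho v' \/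
     reflection p (frame_map e f (0, a3, a2)) (hyperbola e f q rho v) = hyperbola e f q (- rho) v') /\
    (0 < a3 ^ 2 - a2 ^ 2 ->
     reflection p (frame_map e f (0, a3, a2)) (hyperbola e f q rho v) = hyperbola e f q rho v').
Proof.
  intros H Hd Hq. set (w := frame_map e f (0, a3, a2)) in *.
  pose proof (cosh_sq v) as Ev.
  (* The multiple of (a3, a2) that the reflection subtracts from the unit vector (sinh v, cosh v);
     on the circle it is scaled by rho. *)
  set (k := 2 * (a3 * sinh v - a2 * cosh v) / (a3 ^ 2 - a2 ^ 2)).
  assert (Ek : k * (a3 ^ 2 - a2 ^ 2) = 2 * (a3 * sinh v - a2 * cosh v)).
  { unfold k. field. exact Hd. }
  assert (Hh : forall rho' v', hyperbola e f q rho' v'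
     = vadd q (frame_map e f (0, rho' * sinh v', rho' * cosh v'))).
  { intros rho' v'. unfold hyperbola, frame_map. set (n := lcross e f).
    set (C := cosh v'). set (S := sinh v'). clearbody n C S. clear.
    apply L3_eq; vsimpl; ring. }
  assert (Hww : lprod w w = a3 ^ 2 - a2 ^ 2).
  { unfold w. rewrite frame_map_isometry by exact H. clear. vsimpl. ring. }
  assert (Hr : reflection p w (hyperbola e f q rho v) =
     vadd q (frame_map e f (0, rho * (sinh v - k * a3), rho * (cosh v - k * a2)))).
  { unfold reflection. rewrite Hww, Hh.
    assert (E : lprod w (vsub (vadd q (frame_map e f (0, rho * sinh v, rho * cosh v))) p)
                = rho * (a3 * sinh v - a2 * cosh v)).
    { transitivity (lprod w (vsub q p) + lprod w (frame_map e f (0, rho * sinh v, rho * cosh v))).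
      - set (z := frame_map e f (0, rho * sinh v, rho * cosh v)). clearbody z w. clear.
        vsimpl. ring.
      - rewrite Hq. unfold w. rewrite frame_map_isometry by exact H.
        set (C := cosh v). set (S := sinh v). clearbody C S. clear. vsimpl. ring. }
    rewrite E.
    replace (2 * (rho * (a3 * sinh v - a2 * cosh v)) / (a3 ^ 2 - a2 ^ 2)) with (rho * k)
      by (unfold k; field; exact Hd).
    unfold w, frame_map. set (n := lcross e f). clearbody n k.
    set (C := cosh v). set (S := sinh v). clearbody C S. clear. apply L3_eq; vsimpl; ring. }
  destruct (hyperbola_shape (sinh v - k * a3) (cosh v - k * a2)) as (v' & Hor & Hpos).
  { transitivity (cosh v ^ 2 - sinh v ^ 2 + k * (2 * (a3 * sinh v - a2 * cosh v) - k * (a3 ^ 2 - a2 ^ 2))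
      + (sinh v - k * a3) ^ 2); [ring|].
    rewrite Ek, Ev. ring. }
  exists v'. rewrite Hr, !Hh. split.
  - destruct Hor as [[-> ->]|[-> ->]]; [now left|right].
    replace (rho * - sinh v') with (- rho * sinh v') by ring.
    now replace (rho * - cosh v') with (- rho * cosh v') by ring.
  - intros Hdp. destruct Hpos as [-> ->]; [|reflexivity].
    apply (Rmult_lt_reg_l (a3 ^ 2 - a2 ^ 2)); [exact Hdp|]. rewrite Rmult_0_r.
    replace ((a3 ^ 2 - a2 ^ 2) * (cosh v - k * a2))
      with ((a3 ^ 2 + a2 ^ 2) * cosh v - 2 * a2 * a3 * sinh v
            + a2 * (2 * (a3 * sinh v - a2 * cosh v) - k * (a3 ^ 2 - a2 ^ 2))) by ring.
    rewrite Ek.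
    pose proof (cosh_pos v). pose proof (Rabs_sinh_lt_cosh v) as Hab.
    apply Rabs_def2 in Hab. set (C := cosh v) in *. set (S := sinh v) in *. clearbody C S.
    (* Half of this sum is (a3^2 + a2^2) C - 2 a2 a3 S, and C > |S| makes both terms nonnegative. *)
    assert (0 < (a3 - a2) ^ 2 * (C + S) + (a3 + a2) ^ 2 * (C - S)).
    { assert (0 <= (a3 - a2) ^ 2) by nra. assert (0 <= (a3 + a2) ^ 2) by nra.
      assert (0 < (a3 - a2) ^ 2) by nra. nra. }
    nra.
Qed.

(** * Inverse branches *)

(** Carathéodory's form of the derivative: the increment is a product valid for every y, so no
    division by an increment that may vanish is ever made. *)
Lemma caratheodory (f : R -> R) (x l : R) :
  is_derive f x l ->
  exists phi, continuous phi x /\ phi x = l /\ forall y, f y - f x = phi y * (y - x).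
Proof.
  intros H. apply is_derive_Reals in H.
  exists (fun y => if Req_EM_T y x then l else (f y - f x) / (y - x)).
  split; [|split].
  - apply continuity_pt_continuous. intros eps Heps.
    destruct (H eps Heps) as [d Hd]. exists d. split; [apply cond_pos|].
    intros y [[_ Hne] Hy]. simpl in *. unfold R_dist in *.
    destruct (Req_EM_T x x) as [_|N]; [|now elim N].
    destruct (Req_EM_T y x) as [E|N]; [now elim Hne|].
    specialize (Hd (y - x)). replace (x + (y - x)) with y in Hd by ring.
    apply Hd; [lra|exact Hy].
  - destruct (Req_EM_T x x) as [_|N]; [reflexivity|now elim N].
  - intros y. destruct (Req_EM_T y x) as [->|N]; [ring|field; lra].
Qed.

Lemma is_derive_of_caratheodory (f phi : R -> R) (x : R) :
  continuous phi x -> locally x (fun y => f y - f x = phi y * (y - x)) ->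
  is_derive f x (phi x).
Proof.
  intros Hc Hl. apply is_derive_Reals. intros eps Heps.
  apply continuous_continuity_pt in Hc. destruct (Hc eps Heps) as (d1 & Hd1 & H1).
  destruct (proj1 (locally_Rabs_iff _ _) Hl) as (d2 & Hd2 & H2).
  assert (Hd : 0 < Rmin d1 d2) by now apply Rmin_glb_lt.
  exists (mkposreal _ Hd). intros h Hh Hhd. simpl in Hhd.
  pose proof (Rmin_l d1 d2). pose proof (Rmin_r d1 d2).
  rewrite (H2 (x + h)) by (replace (x + h - x) with h by ring; lra).
  replace (phi (x + h) * (x + h - x) / h) with (phi (x + h)) by (field; exact Hh).
  apply (H1 (x + h)). split.
  - split; [exact Logic.I|]. lra.
  - simpl. unfold R_dist. replace (x + h - x) with h by ring. lra.
Qed.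

Lemma derive_pos_increasing (Q : R -> Prop) (f f' : R -> R) :
  convex Q -> (forall t, Q t -> is_derive f t (f' t)) -> (forall t, Q t -> 0 < f' t) ->
  forall a b, Q a -> Q b -> a < b -> f a < f b.
Proof.
  intros HQ Hd Hp a b Qa Qb Hab.
  assert (Hin : forall t, Rmin a b <= t <= Rmax a b -> Q t).
  { rewrite Rmin_left, Rmax_right by lra. intros t Ht. now apply (HQ a b). }
  destruct (MVT_gen f a b f') as (t & Ht & E).
  - intros t Ht. apply Hd, Hin. lra.
  - intros t Ht. apply continuous_continuity_pt.
    apply (is_derive_continuous f t (f' t)). now apply Hd, Hin.
  - pose proof (Hp t (Hin t Ht)). nra.
Qed.

(** Here g is an arbitrary pointwise choice, not known to be continuous. Monotonicity of f traps g t
    between q0 - h and q0 + h as soon as P t lies between the values of f there; then the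
    Carathéodory factors of P and f can be divided. *)
Lemma is_derive_inverse_branch (Q : R -> Prop) (f f' g P : R -> R) (t0 l : R) :
  convex Q -> open Q ->
  (forall q, Q q -> is_derive f q (f' q)) -> (forall q, Q q -> 0 < f' q) ->
  locally t0 (fun t => Q (g t) /\ f (g t) = P t) ->
  is_derive P t0 l -> is_derive g t0 (l / f' (g t0)).
Proof.
  intros HQ HQo Hd Hp Hl HP.
  pose proof (derive_pos_increasing Q f f' HQ Hd Hp) as Hinc.
  destruct (locally_singleton _ _ Hl) as [Q0 E0].
  set (q0 := g t0) in *.
  assert (Hg : continuous g t0).
  { apply continuity_pt_continuous. intros eps Heps.
    destruct (proj1 (locally_Rabs_iff _ _) (HQo q0 Q0)) as (d & Hd0 & Hin).
    set (h := Rmin eps d / 2).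
    assert (0 < h /\ h < eps /\ h < d).
    { unfold h. pose proof (Rmin_l eps d). pose proof (Rmin_r eps d).
      assert (0 < Rmin eps d) by (apply Rmin_glb_lt; lra). lra. }
    assert (Q1 : Q (q0 - h)) by (apply Hin, Rabs_def1; lra).
    assert (Q2 : Q (q0 + h)) by (apply Hin, Rabs_def1; lra).
    assert (F1 : f (q0 - h) < P t0) by (rewrite <- E0; apply Hinc; auto; lra).
    assert (F2 : P t0 < f (q0 + h)) by (rewrite <- E0; apply Hinc; auto; lra).
    pose proof (is_derive_continuous P t0 l HP) as HPc.
    destruct (proj1 (locally_Rabs_iff _ _) (filter_and _ _ Hl (filter_and _ _
      (continuous_gt_locally P t0 _ HPc F1) (continuous_lt_locally P t0 _ HPc F2))))
      as (d' & Hd' & Hin').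
    exists d'. split; [exact Hd'|]. intros t [_ Ht]. simpl in *. unfold R_dist in *.
    destruct (Hin' t Ht) as ([Qt Et] & T1 & T2). rewrite <- Et in T1, T2. fold q0.
    assert (q0 - h < g t).
    { destruct (Rtotal_order (q0 - h) (g t)) as [L|[L|L]]; [exact L| |].
      - rewrite <- L in T1. lra.
      - pose proof (Hinc _ _ Qt Q1 L). lra. }
    assert (g t < q0 + h).
    { destruct (Rtotal_order (g t) (q0 + h)) as [L|[L|L]]; [exact L| |].
      - rewrite L in T2. lra.
      - pose proof (Hinc _ _ Q2 Qt L). lra. }
    apply Rabs_def1; lra. }
  destruct (caratheodory P t0 l HP) as (phiP & CP & VP & EP).
  destruct (caratheodory f q0 (f' q0) (Hd q0 Q0)) as (phif & Cf & Vf & Ef).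
  assert (Cfg : continuous (fun t => phif (g t)) t0) by now apply (continuous_comp g phif).
  pose proof (Hp q0 Q0) as Hpq.
  rewrite <- VP, <- Vf.
  apply (is_derive_of_caratheodory g (fun t => phiP t / phif (g t))).
  - apply (continuous_Rmult phiP (fun t => / phif (g t))); [exact CP|].
    apply (continuous_Rinv_comp (fun t => phif (g t))); [exact Cfg|]. fold q0. lra.
  - assert (Ln : locally t0 (fun t => phif (g t) <> 0)).
    { apply (continuous_nonzero_locally (fun t => phif (g t))); [exact Cfg|]. fold q0. lra. }
    apply (filter_imp _ _) with (2 := filter_and _ _ Hl Ln). intros t [[Qt Et] Nt]. fold q0.
    apply (Rmult_eq_reg_l (phif (g t))); [|exact Nt].
    rewrite <- Ef, Et. fold q0 in E0. rewrite E0, EP. field. exact Nt.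
Qed.

(** * Killing fields of rotation groups *)

Lemma is_derive_lprod (u w : R -> L3) (t : R) (u' w' : L3) :
  is_vderive u t u' -> is_vderive w t w' ->
  is_derive (fun s => lprod (u s) (w s)) t (lprod u' (w t) + lprod (u t) w').
Proof.
  intros (U1 & U2 & U3) (W1 & W2 & W3). unfold lprod.
  assert (Hm : forall f g f' g', is_derive f t f' -> is_derive g t g' ->
    is_derive (fun s => f s * g s) t (f' * g t + f t * g')).
  { intros f g f' g' Hf Hg. apply (is_derive_mult f g t f' g' Hf Hg). intros; apply Rmult_comm. }
  pose proof (Hm _ _ _ _ U1 W1) as M1. pose proof (Hm _ _ _ _ U2 W2) as M2.
  pose proof (Hm _ _ _ _ U3 W3) as M3.
  pose proof (is_derive_minus _ _ _ _ _ (is_derive_plus _ _ _ _ _ M1 M2) M3) as M.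
  cbv beta in M. unfold minus, plus, opp in M; simpl in M.
  match type of M with is_derive _ _ ?l => match goal with |- is_derive _ _ ?l' =>
    replace l' with l by ring end end.
  exact M.
Qed.

Lemma is_vderive_lin (u w : R -> L3) (t k j : R) (u' w' : L3) :
  is_vderive u t u' -> is_vderive w t w' ->
  is_vderive (fun s => vadd (vscal k (u s)) (vscal j (w s))) t (vadd (vscal k u') (vscal j w')).
Proof.
  intros (U1 & U2 & U3) (W1 & W2 & W3).
  split; [|split]; unfold vadd, vscal; cbn [x1 x2 x3 fst snd].
  - apply (is_derive_plus (fun s => k * x1 (u s)) (fun s => j * x1 (w s))); now apply is_derive_scal.
  - apply (is_derive_plus (fun s => k * x2 (u s)) (fun s => j * x2 (w s))); now apply is_derive_scal.
  - apply (is_derive_plus (fun s => k * x3 (u s)) (fun s => j * x3 (w s))); now apply is_derive_scal.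
Qed.

(** The three coefficients k, j and 1 - k - j sum to 1, so the translation part passes through
    unchanged. *)
Lemma rigid_motion_affine (T : L3 -> L3) (p q : L3) (k j : R) : rigid_motion T ->
  T (vadd (vscal k p) (vscal j q)) =
  vadd (vadd (vscal k (T p)) (vscal j (T q))) (vscal (1 - k - j) (T vzero)).
Proof.
  intros (A & b & Ha & Hs & _ & HT). rewrite !HT, Ha, !Hs.
  assert (E0 : A vzero = vzero).
  { replace vzero with (vscal 0 vzero) by (apply L3_eq; vsimpl; ring). rewrite Hs.
    set (z := A vzero). clearbody z. apply L3_eq; vsimpl; ring. }
  rewrite E0. generalize (A p) (A q) b. clear. intros. apply L3_eq; vsimpl; ring.
Qed.

Lemma rigid_motion_lprod (T : L3 -> L3) (p q : L3) : rigid_motion T ->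
  lprod (vsub (T p) (T vzero)) (vsub (T q) (T vzero)) = lprod p q.
Proof.
  intros (A & b & Ha & Hs & Hi & HT). rewrite <- (Hi p q), !HT.
  assert (E0 : A vzero = vzero).
  { replace vzero with (vscal 0 vzero) by (apply L3_eq; vsimpl; ring). rewrite Hs.
    set (z := A vzero). clearbody z. apply L3_eq; vsimpl; ring. }
  rewrite E0. generalize (A p) (A q) b. clear. intros. vsimpl. ring.
Qed.

Lemma rigid_motion_injective (T : L3 -> L3) (p q : L3) : rigid_motion T -> T p = T q -> p = q.
Proof.
  intros HT E.
  assert (H : forall w, lprod (vsub p q) w = 0).
  { intros w.
    transitivity (lprod p w - lprod q w); [clear; vsimpl; ring|].
    rewrite <- (rigid_motion_lprod T p w HT), <- (rigid_motion_lprod T q w HT), E. ring. }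
  pose proof (H (1, 0, 0)) as W1. pose proof (H (0, 1, 0)) as W2. pose proof (H (0, 0, 1)) as W3.
  clear - W1 W2 W3. apply L3_eq; vsimpl; lra.
Qed.

(** By the group law phi 0 is idempotent, and rigid motions are injective because the form is
    non-degenerate. *)
Lemma rotation_group_0 (phi : R -> L3 -> L3) (p : L3) : rotation_group phi -> phi 0 p = p.
Proof.
  intros (Hr & Hg & _). apply (rigid_motion_injective (phi 0)); [apply Hr|].
  rewrite <- Hg. now rewrite Rplus_0_r.
Qed.

(** The velocity field V at time 0 is affine because each phi t is, and its linear part L is skew
    for the metric because each phi t is isometric; skew maps are cross products. If om were 0, V
    would be constant, hence zero because of the fixed axis, and the group would be trivial. *)
Lemma rotation_group_killing (phi : R -> L3 -> L3) : rotation_group phi ->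
  exists om b, om <> vzero /\
    forall p, is_vderive (fun t => phi t p) 0 (vadd b (lcross om p)).
Proof.
  intros Hphi. pose proof (fun p => rotation_group_0 phi p Hphi) as H0.
  destruct Hphi as (Hr & Hg & Hs & (p0 & d & _ & Hfix) & (t1 & p1 & Hne)).
  set (V := fun p => vDerive (fun t => phi t p) 0).
  assert (HV : forall p, is_vderive (fun t => phi t p) 0 (V p)).
  { intros p. destruct (Hs p) as (S1 & S2 & S3).
    split; [|split]; apply Derive_correct;
      [exact (S1 1%nat 0 Logic.I)|exact (S2 1%nat 0 Logic.I)|exact (S3 1%nat 0 Logic.I)]. }
  set (e1 := (1, 0, 0) : L3). set (e2 := (0, 1, 0) : L3). set (e3 := (0, 0, 1) : L3).
  set (L := fun p => vsub (V p) (V vzero)).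
  assert (Hlin : forall p q k j, V (vadd (vscal k p) (vscal j q)) =
    vadd (vadd (vscal k (V p)) (vscal j (V q))) (vscal (1 - k - j) (V vzero))).
  { intros p q k j. unfold V at 1.
    apply is_vderive_unique.
    apply (is_vderive_ext_loc (fun t => vadd (vadd (vscal k (phi t p)) (vscal j (phi t q)))
      (vscal (1 - k - j) (phi t vzero)))).
    - apply filter_forall. intros t. symmetry. now apply rigid_motion_affine.
    - set (W := fun t => vadd (vscal k (phi t p)) (vscal j (phi t q))).
      assert (HW : is_vderive W 0 (vadd (vscal k (V p)) (vscal j (V q)))) by now apply is_vderive_lin.
      pose proof (is_vderive_lin W (fun t => phi t vzero) 0 1 (1 - k - j) _ _ HW (HV vzero)) as HH.
      replace (vadd (vadd (vscal k (V p)) (vscal j (V q))) (vscal (1 - k - j) (V vzero)))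
        with (vadd (vscal 1 (vadd (vscal k (V p)) (vscal j (V q)))) (vscal (1 - k - j) (V vzero))).
      + apply (is_vderive_ext_loc _ _ _ _) with (2 := HH). apply filter_forall. intros t.
        unfold W. generalize (phi t p) (phi t q) (phi t vzero). clear. intros.
        apply L3_eq; vsimpl; ring.
      + generalize (V p) (V q) (V vzero). clear. intros. apply L3_eq; vsimpl; ring. }
  assert (Hskew : forall p q, lprod (L p) q + lprod p (L q) = 0).
  { intros p q.
    assert (Hd : forall p, is_vderive (fun t => vsub (phi t p) (phi t vzero)) 0 (L p)).
    { intros p'. pose proof (is_vderive_lin (fun t => phi t p') (fun t => phi t vzero) 0 1 (-1) _ _
        (HV p') (HV vzero)) as HH.
      replace (L p') with (vadd (vscal 1 (V p')) (vscal (-1) (V vzero))).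
      - apply (is_vderive_ext_loc _ _ _ _) with (2 := HH). apply filter_forall. intros t.
        generalize (phi t p') (phi t vzero). clear. intros. apply L3_eq; vsimpl; ring.
      - unfold L. generalize (V p') (V vzero). clear. intros. apply L3_eq; vsimpl; ring. }
    pose proof (is_derive_lprod _ _ _ _ _ (Hd p) (Hd q)) as HH. cbv beta in HH.
    rewrite !H0 in HH.
    assert (Ez : forall p, vsub p vzero = p) by (intros; apply L3_eq; vsimpl; ring).
    rewrite !Ez in HH. apply is_derive_unique in HH. rewrite <- HH.
    rewrite (Derive_ext _ (fun _ => lprod p q)); [apply Derive_const|].
    intros t. now apply rigid_motion_lprod. }
  (* Read off from [lcross om e1] = (0, o3, o2) and [lcross om e2] = (- o3, 0, - o1). *)
  set (om := (- x3 (L e2), x3 (L e1), x2 (L e1)) : L3).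
  assert (HL : forall p, L p = lcross om p).
  { intros p.
    assert (Hcomb : L p = vadd (vscal (x1 p) (L e1)) (vadd (vscal (x2 p) (L e2)) (vscal (x3 p) (L e3)))).
    { assert (Ep : p = vadd (vscal (x1 p) e1) (vscal 1 (vadd (vscal (x2 p) e2) (vscal (x3 p) e3)))).
      { unfold e1, e2, e3. clear. apply L3_eq; vsimpl; ring. }
      unfold L at 1. rewrite Ep at 1. rewrite Hlin, Hlin. unfold L.
      generalize (V e1) (V e2) (V e3) (V vzero) (x1 p) (x2 p) (x3 p). clear. intros.
      apply L3_eq; vsimpl; ring. }
    rewrite Hcomb. unfold om.
    pose proof (Hskew e1 e1) as K11. pose proof (Hskew e2 e2) as K22. pose proof (Hskew e3 e3) as K33.
    pose proof (Hskew e1 e2) as K12. pose proof (Hskew e1 e3) as K13. pose proof (Hskew e2 e3) as K23.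
    revert K11 K22 K33 K12 K13 K23. generalize (L e1) (L e2) (L e3). clear.
    intros l1 l2 l3. unfold e1, e2, e3. clear. intros K11 K22 K33 K12 K13 K23.
    destruct l1 as [[l11 l12] l13], l2 as [[l21 l22] l23], l3 as [[l31 l32] l33], p as [[p1 p2] p3].
    vsimpl.
    assert (l11 = 0) by lra. assert (l22 = 0) by lra. assert (l33 = 0) by lra.
    assert (l21 = - l12) by lra. assert (l31 = l13) by lra. assert (l32 = l23) by lra.
    subst. apply L3_eq; vsimpl; ring. }
  assert (HVb : forall p, V p = vadd (V vzero) (lcross om p)).
  { intros p. rewrite <- HL. unfold L. generalize (V p) (V vzero). clear. intros.
    apply L3_eq; vsimpl; ring. }
  exists om, (V vzero). split.
  - intros Eom. rewrite Eom in HVb.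
    assert (Hconst : forall p, V p = V vzero).
    { intros p. rewrite HVb. generalize (V vzero). clear. intros. apply L3_eq; vsimpl; ring. }
    set (P0 := vadd p0 (vscal 0 d)).
    assert (V0 : V P0 = vzero).
    { unfold V. apply is_vderive_unique.
      apply (is_vderive_ext_loc (fun _ => P0)).
      - apply filter_forall. intros t. symmetry. apply Hfix.
      - split; [|split]; apply @is_derive_const. }
    assert (Hz : forall p, V p = vzero) by (intros p; rewrite Hconst, <- (Hconst P0); exact V0).
    (* The group law carries the vanishing velocity from time 0 to every time s, through the point
       phi s p. *)
    assert (Hall : forall p s, is_vderive (fun t => phi t p) s vzero).
    { intros p s. pose proof (HV (phi s p)) as (D1 & D2 & D3). rewrite Hz in D1, D2, D3.
      assert (Hsh : forall g : L3 -> R, is_derive (fun t => g (phi t (phi s p))) 0 0 ->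
                  is_derive (fun t => g (phi t p)) s 0).
      { intros g Hgd.
        assert (Eg : forall t : R, g (phi (t - s) (phi s p)) = g (phi t p)).
        { intros t. rewrite <- Hg. now replace (t - s + s) with t by ring. }
        apply (is_derive_ext (fun t => g (phi (t - s) (phi s p)))).
        - exact Eg.
        - replace 0 with (1 * 0) by ring.
          apply (is_derive_comp (fun t => g (phi t (phi s p))) (fun t => t - s) s 0 1).
          + now replace (s - s) with 0 by ring.
          + auto_derive; [exact Logic.I|ring]. }
      split; [|split]; [now apply (Hsh x1)|now apply (Hsh x2)|now apply (Hsh x3)]. }
    apply Hne. rewrite <- (H0 p1) at 2.
    assert (HT : convex (fun _ => True)) by now intros a b t.
    apply L3_eq.
    + apply (derive_zero_const _ (fun t => x1 (phi t p1)) HT); auto. intros t _. apply (Hall p1 t).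
    + apply (derive_zero_const _ (fun t => x2 (phi t p1)) HT); auto. intros t _. apply (Hall p1 t).
    + apply (derive_zero_const _ (fun t => x3 (phi t p1)) HT); auto. intros t _. apply (Hall p1 t).
  - intros p. rewrite <- HVb. apply HV.
Qed.

(** * The one-parameter family *)

Definition inv_sqrt_rad (a : R * R) (lam u : R) : R := / sqrt (radicand a lam u).
Definition radicand' (a : R * R) (lam u : R) : R :=
  - lprod2 a a * (3 * u ^ 2) + lam * (2 * u) + 1.

(** The generators are reciprocals of square roots because the derivative of such a reciprocal is a
    polynomial in it and the derivative of the radicand, so the class is closed under
    differentiation; sqrt itself is u times 1 / sqrt u. *)
Inductive radical_class (a : R * R) (lam q0 : R) : (R -> R) -> Prop :=
| rc_const k : radical_class a lam q0 (fun _ => k)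
| rc_id : radical_class a lam q0 (fun u => u)
| rc_inv_sqrt : radical_class a lam q0 (fun u => / sqrt u)
| rc_inv_sqrt_rad : radical_class a lam q0 (inv_sqrt_rad a lam)
| rc_x_int : radical_class a lam q0 (x_int a lam q0)
| rc_m_int : radical_class a lam q0 (m_int a lam q0)
| rc_add g h : radical_class a lam q0 g -> radical_class a lam q0 h ->
    radical_class a lam q0 (fun u => g u + h u)
| rc_mul g h : radical_class a lam q0 g -> radical_class a lam q0 h ->
    radical_class a lam q0 (fun u => g u * h u).

Lemma is_derive_Rmult (f g : R -> R) (t f' g' : R) :
  is_derive f t f' -> is_derive g t g' ->
  is_derive (fun s => f s * g s) t (f' * g t + f t * g').
Proof.
  intros Hf Hg. apply (is_derive_mult f g t f' g' Hf Hg). intros; apply Rmult_comm.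
Qed.

Lemma is_derive_inv_sqrt (f : R -> R) (t l : R) :
  is_derive f t l -> 0 < f t ->
  is_derive (fun s => / sqrt (f s)) t (- / 2 * l * ((/ sqrt (f t)) * (/ sqrt (f t) * / sqrt (f t)))).
Proof.
  intros Hf Hp. pose proof (sqrt_lt_R0 _ Hp) as Hs.
  auto_derive.
  - repeat split; [now exists l|exact Hp|lra].
  - rewrite (is_derive_unique (fun x : R => f x) t l) by exact Hf. field. lra.
Qed.

Section Family.

Variables (lam : R) (a : R * R) (Q : R -> Prop) (q0 : R).
Hypothesis Hadm : admissible a lam Q.
Hypothesis HQ0 : Q q0.

Lemma admissible_open : open Q.
Proof. exact (proj1 (proj2 (proj1 Hadm))). Qed.

Lemma admissible_convex : convex Q.
Proof. exact (proj2 (proj2 (proj1 Hadm))). Qed.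

Lemma is_derive_radicand (q : R) : is_derive (radicand a lam) q (radicand' a lam q).
Proof. unfold radicand, radicand'. auto_derive; [exact Logic.I|ring]. Qed.

Lemma inv_sqrt_rad_pos (q : R) : Q q -> 0 < inv_sqrt_rad a lam q.
Proof. intros Hq. apply Rinv_0_lt_compat, sqrt_lt_R0. now apply Hadm. Qed.

Lemma inv_sqrt_rad_sq (q : R) : Q q -> inv_sqrt_rad a lam q ^ 2 * radicand a lam q = 1.
Proof.
  intros Hq. destruct Hadm as [_ H]. destruct (H q Hq) as [_ Hp].
  unfold inv_sqrt_rad. pose proof (sqrt_lt_R0 _ Hp). rewrite <- (sqrt_sqrt (radicand a lam q)) at 2 by lra.
  field. lra.
Qed.

Lemma is_derive_inv_sqrt_rad (q : R) : Q q ->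
  is_derive (inv_sqrt_rad a lam) q (- / 2 * radicand' a lam q * inv_sqrt_rad a lam q ^ 3).
Proof.
  intros Hq. replace (inv_sqrt_rad a lam q ^ 3)
    with (inv_sqrt_rad a lam q * (inv_sqrt_rad a lam q * inv_sqrt_rad a lam q)) by ring.
  apply (is_derive_inv_sqrt (radicand a lam)); [apply is_derive_radicand|now apply Hadm].
Qed.

Lemma is_derive_integrals (q : R) : Q q ->
  is_derive (x_int a lam q0) q (/ 2 * inv_sqrt_rad a lam q) /\
  is_derive (m_int a lam q0) q (/ 2 * (q * inv_sqrt_rad a lam q)).
Proof.
  intros Hq. apply is_derive_x_int. intros y Hy.
  assert (Qy : Q y).
  { apply (admissible_convex (Rmin q0 q) (Rmax q0 q)); [| |exact Hy].
    - unfold Rmin. now destruct Rle_dec.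
    - unfold Rmax. now destruct Rle_dec. }
  now apply Hadm.
Qed.

Lemma smooth_radical_class (g : R -> R) : radical_class a lam q0 g -> smooth_on Q g.
Proof.
  apply smooth_on_of_derivation; [apply admissible_open|]. clear g. intros g Hg.
  induction Hg as [k| | | | | |g h Hg (g' & Fg & Dg) Hh (h' & Fh & Dh)
    |g h Hg (g' & Fg & Dg) Hh (h' & Fh & Dh)].
  - exists (fun _ => 0). split; [constructor|]. intros t _. apply @is_derive_const.
  - exists (fun _ => 1). split; [constructor|]. intros t _. apply @is_derive_id.
  - exists (fun u => - / 2 * 1 * ((/ sqrt u) * (/ sqrt u * / sqrt u))).
    split; [repeat (apply rc_mul || apply rc_const || apply rc_inv_sqrt)|].
    intros t Ht. apply (is_derive_inv_sqrt (fun u => u)); [apply @is_derive_id|now apply Hadm].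
  - exists (fun u => - / 2 * radicand' a lam u * inv_sqrt_rad a lam u ^ 3). split.
    + unfold radicand'. cbn [pow].
      repeat (apply rc_const || apply rc_id || apply rc_inv_sqrt_rad || apply rc_add || apply rc_mul).
    + exact is_derive_inv_sqrt_rad.
  - exists (fun u => / 2 * inv_sqrt_rad a lam u). split.
    + repeat (apply rc_const || apply rc_inv_sqrt_rad || apply rc_mul).
    + intros t Ht. now apply is_derive_integrals.
  - exists (fun u => / 2 * (u * inv_sqrt_rad a lam u)). split.
    + repeat (apply rc_const || apply rc_id || apply rc_inv_sqrt_rad || apply rc_mul).
    + intros t Ht. now apply is_derive_integrals.
  - exists (fun u => g' u + h' u). split; [now apply rc_add|].
    intros t Ht. apply (is_derive_plus g h); [now apply Dg|now apply Dh].
  - exists (fun u => g' u * h u + g u * h' u). split; [apply rc_add; now apply rc_mul|].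
    intros t Ht. apply is_derive_Rmult; [now apply Dg|now apply Dh].
Qed.

Lemma smooth_sqrt : smooth_on Q sqrt.
Proof.
  apply (smooth_on_ext Q (fun u => u * / sqrt u)); [apply admissible_open| |].
  - intros t Ht. destruct Hadm as [_ H]. destruct (H t Ht) as [Hp _].
    pose proof (sqrt_lt_R0 _ Hp). rewrite <- (sqrt_sqrt t) at 1 by lra. field. lra.
  - apply smooth_radical_class. apply rc_mul; [apply rc_id|apply rc_inv_sqrt].
Qed.

Lemma riemann_surface_frame_map (q v : R) :
  riemann_surface a lam q0 q v = frame_map (0, 1, 0) (0, 0, 1)
    (x_int a lam q0 q, m_int a lam q0 q * fst a + sqrt q * sinh v,
     m_int a lam q0 q * snd a + sqrt q * cosh v).
Proof.
  unfold riemann_surface, riemann_center, frame_map.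
  generalize (x_int a lam q0 q) (m_int a lam q0 q) (sqrt q) (sinh v) (cosh v).
  intros. apply L3_eq; vsimpl; ring.
Qed.

Lemma timelike_frame_std : timelike_frame (0, 1, 0) (0, 0, 1).
Proof. split; [|split]; vsimpl; ring. Qed.

Lemma open_strip : open (fun z : R * R => Q (fst z)).
Proof.
  intros [q v] Hq. destruct (admissible_open q Hq) as [eps He]. exists eps.
  intros [q' v'] [H1 _]. now apply He.
Qed.

Lemma Derive_radii (q : R) : Q q ->
  Derive sqrt q = / (2 * sqrt q) /\ Derive (Derive sqrt) q = - / (4 * sqrt q ^ 3).
Proof.
  intros Hq.
  assert (D1 : forall t, Q t -> is_derive sqrt t (/ (2 * sqrt t))).
  { intros t Ht. destruct Hadm as [_ H]. destruct (H t Ht) as [Hp _].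
    apply is_derive_Reals. now apply derivable_pt_lim_sqrt. }
  split; [now apply is_derive_unique, D1|].
  rewrite (Derive_ext_loc (Derive sqrt) (fun t => / 2 * / sqrt t)).
  - destruct Hadm as [_ H]. destruct (H q Hq) as [Hp _]. pose proof (sqrt_lt_R0 _ Hp) as Hs.
    apply is_derive_unique.
    replace (- / (4 * sqrt q ^ 3)) with (/ 2 * (- / 2 * 1 * ((/ sqrt q) * (/ sqrt q * / sqrt q))))
      by (field; lra).
    apply is_derive_scal. apply (is_derive_inv_sqrt (fun u => u)); [apply @is_derive_id|exact Hp].
  - apply (filter_imp Q); [|now apply admissible_open]. intros t Ht.
    rewrite (is_derive_unique _ _ _ (D1 t Ht)). apply Rinv_mult.
Qed.

Lemma Derive_centers (k q : R) : Q q ->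
  let w := inv_sqrt_rad a lam q in
  Derive (x_int a lam q0) q = / 2 * w /\
  Derive (Derive (x_int a lam q0)) q = - / 4 * radicand' a lam q * w ^ 3 /\
  Derive (fun u => m_int a lam q0 u * k) q = / 2 * (q * w) * k /\
  Derive (Derive (fun u => m_int a lam q0 u * k)) q
    = / 2 * (w - / 2 * q * radicand' a lam q * w ^ 3) * k.
Proof.
  intros Hq w.
  assert (Dm : forall t, Q t ->
    is_derive (fun u => m_int a lam q0 u * k) t (/ 2 * (t * inv_sqrt_rad a lam t) * k)).
  { intros t Ht. apply (is_derive_scal_l (m_int a lam q0) t _ k). now apply is_derive_integrals. }
  split; [|split; [|split]].
  - now apply is_derive_unique, is_derive_integrals.
  - rewrite (Derive_ext_loc _ (fun t => / 2 * inv_sqrt_rad a lam t)).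
    + apply is_derive_unique.
      replace (- / 4 * radicand' a lam q * w ^ 3) with (/ 2 * (- / 2 * radicand' a lam q * w ^ 3))
        by field.
      apply is_derive_scal. now apply is_derive_inv_sqrt_rad.
    + apply (filter_imp Q); [|now apply admissible_open]. intros t Ht.
      now apply is_derive_unique, is_derive_integrals.
  - now apply is_derive_unique, Dm.
  - rewrite (Derive_ext_loc _ (fun t => / 2 * (t * inv_sqrt_rad a lam t) * k)).
    + apply is_derive_unique.
      apply (is_derive_scal_l (fun t => / 2 * (t * inv_sqrt_rad a lam t)) q _ k).
      apply is_derive_scal.
      replace (w - / 2 * q * radicand' a lam q * w ^ 3)
        with (1 * inv_sqrt_rad a lam q + q * (- / 2 * radicand' a lam q * w ^ 3)) by (unfold w; field).
      apply (is_derive_Rmult (fun t => t)); [apply @is_derive_id|now apply is_derive_inv_sqrt_rad].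
    + apply (filter_imp Q); [|now apply admissible_open]. intros t Ht.
      now apply is_derive_unique, Dm.
Qed.

Lemma family_coefs (q : R) : Q q ->
  let al := x_int a lam q0 in
  let be := fun u => m_int a lam q0 u * fst a in
  let ga := fun u => m_int a lam q0 u * snd a in
  coef_lin al sqrt be q = 0 /\ coef_lin al sqrt ga q = 0 /\ coef_const al be ga sqrt q = 0.
Proof.
  intros Hq al be ga.
  destruct (Derive_radii q Hq) as [R1 R2].
  destruct (Derive_centers (fst a) q Hq) as (A1 & A2 & B1 & B2).
  destruct (Derive_centers (snd a) q Hq) as (_ & _ & G1 & G2).
  fold be in B1, B2. fold ga in G1, G2. fold al in A1, A2.
  pose proof (inv_sqrt_rad_sq q Hq) as W2.
  destruct Hadm as [_ H]. destruct (H q Hq) as [Hp _].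
  pose proof (sqrt_lt_R0 _ Hp) as Hs. pose proof (sqrt_sqrt q (Rlt_le _ _ Hp)) as Hss.
  unfold coef_lin, coef_const. rewrite A1, A2, B1, B2, G1, G2, R1, R2.
  unfold radicand in W2. unfold radicand', lprod2 in *.
  clear A1 A2 B1 B2 G1 G2 R1 R2. clearbody al be ga.
  set (w := inv_sqrt_rad a lam q) in *. set (r0 := sqrt q) in *. clearbody w r0.
  destruct a as [a2 a3]. cbn [fst snd] in *. subst q.
  split; [|split]; [field; lra|field; lra|].
  (* The third coefficient is a multiple of w^2 radicand - 1, which vanishes because w is the
     reciprocal of the square root. *)
  match goal with |- ?x = 0 =>
    transitivity (w * / (8 * r0) * (w ^ 2 * (- (a2 * a2 - a3 * a3) * (r0 * r0) ^ 3
      + lam * (r0 * r0) ^ 2 + r0 * r0) - 1) * (2 / r0)) end.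
  - field. lra.
  - rewrite W2. ring.
Qed.

Lemma family_foliated :
  foliated_by_spacelike_circles Q (fun z => Q (fst z)) (riemann_surface a lam q0)
    (0, 1, 0) (0, 0, 1) (riemann_center a lam q0) sqrt.
Proof.
  split; [apply Hadm|]. split; [apply open_strip|]. split; [now intros u v|].
  split; [intros u Hu; now exists 0|]. split; [now intros u v1 v2 v|].
  split; [apply timelike_frame_std|].
  assert (Hm : forall k, smooth_on Q (fun u => m_int a lam q0 u * k)).
  { intros k. apply smooth_radical_class. apply rc_mul; [apply rc_m_int|apply rc_const]. }
  split; [|split; [exact smooth_sqrt|split]].
  - split; [|split].
    + apply (smooth_radical_class (x_int a lam q0)). apply rc_x_int.
    + apply (Hm (fst a)).
    + apply (Hm (snd a)).
  - intros u Hu. apply sqrt_lt_R0. now apply Hadm.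
  - intros u v _. unfold riemann_surface, hyperbola. generalize (riemann_center a lam q0 u).
    intros p. generalize (sqrt u) (sinh v) (cosh v). intros. apply L3_eq; vsimpl; ring.
Qed.

Lemma family_immersed_zmc :
  immersed (fun z => Q (fst z)) (riemann_surface a lam q0) /\
  zero_mean_curvature (fun z => Q (fst z)) (riemann_surface a lam q0).
Proof.
  pose (D := fun z : R * R => Q (fst z)).
  assert (HDI : forall u v, D (u, v) -> Q u) by now intros.
  set (al := x_int a lam q0). set (be := fun u => m_int a lam q0 u * fst a).
  set (ga := fun u => m_int a lam q0 u * snd a).
  assert (HX : forall u v, D (u, v) -> riemann_surface a lam q0 u v
     = frame_map (0, 1, 0) (0, 0, 1) (al u, be u + sqrt u * sinh v, ga u + sqrt u * cosh v)).
  { intros u v _. apply riemann_surface_frame_map. }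
  destruct family_foliated as (_ & _ & _ & _ & _ & _ & (S1 & S2 & S3) & S4 & Hr0 & _).
  pose proof (smooth_on_C2 Q al S1) as Cal. pose proof (smooth_on_C2 Q be S2) as Cbe.
  pose proof (smooth_on_C2 Q ga S3) as Cga. pose proof (smooth_on_C2 Q sqrt S4) as Cr.
  split.
  - intros u v Hp.
    apply (immersed_sweep Q D _ _ _ al be ga sqrt open_strip HDI timelike_frame_std HX Cal Cbe Cga Cr
      u v Hp (Hr0 u Hp)).
    left. destruct (Derive_centers 0 u Hp) as (E & _). unfold al. rewrite E.
    pose proof (inv_sqrt_rad_pos u Hp). lra.
  - intros u v Hp Hd. apply mean_curvature_zero_iff; [exact Hd|].
    rewrite (zmc_expr_sweep Q D _ _ _ al be ga sqrt open_strip HDI timelike_frame_std HX Cal Cbe Cga Cr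
      u v Hp).
    destruct (family_coefs u Hp) as (E1 & E2 & E3). fold al be ga in E1, E2, E3.
    rewrite E1, E2, E3. ring.
Qed.

Lemma other_point : exists q1, Q q1 /\ q0 < q1.
Proof.
  destruct (proj1 (locally_Rabs_iff _ _) (admissible_open q0 HQ0)) as (d & Hd & Hin).
  exists (q0 + d / 2). split; [|lra]. apply Hin. apply Rabs_def1; lra.
Qed.

Lemma sqrt_nonconstant : nonconstant_on Q sqrt.
Proof.
  intros [rho H]. destruct other_point as (q1 & Q1 & L).
  destruct Hadm as [_ Hp].
  assert (sqrt q0 < sqrt q1) by (apply sqrt_lt_1; [apply Rlt_le, Hp|apply Rlt_le, Hp|]; assumption).
  rewrite (H q0 HQ0), (H q1 Q1) in H0. lra.
Qed.

(* The surface is a graph over its parameters because x_int is increasing, so a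
   curve in it has differentiable parameter q. *)
Lemma family_tangent (q v : R) (P : R -> L3) (V : L3) : Q q ->
  P 0 = riemann_surface a lam q0 q v -> is_vderive P 0 V ->
  locally 0 (fun t => surface_image (fun z => Q (fst z)) (riemann_surface a lam q0) (P t)) ->
  (q * (fst a * sinh v - snd a * cosh v) - / (inv_sqrt_rad a lam q * sqrt q)) * x1 V
  - sinh v * x2 V + cosh v * x3 V = 0.
Proof.
  intros Hq HP0 (V1 & V2 & V3) HS.
  (* The points P t are only known to lie in the image, so their parameter q is chosen pointwise.
     The parameter v is eliminated through the equation of the hyperbola, whose radius squared is
     q. *)
  set (g := fun t => epsilon (inhabits 0) (fun s => Q s /\ x_int a lam q0 s = x1 (P t) /\
     (x3 (P t) - m_int a lam q0 s * snd a) ^ 2 - (x2 (P t) - m_int a lam q0 s * fst a) ^ 2 = s)).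
  assert (Hcoord : forall s w p, Q s -> p = riemann_surface a lam q0 s w ->
     Q s /\ x_int a lam q0 s = x1 p /\
     (x3 p - m_int a lam q0 s * snd a) ^ 2 - (x2 p - m_int a lam q0 s * fst a) ^ 2 = s).
  { intros s w p Hs ->. split; [exact Hs|].
    pose proof (cosh_sq w) as E. destruct Hadm as [_ Hpos]. destruct (Hpos s Hs) as [Hp _].
    pose proof (sqrt_sqrt s (Rlt_le _ _ Hp)) as Ess.
    unfold riemann_surface, riemann_center.
    revert E Ess. generalize (x_int a lam q0 s) (m_int a lam q0 s) (sqrt s) (sinh w) (cosh w).
    clear. intros x m r S C E Ess. vsimpl. split; [ring|].
    rewrite <- Ess. ring [E]. }
  assert (Hg : locally 0 (fun t => Q (g t) /\ x_int a lam q0 (g t) = x1 (P t) /\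
     (x3 (P t) - m_int a lam q0 (g t) * snd a) ^ 2
     - (x2 (P t) - m_int a lam q0 (g t) * fst a) ^ 2 = g t)).
  { apply (filter_imp _ _) with (2 := HS). intros t (s & w & Hs & Et).
    unfold g. apply (epsilon_spec (inhabits 0)). exists s. now apply (Hcoord s w). }
  assert (Hd1 : forall s, Q s -> is_derive (x_int a lam q0) s (/ 2 * inv_sqrt_rad a lam s)).
  { intros s Hs. now apply is_derive_integrals. }
  assert (Hd2 : forall s, Q s -> 0 < / 2 * inv_sqrt_rad a lam s).
  { intros s Hs. pose proof (inv_sqrt_rad_pos s Hs). lra. }
  assert (Hg0 : g 0 = q).
  { destruct (locally_singleton _ _ Hg) as (G1 & G2 & _).
    rewrite HP0 in G2. change (x1 (riemann_surface a lam q0 q v)) with (x_int a lam q0 q + sqrt q * 0) in G2.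
    pose proof (derive_pos_increasing Q _ _ admissible_convex Hd1 Hd2) as Hinc.
    destruct (Rtotal_order (g 0) q) as [L|[L|L]]; [|exact L|].
    - pose proof (Hinc _ _ G1 Hq L). lra.
    - pose proof (Hinc _ _ Hq G1 L). lra. }
  assert (Dg : is_derive g 0 (x1 V / (/ 2 * inv_sqrt_rad a lam (g 0)))).
  { apply (is_derive_inverse_branch Q (x_int a lam q0) (fun s => / 2 * inv_sqrt_rad a lam s) g
      (fun t => x1 (P t)) 0 (x1 V) admissible_convex admissible_open Hd1 Hd2); [|exact V1].
    apply (filter_imp _ _) with (2 := Hg). intros t (T1 & T2 & _). now split. }
  rewrite Hg0 in Dg. set (g' := x1 V / (/ 2 * inv_sqrt_rad a lam q)) in *.
  assert (Dm : is_derive (fun t => m_int a lam q0 (g t)) 0 (g' * (/ 2 * (q * inv_sqrt_rad a lam q)))).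
  { apply (is_derive_comp (m_int a lam q0) g 0 (/ 2 * (q * inv_sqrt_rad a lam q)) g'); [|exact Dg].
    rewrite Hg0. now apply is_derive_integrals. }
  set (m' := g' * (/ 2 * (q * inv_sqrt_rad a lam q))) in *.
  set (m := fun t => m_int a lam q0 (g t)) in *.
  (* The hyperbola equation differentiated along the curve; since g' = 2 x1 V / w, dividing by 2
     sqrt q yields the stated linear condition on V. *)
  assert (E : 2 * (x3 (P 0) - m 0 * snd a) * (x3 V - m' * snd a)
            - 2 * (x2 (P 0) - m 0 * fst a) * (x2 V - m' * fst a) - g' = 0).
  { apply (derive_locally_zero (fun t => (x3 (P t) - m t * snd a) ^ 2
       - (x2 (P t) - m t * fst a) ^ 2 - g t) 0).
    - set (P2 := fun t => x2 (P t)) in *. set (P3 := fun t => x3 (P t)) in *.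
      change (x2 (P 0)) with (P2 0). change (x3 (P 0)) with (P3 0).
      change (is_derive (fun t => (P3 t - m t * snd a) ^ 2 - (P2 t - m t * fst a) ^ 2 - g t) 0
        (2 * (P3 0 - m 0 * snd a) * (x3 V - m' * snd a)
            - 2 * (P2 0 - m 0 * fst a) * (x2 V - m' * fst a) - g')).
      change (is_derive P2 0 (x2 V)) in V2. change (is_derive P3 0 (x3 V)) in V3.
      change (is_derive m 0 m') in Dm.
      clearbody P2 P3 m g. clear - V2 V3 Dm Dg.
      auto_derive.
      + repeat split; first [now exists m'|now exists g'|now exists (x3 V)|now exists (x2 V)].
      + rewrite (is_derive_unique (fun x : R => P3 x) 0 (x3 V)) by assumption.
        rewrite (is_derive_unique (fun x : R => P2 x) 0 (x2 V)) by assumption.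
        rewrite (is_derive_unique (fun x : R => m x) 0 m') by assumption.
        rewrite (is_derive_unique (fun x : R => g x) 0 g') by assumption. ring.
    - apply (filter_imp _ _) with (2 := Hg). intros t (_ & _ & T). unfold m. lra. }
  unfold m in E. rewrite Hg0, HP0 in E.
  change (x3 (riemann_surface a lam q0 q v)) with (m_int a lam q0 q * snd a + sqrt q * cosh v) in E.
  change (x2 (riemann_surface a lam q0 q v)) with (m_int a lam q0 q * fst a + sqrt q * sinh v) in E.
  destruct Hadm as [_ Hpos]. destruct (Hpos q Hq) as [Hp _].
  pose proof (sqrt_lt_R0 _ Hp) as Hs. pose proof (inv_sqrt_rad_pos q Hq) as Hw.
  unfold m', g' in E. clear - E Hs Hw.
  apply (Rmult_eq_reg_l (2 * sqrt q)); [|lra]. rewrite Rmult_0_r, <- E. field. lra.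
Qed.

Lemma family_not_rotational : a <> (0, 0) ->
  ~ rotational (surface_image (fun z => Q (fst z)) (riemann_surface a lam q0)).
Proof.
  intros Ha (phi & Hphi & Hinv).
  pose proof (fun p => rotation_group_0 phi p Hphi) as H0.
  destruct (rotation_group_killing phi Hphi) as (om & b & Hom & HV).
  destruct om as [[o1 o2] o3], b as [[b1 b2] b3].
  set (a2 := fst a). set (a3 := snd a).
  assert (Ha' : ~ (a2 = 0 /\ a3 = 0)).
  { intros [E2 E3]. apply Ha. rewrite (surjective_pairing a). fold a2 a3. now rewrite E2, E3. }
  set (x := x_int a lam q0) in *. set (m := m_int a lam q0) in *.
  set (w := inv_sqrt_rad a lam).
  assert (Hq : forall q, Q q ->
    (- / (w q * sqrt q) * (b1 + m q * (o2 * a3 - o3 * a2)) - q * sqrt q * (a3 * o2) = 0) /\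
    (q * a2 * (b1 + m q * (o2 * a3 - o3 * a2)) + / (w q * sqrt q) * sqrt q * o3
      - (b2 + o3 * x q - o1 * (m q * a3)) = 0) /\
    (- q * a3 * (b1 + m q * (o2 * a3 - o3 * a2)) - / (w q * sqrt q) * sqrt q * o2
      + (b3 + o2 * x q - o1 * (m q * a2)) = 0) /\
    (- q * sqrt q * (a2 * o3 + a3 * o2) = 0) /\ (q * sqrt q * (a2 * o2 + a3 * o3) = 0)).
  (* Inserting the Killing field into the tangency condition gives, for fixed q, a quadratic
     expression in sinh v and cosh v that vanishes for all v; these are its five coefficients. *)
  { intros q Hq.
    apply (hyp_quadratic_independent 1); [lra|]. intros v _.
    assert (HT : (q * (a2 * sinh v - a3 * cosh v) - / (w q * sqrt q))
        * x1 (vadd (b1, b2, b3) (lcross (o1, o2, o3) (riemann_surface a lam q0 q v)))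
      - sinh v * x2 (vadd (b1, b2, b3) (lcross (o1, o2, o3) (riemann_surface a lam q0 q v)))
      + cosh v * x3 (vadd (b1, b2, b3) (lcross (o1, o2, o3) (riemann_surface a lam q0 q v))) = 0).
    { pose proof (family_tangent q v (fun t => phi t (riemann_surface a lam q0 q v))) as FT.
      apply FT; [exact Hq|apply H0|apply HV|].
      destruct (Hinv (riemann_surface a lam q0 q v)) as (d & Hd & Hin).
      { now exists q, v. }
      apply locally_Rabs_iff. exists d. split; [exact Hd|]. intros t Ht. apply Hin.
      now rewrite Rminus_0_r in Ht. }
    rewrite <- HT. pose proof (cosh_sq v) as E. unfold riemann_surface, riemann_center. fold x m.
    fold a2 a3. revert E. generalize (x q) (m q) (w q * sqrt q) (sqrt q) (sinh v) (cosh v). clearbody a2 a3. clear.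
    intros xq mq wr r S C E. vsimpl. ring [E]. }
  pose proof inv_sqrt_rad_pos as Hw. fold w in Hw.
  assert (Hpos : forall q, Q q -> 0 < q /\ 0 < sqrt q /\ 0 < w q).
  { intros q Qq. destruct Hadm as [_ Hp]. destruct (Hp q Qq) as [P1 _].
    split; [exact P1|split; [now apply sqrt_lt_R0|now apply Hw]]. }
  destruct other_point as (q1 & Q1 & L01).
  destruct (Hq q0 HQ0) as (K1 & K2 & K3 & K4 & K5).
  destruct (Hpos q0 HQ0) as (P0 & S0 & W0).
  assert (N4 : a2 * o3 + a3 * o2 = 0).
  { apply Rmult_integral in K4. destruct K4 as [K|K]; [|exact K].
    exfalso. assert (0 < q0 * sqrt q0) by now apply Rmult_lt_0_compat. lra. }
  assert (N5 : a2 * o2 + a3 * o3 = 0).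
  { apply Rmult_integral in K5. destruct K5 as [K|K]; [|exact K].
    exfalso. assert (0 < q0 * sqrt q0) by now apply Rmult_lt_0_compat. lra. }
  (* The two quadratic coefficients form a linear system for (o2, o3) with determinant a3^2 - a2^2
     up to sign. *)
  assert (Hdet2 : (a3 ^ 2 - a2 ^ 2) * o2 = 0).
  { transitivity (a3 * (a2 * o3 + a3 * o2) - a2 * (a2 * o2 + a3 * o3)); [ring|rewrite N4, N5; ring]. }
  assert (Hdet3 : (a3 ^ 2 - a2 ^ 2) * o3 = 0).
  { transitivity (a3 * (a2 * o2 + a3 * o3) - a2 * (a2 * o3 + a3 * o2)); [ring|rewrite N4, N5; ring]. }
  destruct (classic (o2 = 0 /\ o3 = 0)) as [[-> ->]|Ho].
  (* Only a boost about an axis parallel to x1 and a translation remain. The linear coefficients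
     then equate constants b2 and b3 with o1 m a3 and o1 m a2, although m strictly increases. *)
  - assert (Hb1 : b1 = 0).
    { assert (Hz : / (w q0 * sqrt q0) * b1 = 0) by lra.
      apply Rmult_integral in Hz. destruct Hz as [Hz|Hz]; [|exact Hz].
      exfalso. assert (0 < / (w q0 * sqrt q0)).
      { apply Rinv_0_lt_compat. now apply Rmult_lt_0_compat. }
      lra. }
    subst b1. destruct (Hq q1 Q1) as (_ & K2' & K3' & _).
    assert (Ho1 : o1 <> 0) by (intros ->; now apply Hom).
    assert (Hm : m q0 < m q1).
    { apply (derive_pos_increasing Q m (fun q => / 2 * (q * w q)) admissible_convex); auto.
      - intros t Ht. now apply is_derive_integrals.
      - intros t Ht. destruct (Hpos t Ht) as (T1 & _ & T3).
        assert (0 < t * w t) by now apply Rmult_lt_0_compat. lra. }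
    assert (Hz : forall k, o1 * (m q0 * k) = o1 * (m q1 * k) -> k = 0).
    { intros k Hk. assert (Hk' : (m q1 - m q0) * k = 0).
      { apply (Rmult_eq_reg_l o1); [lra|exact Ho1]. }
      apply Rmult_integral in Hk'. destruct Hk'; lra. }
    apply Ha'. split; apply Hz; lra.
  - assert (Haa : a3 ^ 2 - a2 ^ 2 = 0).
    { destruct (Req_dec (a3 ^ 2 - a2 ^ 2) 0) as [E|E]; [exact E|]. exfalso. apply Ho.
      split; [apply Rmult_integral in Hdet2|apply Rmult_integral in Hdet3]; tauto. }
    assert (Hk : a3 * o2 <> 0).
    { intros Z. assert (Ha3 : a3 <> 0).
      { intros E. apply Ha'. split; [|exact E]. rewrite E in Haa. nra. }
      assert (o2 = 0) by (apply Rmult_integral in Z; tauto). subst o2.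
      apply Ho. split; [reflexivity|].
      assert (Z' : a3 * o3 = 0) by lra. apply Rmult_integral in Z'. tauto. }
    (* Here a is null, and o3 a2 = - o2 a3 turns the constant coefficient, multiplied by - w sqrt q,
       into a relation between m and q^2 w alone. *)
    assert (Hcst : forall q, Q q -> b1 + 2 * (a3 * o2) * m q + (a3 * o2) * (q * q * w q) = 0).
    { intros q Qq. destruct (Hq q Qq) as (K & _). destruct (Hpos q Qq) as (T1 & T2 & T3).
      pose proof (sqrt_sqrt q (Rlt_le _ _ T1)) as Ess.
      replace (o2 * a3 - o3 * a2) with (2 * (a3 * o2)) in K by lra.
      set (rt := sqrt q) in *.
      assert (K' : - (w q * rt) * (- / (w q * rt) * (b1 + m q * (2 * (a3 * o2))) - q * rt * (a3 * o2)) = 0).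
      { rewrite K. ring. }
      rewrite <- K'. transitivity (b1 + 2 * (a3 * o2) * m q + a3 * o2 * (q * (rt * rt) * w q));
        [now rewrite Ess|field; lra]. }
    (* Differentiating that relation gives 6 radicand = q radicand'; with <a, a> = 0 and after
       division by q this is 4 lam q + 5 = 0, which cannot hold at two points. *)
    assert (Hlin : forall q, Q q -> 4 * lam * q + 5 = 0).
    { intros q Qq. destruct (Hpos q Qq) as (T1 & T2 & T3).
      pose proof (is_derive_integrals q Qq) as [_ Dm].
      pose proof (is_derive_inv_sqrt_rad q Qq) as Dw.
      pose proof (inv_sqrt_rad_sq q Qq) as W2.
      fold m w in Dm, Dw, W2.
      assert (E : 2 * (a3 * o2) * (/ 2 * (q * w q)) + (a3 * o2) * ((1 * q + q * 1) * w q
         + q * q * (- / 2 * radicand' a lam q * w q ^ 3)) = 0).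
      { apply (derive_locally_zero (fun q => (b1 + 2 * (a3 * o2) * m q) + (a3 * o2) * (q * q * w q)) q).
        - apply (is_derive_plus (fun q => b1 + 2 * (a3 * o2) * m q) (fun q => (a3 * o2) * (q * q * w q))).
          + now apply is_derive_affine.
          + apply is_derive_scal. apply (is_derive_Rmult (fun q => q * q) w); [|exact Dw].
            apply (is_derive_Rmult (fun q => q) (fun q => q)); apply @is_derive_id.
        - apply (filter_imp Q); [exact Hcst|now apply admissible_open]. }
      unfold radicand', lprod2 in E. unfold radicand, lprod2 in W2. fold a2 a3 in E, W2.
      replace (a2 * a2 - a3 * a3) with 0 in E, W2 by lra.
      assert (E2 : (a3 * o2) * (w q * (6 - w q ^ 2 * (q * (lam * (2 * q) + 1)))) = 0).
      { apply (Rmult_eq_reg_l (q / 2)); [|lra]. rewrite Rmult_0_r, <- E. field. }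
      apply Rmult_integral in E2. destruct E2 as [E2|E2]; [easy|].
      apply Rmult_integral in E2. destruct E2 as [E2|E2]; [lra|].
      assert (E3 : w q ^ 2 * q * (4 * lam * q + 5) = 0).
      { transitivity (6 * (w q ^ 2 * (- 0 * q ^ 3 + lam * q ^ 2 + q)) - 6
                      + (6 - w q ^ 2 * (q * (lam * (2 * q) + 1)))); [ring|].
        rewrite W2, E2. ring. }
      apply Rmult_integral in E3. destruct E3 as [E3|E3]; [|exact E3].
      exfalso. assert (0 < w q ^ 2 * q) by (apply Rmult_lt_0_compat; [now apply pow_lt|exact T1]). lra. }
    pose proof (Hlin q0 HQ0) as L0. pose proof (Hlin q1 Q1) as L1.
    assert (Hz : lam * (q1 - q0) = 0) by lra.
    apply Rmult_integral in Hz. destruct Hz as [Hz|Hz]; [subst; lra|lra].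
Qed.

End Family.

(** Near q = 0 the linear term dominates: for 0 < q < 1 / (1 + k) the other two terms are at most k
    q^2 < q in absolute value. *)
Lemma admissible_exists (lam : R) (a : R * R) : exists Q, admissible a lam Q.
Proof.
  set (k := Rabs lam + Rabs (lprod2 a a)).
  assert (Hk : 0 <= k).
  { unfold k. pose proof (Rabs_pos lam). pose proof (Rabs_pos (lprod2 a a)). lra. }
  assert (He : 0 < / (1 + k)) by (apply Rinv_0_lt_compat; lra).
  exists (fun q => 0 < q /\ q < / (1 + k)). split.
  - split; [|split].
    + exists (/ (1 + k) / 2). lra.
    + apply open_and; [apply open_gt|apply open_lt].
    + intros x y t Hx Hy Ht. lra.
  - intros q [Hq0 Hq1]. split; [exact Hq0|].
    assert (Hqk : q * (1 + k) < 1).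
    { apply (Rmult_lt_compat_r (1 + k)) in Hq1; [|lra]. rewrite Rinv_l in Hq1; lra. }
    assert (Hq2 : q < 1) by nra.
    unfold radicand. replace (- lprod2 a a * q ^ 3 + lam * q ^ 2 + q)
      with (q * (1 + lam * q - lprod2 a a * q * q)) by ring.
    apply Rmult_lt_0_compat; [exact Hq0|].
    assert (A1 : - Rabs lam <= lam) by (pose proof (Rle_abs (- lam)); rewrite Rabs_Ropp in *; lra).
    assert (A2 : lprod2 a a <= Rabs (lprod2 a a)) by apply Rle_abs.
    pose proof (Rabs_pos (lprod2 a a)).
    assert (B1 : - Rabs lam * q <= lam * q) by (apply Rmult_le_compat_r; lra).
    assert (B2 : lprod2 a a * (q * q) <= Rabs (lprod2 a a) * (q * q)) by (apply Rmult_le_compat_r; nra).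
    assert (B3 : Rabs (lprod2 a a) * (q * q) <= Rabs (lprod2 a a) * q)
      by (apply Rmult_le_compat_l; nra).
    unfold k in Hqk. lra.
Qed.

Theorem theorem4p2 :
  (forall (I : R -> Prop) (D : R * R -> Prop) (X : R -> R -> L3)
          (e f : L3) (c : R -> L3) (r : R -> R),
     riemann_ZMC_example I D X e f c r ->
     nonconstant_on I r ->
     exists (lam : R) (a : R * R),
       a <> (0, 0) /\
       (* the pieces on which q = r^2 is a parameter fill the surface densely *)
       (forall u eps, I u -> 0 < eps ->
          exists u', I u' /\ Rabs (u' - u) < eps /\ Derive r u' <> 0) /\
       (* each such piece is, up to a rigid motion, the surface X(q,v) *)
       (forall (K : R -> Prop) (u0 : R),
          is_open_interval K ->
          (forall u, K u -> I u /\ Derive r u <> 0) ->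
          K u0 ->
          exists (T : L3 -> L3) (s : R),
            rigid_motion T /\ (s = 1 \/ s = -1) /\
            let a' := (s * fst a, s * snd a) in
            (forall u, K u -> 0 < radicand a' lam (r u ^ 2)) /\
            (forall u v, K u -> D (u, v) ->
               T (X u v) = riemann_surface a' lam (r u0 ^ 2) (r u ^ 2) v)) /\
       (* the centers lie in a plane, and the surface is symmetric about it *)
       (exists p w : L3,
          w <> vzero /\
          (forall u, I u -> on_plane p w (c u)) /\
          (lprod2 a a <> 0 -> symmetric_about p w (swept_full I e f c r)) /\
          (lprod2 a a < 0 -> symmetric_about p w (swept_branch I e f c r))))
  /\
  (forall (lam : R) (a : R * R),
     a <> (0, 0) ->
     (exists Q, admissible a lam Q) /\
     (forall (Q : R -> Prop) (q0 : R),
        admissible a lam Q -> Q q0 ->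
        riemann_ZMC_example Q (fun z => Q (fst z)) (riemann_surface a lam q0)
          (0, 1, 0) (0, 0, 1) (riemann_center a lam q0) sqrt /\
        nonconstant_on Q sqrt)).
Proof.
  split.
  - intros I D X e f c r Hex Hnc.
    destruct (riemann_example_profile I D X e f c r Hex) as (lam & a & Ha & Hp).
    destruct Hex as (Hfol & _).
    destruct Hfol as ((Hne & HIo & HIc) & HD & HDI & Hfib & _ & H & Hc & Hr & Hr0 & HX0).
    destruct (smooth_coords I e f c HIo Hc) as (Hal & Hbe & Hga).
    assert (HX : forall u v, D (u, v) -> X u v = frame_map e f
       (ax e f c u, ay e f c u + r u * sinh v, az e f c u + r u * cosh v)).
    { intros u v Hd. rewrite (HX0 u v Hd). now apply hyperbola_frame_map. }
    assert (Hcm : forall u, c u = frame_map e f (ax e f c u, ay e f c u, az e f c u)).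
    { intros u. rewrite <- (frame_map_coords e f (c u)) at 1 by exact H. reflexivity. }
    set (al := ax e f c) in *. set (be := ay e f c) in *. set (ga := az e f c) in *.
    clearbody al be ga.
    exists lam, a. split; [exact Ha|split; [|split]].
    + now apply (radius_regular_dense I al be ga r a lam).
    + intros K u0 (_ & HKo & HKc) HKI K0.
      (* On the interval K neither al' nor r' vanishes, so al' r' keeps one sign; this sign is s. *)
      assert (Hsg : forall u v, K u -> K v ->
        0 < (Derive al u * Derive r u) * (Derive al v * Derive r v)).
      { intros u v Ku Kv.
        apply (nonvanishing_same_sign K (fun t => Derive al t * Derive r t)); auto.
        - intros t Kt. destruct (HKI t Kt) as [It _].
          apply continuous_Rmult; [apply (smooth_on_continuous2 I al t Hal It)
            |apply (smooth_on_continuous2 I r t Hr It)].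
        - intros t Kt. destruct (HKI t Kt) as [It N].
          apply Rmult_integral_contrapositive_currified; [now apply (Hp t It)|exact N]. }
      assert (exists s, (s = 1 \/ s = -1) /\ forall u, K u -> 0 < s * Derive al u * Derive r u)
        as (s & Hs & Hss).
      { destruct (Rlt_dec 0 (Derive al u0 * Derive r u0)) as [L|L].
        - exists 1. split; [now left|]. intros u Ku. pose proof (Hsg u u0 Ku K0). nra.
        - exists (-1). split; [now right|]. intros u Ku. pose proof (Hsg u u0 Ku K0). nra. }
      (* The center c u0 goes to the origin because the integrals are normalized to vanish at
         r(u0)^2. *)
      exists (to_frame e f (c u0) s), s.
      split; [now apply rigid_motion_to_frame|split; [exact Hs|]]. cbv zeta.
      set (a' := (s * fst a, s * snd a)).
      assert (HP := piece_integrals K al r a' lam s u0 HKc K0 Hs).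
      assert (HP' : forall u, K u ->
        0 < radicand a' lam (r u ^ 2) /\
        s * (al u - al u0) = x_int a' lam (r u0 ^ 2) (r u ^ 2) /\
        (forall b k, (forall t, K t -> is_derive b t (k * Derive al t * r t ^ 2)) ->
          b u - b u0 = m_int a' lam (r u0 ^ 2) (r u ^ 2) * (s * k))).
      { apply HP. intros u Ku. destruct (HKI u Ku) as [Iu _].
        split; [apply (smooth_on_C2 I al Hal u Iu)|].
        split; [apply (smooth_on_C2 I r Hr u Iu)|].
        split; [now apply Hr0|]. split; [now apply Hss|].
        unfold a'. rewrite radicand_swap_sign by exact Hs. apply (Hp u Iu). }
      clear HP. split; [intros u Ku; now apply HP'|].
      intros u v Ku Hd. destruct (HKI u Ku) as [Iu _].
      destruct (HP' u Ku) as (_ & Ex & Em).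
      assert (Eb : be u - be u0 = m_int a' lam (r u0 ^ 2) (r u ^ 2) * (s * fst a)).
      { apply Em. intros t Kt. destruct (HKI t Kt) as [It _].
        destruct (Hp t It) as (_ & Eb & _). rewrite <- Eb.
        apply Derive_correct. now apply (smooth_on_C2 I be Hbe). }
      assert (Eg : ga u - ga u0 = m_int a' lam (r u0 ^ 2) (r u ^ 2) * (s * snd a)).
      { apply Em. intros t Kt. destruct (HKI t Kt) as [It _].
        destruct (Hp t It) as (_ & _ & Eg & _). rewrite <- Eg.
        apply Derive_correct. now apply (smooth_on_C2 I ga Hga). }
      unfold to_frame. rewrite (HX u v Hd), (Hcm u0).
      replace (vsub (frame_map e f (al u, be u + r u * sinh v, ga u + r u * cosh v))
         (frame_map e f (al u0, be u0, ga u0)))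
        with (frame_map e f (al u - al u0, be u + r u * sinh v - be u0, ga u + r u * cosh v - ga u0)).
      2:{ unfold frame_map. set (n := lcross e f). clearbody n.
          generalize (al u) (al u0) (be u) (be u0) (ga u) (ga u0) (r u) (sinh v) (cosh v). clear.
          intros. apply L3_eq; vsimpl; ring. }
      rewrite frame_coords_map by exact H. cbv zeta.
      assert (Hsq : sqrt (r u ^ 2) = r u).
      { rewrite <- Rsqr_pow2. apply sqrt_Rsqr. pose proof (Hr0 u Iu). lra. }
      unfold riemann_surface, riemann_center. rewrite Hsq, <- Ex.
      change (fst a') with (s * fst a). change (snd a') with (s * snd a). rewrite <- Eb, <- Eg.
      generalize (al u) (al u0) (be u) (be u0) (ga u) (ga u0) (r u) (sinh v) (cosh v). clear.
      intros. apply L3_eq; vsimpl; ring.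
    + destruct Hne as [u0 I0]. destruct a as [a2 a3].
      (* In the frame the centers move with velocity al' (1, a2 r^2, a3 r^2), which is orthogonal to
         (0, a3, a2) for the Lorentzian product. This normal has square - <a, a>: it is null exactly
         when no reflection exists, and spacelike when <a, a> < 0. *)
      exists (c u0), (frame_map e f (0, a3, a2)).
      assert (Hw : lprod (frame_map e f (0, a3, a2)) (frame_map e f (0, a3, a2)) = a3 ^ 2 - a2 ^ 2).
      { rewrite frame_map_isometry by exact H. clear. vsimpl. ring. }
      assert (Haa : lprod2 (a2, a3) (a2, a3) = - (a3 ^ 2 - a2 ^ 2)).
      { unfold lprod2. cbn [fst snd]. ring. }
      assert (Hplane : forall u, I u -> lprod (frame_map e f (0, a3, a2)) (vsub (c u) (c u0)) = 0).
      { intros u Iu. rewrite (Hcm u), (Hcm u0).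
        replace (vsub (frame_map e f (al u, be u, ga u)) (frame_map e f (al u0, be u0, ga u0)))
          with (frame_map e f (al u - al u0, be u - be u0, ga u - ga u0)).
        2:{ unfold frame_map. set (n := lcross e f). clearbody n.
            generalize (al u) (al u0) (be u) (be u0) (ga u) (ga u0). clear.
            intros. apply L3_eq; vsimpl; ring. }
        rewrite frame_map_isometry by exact H.
        assert (E : a3 * be u - a2 * ga u = a3 * be u0 - a2 * ga u0).
        { apply (derive_zero_const I (fun t => a3 * be t - a2 * ga t)); auto.
          intros t It. destruct (Hp t It) as (_ & Eb & Eg & _). cbn [fst snd] in Eb, Eg.
          replace 0 with (a3 * Derive be t - a2 * Derive ga t) by (rewrite Eb, Eg; ring).
          apply (is_derive_minus (fun t => a3 * be t) (fun t => a2 * ga t));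
            apply is_derive_scal; apply Derive_correct;
            [now apply (smooth_on_C2 I be Hbe)|now apply (smooth_on_C2 I ga Hga)]. }
        clear - E. vsimpl. lra. }
      set (w := frame_map e f (0, a3, a2)) in *.
      split; [|split; [|split]].
      * intros Ew. apply Ha. change vzero with (0, 0, 0) in Ew.
        assert (Ew' : frame_map e f (0, a3, a2) = frame_map e f (0, 0, 0)).
        { fold w. rewrite Ew. unfold frame_map. set (n := lcross e f). clearbody n. clear.
          apply L3_eq; vsimpl; ring. }
        apply frame_map_inj in Ew'; [|exact H]. injection Ew' as -> ->. reflexivity.
      * exact Hplane.
      * intros Hn. assert (Hd : a3 ^ 2 - a2 ^ 2 <> 0) by lra.
        split; [now rewrite Hw|].
        assert (Himp : forall y, swept_full I e f c r y -> swept_full I e f c r (reflection (c u0) w y)).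
        { intros y (u & v & Iu & Hy).
          (* A negative radius describes the opposite branch, so the same statement about leaves
             serves both branches. *)
          destruct Hy as [-> | ->].
          - destruct (reflection_leaf e f (c u0) (c u) a2 a3 (r u) v H Hd (Hplane u Iu))
              as (v' & [E|E] & _); exists u, v'; (split; [exact Iu|]); [now left|now right].
          - destruct (reflection_leaf e f (c u0) (c u) a2 a3 (- r u) v H Hd (Hplane u Iu))
              as (v' & [E|E] & _); exists u, v'; (split; [exact Iu|]); [now right|left].
            now rewrite Ropp_involutive in E. }
        intros y. split; [apply Himp|]. intros Hy. apply Himp in Hy.
        rewrite reflection_involutive in Hy; [exact Hy|now rewrite Hw].
      * intros Hn. assert (Hd : 0 < a3 ^ 2 - a2 ^ 2) by lra.
        assert (Hd' : a3 ^ 2 - a2 ^ 2 <> 0) by lra.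
        split; [now rewrite Hw|].
        assert (Himp : forall y, swept_branch I e f c r y -> swept_branch I e f c r (reflection (c u0) w y)).
        { intros y (u & v & Iu & ->).
          destruct (reflection_leaf e f (c u0) (c u) a2 a3 (r u) v H Hd' (Hplane u Iu))
            as (v' & _ & E). exists u, v'. split; [exact Iu|]. now apply E. }
        intros y. split; [apply Himp|]. intros Hy. apply Himp in Hy.
        rewrite reflection_involutive in Hy; [exact Hy|now rewrite Hw].
  - intros lam a Ha. split; [apply admissible_exists|].
    intros Q q0 Hadm HQ0. split; [split; [|split; [|split]]|].
    + now apply family_foliated.
    + now apply family_immersed_zmc.
    + now apply family_immersed_zmc.
    + now apply family_not_rotational.
    + now apply (sqrt_nonconstant lam a Q q0).
Qed.
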